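(* Let $\Psi=\{\psi_x\}_{x\in X}\subset\mathcal H$ be a continuous tight frame with frame bound $A$, let $m$ be an admissible weight on $X\times X$ with $K_\Psi\in\mathcal A_m$, fix $z_0\in X$ and put $v:=m(\cdot,z_0)$. Let $Y$ be a solid Banach space of functions on $X$ such that $K(F)\in Y$ and $\|K(F)\|_Y\le\|K\|_{\mathcal A_m}\|F\|_Y$ for all $K\in\mathcal A_m$, $F\in Y$, and such that $K_\Psi(Y)\subset \mathbf L^\infty_{1/v}$. Suppose there are a function $\Gamma:X\times X\to\mathbb C$ with $|\Gamma|=1$ and a moderate, admissible covering $\mathcal U^\delta=\{U_i^\delta\}_{i\in I}$ of $X$ such that $$\|\mathrm{osc}_{\mathcal U^\delta,\Gamma}\|_{\mathcal A_m}\Big(\|K_\Psi\|_{\mathcal A_m}+\max\big\{C_{m,\mathcal U^\delta}\|K_\Psi\|_{\mathcal A_m},\ \|K_\Psi\|_{\mathcal A_m}+\|\mathrm{osc}_{\mathcal U^\delta,\Gamma}\|_{\mathcal A_m}\big\}\Big)<1$$ for some constant $C_{m,\mathcal U^\delta}\ge\sup_{i\in I}\sup_{x,y\in U_i^\delta}m(x,y)$. If $x_i\in U_i^\delta$ for all $i\in I$, then $\{\psi_{x_i}\}_{i\in I}$ is a Banach frame and an atomic decomposition for $\mathrm{Co}(\Psi,Y)$.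
   Context: Setting: $\mathcal H$ is a separable Hilbert space and $(X,\mu)$ is a locally compact, $\sigma$-compact Hausdorff space with positive Radon measure $\mu$. A nontrivial Banach space $(Y,\|\cdot\|_Y)$ of functions on $X$, continuously embedded in $\mathbf L^1_{loc}(X,\mu)$, is solid if for $G\in \mathbf L^1_{loc}(X,\mu)$, $H\in Y$: $|G|\le|H|$ a.e. implies $G\in Y$ and $\|G\|_Y\le\|H\|_Y$. $\Psi=\{\psi_x\}_{x\in X}\subset\mathcal H$ is a continuous tight frame with bound $A>0$ if $x\mapsto\psi_x$ is weakly continuous and $\int_X|\langle f,\psi_x\rangle|^2d\mu(x)=A\|f\|^2$ for all $f\in\mathcal H$. Put $V_\Psi f(x)=\langle f,\psi_x\rangle$ and $K_\Psi(x,y)=A^{-1}\langle\psi_y,\psi_x\rangle$. A kernel $K:X\times X\to\mathbb C$ acts by $K(G)(x)=\int_XK(x,y)G(y)\,d\mu(y)$. $\|K\|_{\mathcal A_1}=\max\{\mathrm{ess\,sup}_x\int_X|K(x,y)|d\mu(y),\ \mathrm{ess\,sup}_y\int_X|K(x,y)|d\mu(x)\}$. A weight $m$ on $X\times X$ is admissible if $1\le m(x,y)\le m(x,z)m(z,y)$, $m(x,y)=m(y,x)$ and $m(x,x)\le C$ for some $C>0$ and all $x,y,z\in X$. $\mathcal A_m$ is the space of kernels with $\|K\|_{\mathcal A_m}:=\|Km\|_{\mathcal A_1}<\infty$. For a weight $u$, $\mathbf L^p_u$ has norm $\|uG\|_{\mathbf L^p}$. $\mathcal H^1_v:=\{f\in\mathcal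 H: V_\Psi f\in\mathbf L^1_v\}$ with norm $\|V_\Psi f\|_{\mathbf L^1_v}$; it contains all $\psi_x$. $(\mathcal H^1_v)^*$ is its anti-dual (continuous conjugate-linear functionals), and $V_\Psi f(x):=f(\psi_x)$ for $f\in(\mathcal H^1_v)^*$. The coorbit space is $\mathrm{Co}(\Psi,Y)=\{f\in(\mathcal H^1_v)^*: V_\Psi f\in Y\}$ with norm $\|V_\Psi f\|_Y$. A family $\mathcal U=\{U_i\}_{i\in I}$ ($I$ countable) is an admissible covering of $X$ if each $U_i$ is relatively compact with non-void interior, $X=\bigcup_iU_i$, and $\sup_i\#\{j:U_i\cap U_j\ne\emptyset\}\le N<\infty$. It is moderate if there is $D>0$ with $\mu(U_i)\ge D$ for all $i$ and a constant $\tilde C$ with $\mu(U_i)\le\tilde C\mu(U_j)$ whenever $U_i\cap U_j\ne\emptyset$. The $\Gamma$-oscillation is $\mathrm{osc}_{\mathcal U,\Gamma}(x,y)=A^{-1}\sup_{z\in Q_y}|\langle\psi_x,\psi_y-\Gamma(y,z)\psi_z\rangle|=\sup_{z\in Q_y}|K_\Psi(x,y)-\Gamma(y,z)K_\Psi(x,z)|$, where $Q_y=\bigcup_{i\in I,\,y\in U_i}U_i$. A BK-space is a solid Banach space of sequences in which convergence implies componentwise convergence. A family $\{\psi_i\}_{i\in I}$ in a Banach space $B$ is an atomic decomposition for $B$ if there are a BK-space $B^\sharp$ and bounded linear functionals $\{\lambda_i\}_{i\in I}$ on $B$ such that: $(\lambda_i(f))_i\in B^\sharp$ with $\|(\lambda_i(f))_i\|_{B^\sharp}\le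 C_1\|f\|_B$ for all $f\in B$; if $(\lambda_i)_i\in B^\sharp$ then $f=\sum_i\lambda_i\psi_i\in B$ (unconditional convergence in some suitable topology) with $\|f\|_B\le C_2\|(\lambda_i)_i\|_{B^\sharp}$; and $f=\sum_i\lambda_i(f)\psi_i$ for all $f\in B$ (with finite constants $C_1,C_2>0$). A family $\{\tilde\psi_i\}_{i\in I}\subset B^*$ is a Banach frame for $B$ if there are a BK-space $B^\flat$ and a bounded linear operator $\Omega:B^\flat\to B$ such that for all $f\in B$: $(\tilde\psi_i(f))_i\in B^\flat$, $C_1\|f\|_B\le\|(\tilde\psi_i(f))_i\|_{B^\flat}\le C_2\|f\|_B$ with $0<C_1\le C_2<\infty$, and $f=\Omega((\tilde\psi_i(f))_i)$. For the Banach frame statement, $\psi_{x_i}$ acts on $\mathrm{Co}(\Psi,Y)$ as $f\mapsto V_\Psi f(x_i)$. *)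

(* Defs.v *)
From HB Require Import structures.
From mathcomp Require Import all_boot all_order all_algebra.
From mathcomp Require Import sesquilinear finmap complex.
From mathcomp Require Import all_classical all_reals all_analysis.
From mathcomp Require Import ess_sup_inf summability.

Set Implicit Arguments.
Unset Strict Implicit.
Unset Printing Implicit Defensive.
Import Order.TTheory GRing.Theory Num.Theory.
Import numFieldNormedType.Exports.

Local Open Scope classical_set_scope.
Local Open Scope complex_scope.
Local Open Scope ring_scope.

(* Norms over R[i] are R[i]-valued in the library; rnorm is the real number
   they come from. It is used for vectors and for complex numbers alike. *)
Definition rnorm (R : realType) (V : normedZmodType R[i]) (u : V) : R :=
  complex.Re `|u|.

HB.mixin Record isBorel d T & Topological T & Measurable d T := {
  borel_measurableE : @measurable d T = <<s @open T >> }.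

#[short(type="borelTopologicalType")]
HB.structure Definition BorelTopological d :=
  { T of Topological T & Measurable d T & isBorel d T }.

Definition sigma_compact (X : topologicalType) : Prop :=
  exists F : nat -> set X, (forall n, compact (F n)) /\ \bigcup_n F n = setT.

Record radon d (X : borelTopologicalType d) (R : realType)
    (mu : set X -> \bar R) : Prop := {
  radon_compact : forall Q, compact Q -> (mu Q < +oo)%E ;
  radon_outer : forall B, measurable B ->
    mu B = ereal_inf (mu @` [set O | open O /\ B `<=` O]) ;
  radon_inner : forall O, open O ->
    mu O = ereal_sup (mu @` [set Q | compact Q /\ Q `<=` O]) }.

Section complex_functions.
Context d (T : measurableType d) (R : realType).
Variable mu : {measure set T -> \bar R}.
Implicit Types F G : T -> R[i].

Definition cmeasurable F : Prop :=
  measurable_fun [set: T] (fun x => complex.Re (F x)) /\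
  measurable_fun [set: T] (fun x => complex.Im (F x)).

(* Measurability with respect to the completion of mu. *)
Definition ae_measurable F : Prop :=
  exists2 G, cmeasurable G & {ae mu, forall x, F x = G x}.

Definition cintegral F : R[i] :=
  (\int[mu]_x complex.Re (F x))%R +i* (\int[mu]_x complex.Im (F x))%R.

Definition Lw_norm (p : \bar R) (u : T -> R) F : \bar R :=
  ('N[mu]_p [(fun x => (u x * rnorm (F x))%:E)])%E.

Definition Lw (p : \bar R) (u : T -> R) : set (T -> R[i]) :=
  [set F | ae_measurable F /\ (Lw_norm p u F < +oo)%E].

End complex_functions.

Section banach.
Context (R : realType).

(* The Banach space is B modulo Z: elements of B that differ by an element
   of Z are identified. *)
Record banach_mod (V : lmodType R[i]) (Z B : set V) (N : V -> R) : Prop := {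
  banach0 : B 0 ;
  banach_lin : forall (a : R[i]) u w, B u -> B w -> B (a *: u + w) ;
  banach_ge0 : forall u, B u -> 0 <= N u ;
  banach_eq0 : forall u, B u -> (N u = 0 <-> Z u) ;
  banachZ : forall (a : R[i]) u, B u -> N (a *: u) = rnorm a * N u ;
  banachD : forall u w, B u -> B w -> N (u + w) <= N u + N w ;
  banach_complete : forall u : nat -> V, (forall n, B (u n)) ->
    (forall e : R, 0 < e -> exists n0, forall p q,
       (n0 <= p)%N -> (n0 <= q)%N -> N (u p - u q) < e) ->
    exists2 l, B l & (fun n => N (u n - l)) @ \oo --> (0 : R) }.

Definition banach (V : lmodType R[i]) (B : set V) (N : V -> R) : Prop :=
  banach_mod [set 0] B N.

Definition bounded_linear (V W : lmodType R[i]) (B : set V) (NB : V -> R)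
    (NW : W -> R) (L : V -> W) : Prop :=
  (forall (a : R[i]) u w, B u -> B w -> L (a *: u + w) = a *: L u + L w) /\
  (exists c : R, forall u, B u -> NW (L u) <= c * NB u).

Definition bounded_functional (V : lmodType R[i]) (B : set V) (NB : V -> R)
    (l : V -> R[i]^o) : Prop :=
  bounded_linear B NB (@rnorm R R[i]) l.

Record BK_space (I : countType) (S : set (I -> R[i]^o))
    (N : (I -> R[i]^o) -> R) : Prop := {
  BK_banach : banach S N ;
  BK_solid : forall a b, S b -> (forall i, rnorm (a i : R[i]) <= rnorm (b i : R[i])) ->
    S a /\ N a <= N b ;
  BK_coord : forall (u : nat -> I -> R[i]^o) l, (forall n, S (u n)) -> S l ->
    (fun n => N (u n - l)) @ \oo --> (0 : R) ->
    forall i, (fun n => u n i) @ \oo --> l i }.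

(* Unconditional convergence of \sum_i c i *: psi i to f in the weak topology
   induced by the functionals in W: the net of all finite partial sums
   converges when tested against each of them. *)
Definition weak_unconditional_sum (I : countType) (V : lmodType R[i])
    (W : set (V -> R[i])) (c : I -> R[i]^o) (psi : I -> V) (f : V) : Prop :=
  forall l, W l ->
    (fun J : {fset I} => l (\sum_(i <- J) c i *: psi i) : R[i]^o) @ totally
      --> (l f : R[i]^o).

(* The series converge in the weak topology induced by W, which
   is required to be Hausdorff on B. *)
Definition atomic_decomposition (I : countType) (V : lmodType R[i])
    (B : set V) (N : V -> R) (W : set (V -> R[i])) (psi : I -> V) : Prop :=
  [/\ banach B N,
      forall f g, B f -> B g -> (forall l, W l -> l f = l g) -> f = g,
      forall i, B (psi i) &
      exists (S : set (I -> R[i]^o)) (NS : (I -> R[i]^o) -> R)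
             (lambda : I -> V -> R[i]^o) (C1 C2 : R),
        [/\ BK_space S NS /\ (0 < C1 /\ 0 < C2),
            forall i, bounded_functional B N (lambda i),
            forall f, B f ->
              S (fun i => lambda i f) /\ NS (fun i => lambda i f) <= C1 * N f,
            forall c, S c -> exists f,
              [/\ B f, weak_unconditional_sum W c psi f & N f <= C2 * NS c] &
            forall f, B f ->
              weak_unconditional_sum W (fun i => lambda i f) psi f]].

Definition banach_frame (I : countType) (V : lmodType R[i])
    (B : set V) (N : V -> R) (psi : I -> V -> R[i]^o) : Prop :=
  [/\ banach B N,
      forall i, bounded_functional B N (psi i) &
      exists (S : set (I -> R[i]^o)) (NS : (I -> R[i]^o) -> R)
             (Omega : (I -> R[i]^o) -> V) (C1 C2 : R),
        [/\ BK_space S NS /\ (0 < C1 <= C2),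
            (forall c, S c -> B (Omega c)) /\ bounded_linear S NS N Omega,
            forall f, B f -> S (fun i => psi i f),
            forall f, B f -> C1 * N f <= NS (fun i => psi i f) <= C2 * N f &
            forall f, B f -> f = Omega (fun i => psi i f)]].

End banach.

Section function_spaces.
Context d (X : borelTopologicalType d) (R : realType).
Variable mu : {sigma_finite_measure set X -> \bar R}.

(* Functions are not quotiented: identification almost everywhere is part of
   banach_mod, and sigma-finiteness of mu, which for a Radon measure
   follows from sigma-compactness, only serves to type the product measure. *)
Definition L1loc : set (X -> R[i]^o) :=
  [set F | ae_measurable mu F /\
    forall Q, compact Q -> (\int[mu]_(x in Q) (rnorm (F x : R[i]))%:E < +oo)%E].

Definition ae_zero : set (X -> R[i]^o) := [set F | {ae mu, forall x, F x = 0}].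

Record solid_space (Y : set (X -> R[i]^o)) (NY : (X -> R[i]^o) -> R) : Prop := {
  solid_L1loc : Y `<=` L1loc ;
  solid_banach : banach_mod ae_zero Y NY ;
  solid_nontrivial : exists2 F, Y F & ~ ae_zero F ;
  solid_embedding : forall Q, compact Q -> exists c : R, forall F, Y F ->
    (\int[mu]_(x in Q) (rnorm (F x : R[i]))%:E <= (c * NY F)%:E)%E ;
  solid_solid : forall G H, L1loc G -> Y H ->
    {ae mu, forall x, rnorm (G x : R[i]) <= rnorm (H x : R[i])} ->
    Y G /\ NY G <= NY H }.

Implicit Types (K : X -> X -> R[i]) (m : X -> X -> R).

Definition kernel_act K (F : X -> R[i]^o) : X -> R[i]^o :=
  fun x => cintegral mu (fun y => K x y * F y).

(* The library integral is total: this says that the integral defining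
   kernel_act K F x converges absolutely for almost every x. *)
Definition kernel_act_defined K (F : X -> R[i]^o) : Prop :=
  {ae mu, forall x, (\int[mu]_y (rnorm (K x y * F y))%:E < +oo)%E}.

Definition A1_norm K : \bar R :=
  maxe (ess_sup mu (fun x => \int[mu]_y (rnorm (K x y))%:E)%E)
       (ess_sup mu (fun y => \int[mu]_x (rnorm (K x y))%:E)%E).

Definition Am_norm m K : \bar R := A1_norm (fun x y => K x y * (m x y)%:C).

Definition Am m : set (X -> X -> R[i]) :=
  [set K | ae_measurable (mu \x mu)%E (fun p => K p.1 p.2) /\
           (Am_norm m K < +oo)%E].

(* A weight is measurable for the product sigma-algebra. *)
Record admissible_weight m : Prop := {
  weight_measurable : measurable_fun [set: X * X] (fun p => m p.1 p.2) ;
  weight_ge1 : forall x y, 1 <= m x y ;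
  weight_submul : forall x y z, m x y <= m x z * m z y ;
  weight_sym : forall x y, m x y = m y x ;
  weight_diag : exists2 C : R, 0 < C & forall x, m x x <= C }.

Definition Am_acts m (Y : set (X -> R[i]^o)) (NY : (X -> R[i]^o) -> R) : Prop :=
  forall K F, Am m K -> Y F ->
    [/\ kernel_act_defined K F, Y (kernel_act K F) &
        ((NY (kernel_act K F))%:E <= Am_norm m K * (NY F)%:E)%E].

(* The sets are taken Borel, so that mu is meaningful on them. *)
Record admissible_covering (I : countType) (U : I -> set X) : Prop := {
  covering_measurable : forall i, measurable (U i) ;
  covering_precompact : forall i, precompact (U i) ;
  covering_interior : forall i, (U i)° !=set0 ;
  covering_total : \bigcup_i U i = setT ;
  covering_overlap : exists N : nat,
    forall i, ([set j | U i `&` U j !=set0] #<= `I_N)%card }.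

Definition moderate (I : countType) (U : I -> set X) : Prop :=
  (exists2 D : R, 0 < D & forall i, (D%:E <= mu (U i))%E) /\
  (exists C : R, forall i j, U i `&` U j !=set0 ->
     (mu (U i) <= C%:E * mu (U j))%E).

Definition nbhd (I : Type) (U : I -> set X) (y : X) : set X :=
  \bigcup_(i in [set i | U i y]) U i.

End function_spaces.

Section coorbit.
Context d (X : borelTopologicalType d) (R : realType).
Variable mu : {sigma_finite_measure set X -> \bar R}.
Variable H : completeNormedModType R[i].

(* {dot _ for _} is linear in its first argument. *)
Definition hilbert (ip : {dot H for Num.conj}) : Prop :=
  forall f, ip f f = `|f| ^+ 2.

Definition separable : Prop := exists2 D : set H, countable D & dense D.

Variables (ip : {dot H for Num.conj}) (psi : X -> H).

Record continuous_tight_frame (A : R) : Prop := {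
  frame_gt0 : 0 < A ;
  frame_weakly_continuous : forall f, continuous (fun x => ip f (psi x) : R[i]^o) ;
  frame_tight : forall f,
    (\int[mu]_x (rnorm (ip f (psi x)) ^+ 2)%:E = (A * rnorm f ^+ 2)%:E)%E }.

Definition voice (f : H) : X -> R[i]^o := fun x => ip f (psi x).

Definition frame_kernel (A : R) : X -> X -> R[i] :=
  fun x y => (A^-1)%:C * ip (psi y) (psi x).

(* The supremum is that of a real set: it is taken over a set which is
   bounded for the frames and coverings considered here, since a weakly
   continuous family is norm-bounded on relatively compact sets. *)
Definition osc (A : R) (I : Type) (U : I -> set X) (Gamma : X -> X -> R[i]) :
    X -> X -> R[i] :=
  fun x y => (A^-1 * sup [set rnorm (ip (psi x) (psi y - Gamma y z *: psi z))
                         | z in nbhd U y])%:C.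

Section spaces.
Variable v : X -> R.

Definition H1 : set H := [set f | Lw mu 1%E v (voice f)].

Definition H1_norm (f : H) : R := fine (Lw_norm mu 1%E v (voice f)).

(* A functional on the subspace H1 is represented by its extension by 0. *)
Record antidual (phi : H -> R[i]^o) : Prop := {
  antidual_out : forall g, ~ H1 g -> phi g = 0 ;
  antidual_lin : forall (a : R[i]) g h, H1 g -> H1 h ->
    phi (a *: g + h) = Num.conj a * phi g + phi h ;
  antidual_bounded : exists c : R, forall g, H1 g ->
    rnorm (phi g : R[i]) <= c * H1_norm g }.

Definition extended_voice (phi : H -> R[i]^o) : X -> R[i]^o :=
  fun x => phi (psi x).

Definition embed (h : H) : H -> R[i]^o := patch (fun=> 0) H1 (fun g => ip h g).

(* The functionals inducing the weak-star topology of the antidual. *)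
Definition weak_star : set ((H -> R[i]^o) -> R[i]) :=
  [set (fun phi => phi g) | g in H1].

Variables (Y : set (X -> R[i]^o)) (NY : (X -> R[i]^o) -> R).

Definition Co : set (H -> R[i]^o) :=
  [set phi | antidual phi /\ Y (extended_voice phi)].

Definition Co_norm (phi : H -> R[i]^o) : R := NY (extended_voice phi).

End spaces.
End coorbit.

(* Main.v *)
Require Import Defs.
From HB Require Import structures.
From mathcomp Require Import all_boot all_order all_algebra.
From mathcomp Require Import sesquilinear finmap complex.
From mathcomp Require Import all_classical all_reals all_analysis.
From mathcomp Require Import ess_sup_inf summability.
From mathcomp Require Import measurable_realfun ring lra.

Set Implicit Arguments.
Unset Strict Implicit.
Unset Printing Implicit Defensive.
Import Order.TTheory GRing.Theory Num.Theory.
Import numFieldNormedType.Exports.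

Local Open Scope classical_set_scope.
Local Open Scope complex_scope.
Local Open Scope ring_scope.

(** Write K for the frame kernel, V for the transform of vectors and
functionals, R F for the integral of K(x, y) F(y) in y, and O for the
oscillation.

Polarizing the tight frame identity gives K (V f) = V f at every point, for
f in the Hilbert space [voice_repr]. The estimates behind everything are
transferred from almost every point to every point by the covering: on a set
U i the columns of K differ from one another, up to a unimodular factor, by at
most O, and U i has positive measure, so that Schur's bound at one good point
of U i serves all of them. In this way every psi_p lies in H1, with norm at
most a constant times v(p) [H1_psi], and every F in Y can be integrated against
every row of K, with the bound c v(p) |F|_Y [kernel_abs_bound]; here the mass
of F on U i is spread over a set around the base point of v, at the cost of the
weight between the two. Hence F in Y defines the functional rho F on H1 by
pairing R F with the transform, and V (rho F) = R F [rho_voice].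

Next the samples are made measurable. Each point gets the index of a covering
set that contains it, which cuts X into cells, and a unimodular phase gam, so
that K'(x, y) = gam(y) K(x, x_i), for y in the cell i, differs from K by a
kernel of norm eta with 2 eta |K| < 1. The given phases Gamma need not be
measurable; gam is selected from a countable dense subset of the circle, at
the price of an arbitrarily small increase of eta [phase_selection].

The reproducing formula rho (V phi) = phi for phi in the coorbit space
[rho_extended_voice] is again a consequence of the sampling. Their difference
is a bounded functional on H1 whose transform is annihilated by the pairing.
A vector g of H1 is, up to eta |g|, a finite combination of the psi_(x_i); on
that combination the functional differs from the vanishing pairing by at most
eta times its norm. So its norm is at most 2 eta |K| < 1 times itself, and it
is zero [null_contract]. Consequently the coorbit space is complete, a limit
being rho of the limit of the transforms in Y [Co_banach].

Finally two operators on the coorbit space are within eta |K| < 1 of the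
identity, hence invertible by Neumann's series [near_identity_inverse]. One
sends phi to rho of the function conj(gam(y)) (V phi)(x_i), y in the cell i,
which depends on the samples only; inverting it reconstructs phi from its
samples and gives the Banach frame [samples_banach_frame]. The other sends phi
to rho (K' (V phi)), which is the sum of the psi_(x_i) with coefficients
A^-1 times the integral of gam V phi over the cell i; inverting it gives the
atomic decomposition [samples_atomic_decomposition]. In both cases the sequence
space consists of the sequences whose step function over the cells lies in Y;
a weighted supremum is added to the norm in order to control the coordinates
that belong to null cells. *)

(** * The modulus of a complex number *)

Section modulus.
Context (R : realType).
Implicit Types (z w : R[i]) (r : R).

Lemma rnormE z : rnorm z = Num.sqrt (complex.Re z ^+ 2 + complex.Im z ^+ 2).
Proof. by rewrite /rnorm normc_def. Qed.

Lemma normC_rnorm z : `|z| = (rnorm z)%:C.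
Proof. by rewrite rnormE normc_def. Qed.

Lemma rnorm_ge0 z : 0 <= rnorm z.
Proof. by rewrite rnormE sqrtr_ge0. Qed.

Lemma rnorm0 : rnorm (0 : R[i]) = 0.
Proof. by rewrite /rnorm normr0. Qed.

Lemma rnormN z : rnorm (- z) = rnorm z.
Proof. by rewrite /rnorm normrN. Qed.

Lemma rnormM z w : rnorm (z * w) = rnorm z * rnorm w.
Proof. by apply: (@complexI R); rewrite -normC_rnorm normrM !normC_rnorm -rmorphM. Qed.

Lemma rnormD z w : rnorm (z + w) <= rnorm z + rnorm w.
Proof. by rewrite -lecR rmorphD -!normC_rnorm ler_normD. Qed.

Lemma rnormB z w : rnorm (z - w) <= rnorm z + rnorm w.
Proof. by rewrite (le_trans (rnormD _ _))// rnormN. Qed.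

Lemma rnormBC z w : rnorm (z - w) = rnorm (w - z).
Proof. by rewrite -rnormN opprB. Qed.

Lemma rnorm_eq0 z : rnorm z = 0 -> z = 0.
Proof. by move=> z0; apply/eqP; rewrite -normr_eq0 normC_rnorm z0. Qed.

Lemma rnorm_conj z : rnorm (Num.conj z) = rnorm z.
Proof. by rewrite /rnorm norm_conjC. Qed.

Lemma rnorm_real r : rnorm r%:C = `|r|.
Proof. by rewrite rnormE /= expr0n addr0 sqrtr_sqr. Qed.

Lemma rnorm1 : rnorm (1 : R[i]) = 1.
Proof. by rewrite /rnorm normr1. Qed.

Lemma rnormV z : rnorm z^-1 = (rnorm z)^-1.
Proof. by apply: (@complexI R); rewrite -normC_rnorm normfV normC_rnorm -fmorphV. Qed.

Lemma Re_le_rnorm z : `|complex.Re z| <= rnorm z.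
Proof. by rewrite rnormE -sqrtr_sqr ler_wsqrtr// lerDl sqr_ge0. Qed.

Lemma Im_le_rnorm z : `|complex.Im z| <= rnorm z.
Proof. by rewrite rnormE -sqrtr_sqr ler_wsqrtr// lerDr sqr_ge0. Qed.

Lemma rnorm_le_ReIm z : rnorm z <= `|complex.Re z| + `|complex.Im z|.
Proof.
rewrite rnormE -(ler_pXn2r (n := 2))// ?nnegrE ?sqrtr_ge0 ?addr_ge0//.
rewrite sqr_sqrtr ?addr_ge0 ?sqr_ge0// sqrrD !real_normK ?num_real//.
by rewrite lerD2r lerDl mulrn_wge0// mulr_ge0.
Qed.

Lemma ReD z w : complex.Re (z + w) = complex.Re z + complex.Re w.
Proof. by case: z => a b; case: w. Qed.

Lemma ImD z w : complex.Im (z + w) = complex.Im z + complex.Im w.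
Proof. by case: z => a b; case: w. Qed.

Lemma ReM z w : complex.Re (z * w) =
  complex.Re z * complex.Re w - complex.Im z * complex.Im w.
Proof. by case: z => a b; case: w. Qed.

Lemma ImM z w : complex.Im (z * w) =
  complex.Re z * complex.Im w + complex.Im z * complex.Re w.
Proof. by case: z => a b; case: w. Qed.

Lemma Re_conj z : complex.Re (Num.conj z) = complex.Re z.
Proof. by rewrite /Num.conj /=; case: z. Qed.

Lemma Im_conj z : complex.Im (Num.conj z) = - complex.Im z.
Proof. by rewrite /Num.conj /=; case: z. Qed.

Lemma conjM z w : Num.conj (z * w) = Num.conj z * Num.conj w.
Proof. exact: rmorphM. Qed.

Lemma conjD z w : Num.conj (z + w) = Num.conj z + Num.conj w.
Proof. exact: rmorphD. Qed.

Lemma conjB z w : Num.conj (z - w) = Num.conj z - Num.conj w.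
Proof. exact: rmorphB. Qed.

Lemma conjK z : Num.conj (Num.conj z) = z.
Proof. exact: conjCK. Qed.

Lemma conjR r : Num.conj r%:C = r%:C.
Proof. by apply/eqP; rewrite eq_complex Re_conj Im_conj/= oppr0 !eqxx. Qed.

(** A unimodular factor that rotates z onto the positive axis. *)
Definition phase z : R[i] := if z == 0 then 1 else Num.conj z / `|z|.

Lemma rnorm_phase z : rnorm (phase z) = 1.
Proof.
rewrite /phase; case: eqVneq => [_|z0]; first exact: rnorm1.
by rewrite normC_rnorm rnormM rnormV rnorm_conj rnorm_real ger0_norm ?rnorm_ge0//
  divff//; apply: contra_neq z0 => /rnorm_eq0.
Qed.

Lemma phaseE z : phase z * z = (rnorm z)%:C.
Proof.
rewrite /phase; case: eqVneq => [->|z0]; first by rewrite mulr0 rnorm0.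
rewrite mulrAC [Num.conj z * z]mulrC -normCK expr2 -mulrA divff ?normr_eq0//.
by rewrite mulr1 normC_rnorm.
Qed.

End modulus.

(** * Nonnegative integrals up to null sets *)

Section nonneg_integral.
Context d (T : measurableType d) (R : realType).
Variable mu : {measure set T -> \bar R}.
Implicit Types f g : T -> \bar R.
Local Open Scope ereal_scope.

Lemma le_lint f g : (forall x, 0 <= f x) -> (forall x, f x <= g x) ->
  \int[mu]_x f x <= \int[mu]_x g x.
Proof.
move=> f0 fg.
have g0 x : 0 <= g x by exact: le_trans (f0 x) (fg x).
rewrite !ge0_integralTE//; apply: le_ereal_sup => _ [h hf <-].
by exists h => // x; exact: le_trans (hf x) (fg x).
Qed.

Import HBNNSimple.

(** A simple function below f, cut off on a null set, falls below g and keeps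
its integral; this reaches functions that are measurable only for the
completed measure. *)
Lemma ae_le_lint f g : (forall x, 0 <= f x) -> (forall x, 0 <= g x) ->
  {ae mu, forall x, f x <= g x} -> \int[mu]_x f x <= \int[mu]_x g x.
Proof.
move=> f0 g0 [N [mN N0 fgN]].
rewrite ge0_integralTE//; apply: ge_ereal_sup => _ [h /= hf <-].
have mh : measurable_fun setT (EFin \o h) by exact/measurable_EFinP.
have h0 x : setT x -> 0 <= (EFin \o h) x by move=> _; rewrite lee_fin.
rewrite -integralT_nnsfun (ge0_negligible_integral mN measurableT mh h0)//.
rewrite integral_mkcond; apply: le_lint => x; rewrite patchE.
  by case: ifPn => // _; rewrite lee_fin.
case: ifPn => [|_]; last exact: g0.
rewrite inE => -[_ Nx]; apply: le_trans (hf x) _.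
by apply: contrapT => fgx; exact/Nx/fgN.
Qed.

Lemma ae_eq_lint f g : (forall x, 0 <= f x) -> (forall x, 0 <= g x) ->
  {ae mu, forall x, f x = g x} -> \int[mu]_x f x = \int[mu]_x g x.
Proof.
move=> f0 g0 fg; apply/eqP; rewrite eq_le.
by rewrite !ae_le_lint//; apply: filterS fg => x ->.
Qed.

Lemma ae_eq_int f g : {ae mu, forall x, f x = g x} ->
  \int[mu]_x f x = \int[mu]_x g x.
Proof.
move=> fg; rewrite integralE [RHS]integralE.
congr (_ - _); apply: ae_eq_lint => //; apply: filterS fg => x;
  by rewrite ?funeposE ?funenegE => ->.
Qed.

(** Measurability for the completed measure, of extended-real functions. *)
Definition ae_emeasurable f :=
  exists2 g : T -> \bar R, measurable_fun [set: T] g &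
    {ae mu, forall x, f x = g x}.

Lemma ae_emeasurableW f : measurable_fun [set: T] f -> ae_emeasurable f.
Proof. by move=> mf; exists f => //; exact: aeW. Qed.

Lemma ae_emeasurable_ae f g : {ae mu, forall x, f x = g x} ->
  ae_emeasurable g -> ae_emeasurable f.
Proof.
move=> fg [h mh gh]; exists h => //.
by apply: filterS2 fg gh => x -> ->.
Qed.

Lemma ae_emeasurableD f g : ae_emeasurable f -> ae_emeasurable g ->
  ae_emeasurable (fun x => f x + g x).
Proof.
move=> [f' mf ff'] [g' mg gg']; exists (fun x => f' x + g' x).
  exact: emeasurable_funD.
by apply: filterS2 ff' gg' => x -> ->.
Qed.

Lemma ae_emeasurableM f g : ae_emeasurable f -> ae_emeasurable g ->
  ae_emeasurable (fun x => f x * g x).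
Proof.
move=> [f' mf ff'] [g' mg gg']; exists (fun x => f' x * g' x).
  exact: emeasurable_funM.
by apply: filterS2 ff' gg' => x -> ->.
Qed.

Lemma ae_emeasurable_ge0 f : (forall x, 0 <= f x) -> ae_emeasurable f ->
  exists g, [/\ measurable_fun [set: T] g, forall x, 0 <= g x &
    {ae mu, forall x, f x = g x}].
Proof.
move=> f0 [g mg fg]; exists (abse \o g); split.
- exact: measurableT_comp.
- by move=> x /=.
- by apply: filterS fg => x /= <-; rewrite gee0_abs.
Qed.

Lemma lintD f g : (forall x, 0 <= f x) -> (forall x, 0 <= g x) ->
  ae_emeasurable f -> ae_emeasurable g ->
  \int[mu]_x (f x + g x) = \int[mu]_x f x + \int[mu]_x g x.
Proof.
move=> f0 g0 /(ae_emeasurable_ge0 f0)[f' [mf f'0 ff']].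
move=> /(ae_emeasurable_ge0 g0)[g' [mg g'0 gg']].
rewrite (ae_eq_lint f0 f'0 ff') (ae_eq_lint g0 g'0 gg') -ge0_integralD//.
apply: ae_eq_int; by apply: filterS2 ff' gg' => x -> ->.
Qed.

Lemma lintZ f (c : R) : (forall x, 0 <= f x) -> (0 <= c)%R ->
  ae_emeasurable f -> \int[mu]_x (c%:E * f x) = c%:E * \int[mu]_x f x.
Proof.
move=> f0 c0 /(ae_emeasurable_ge0 f0)[g [mg g0 fg]].
rewrite (ae_eq_lint f0 g0 fg) -ge0_integralZl_EFin//.
by apply: ae_eq_int; apply: filterS fg => x ->.
Qed.

Lemma lint_lty_ae f : (forall x, 0 <= f x) -> ae_emeasurable f ->
  \int[mu]_x f x < +oo -> {ae mu, forall x, f x < +oo}.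
Proof.
move=> f0 /(ae_emeasurable_ge0 f0)[g [mg g0 fg]].
rewrite (ae_eq_lint f0 g0 fg) => gfin.
have : mu.-integrable setT g.
  apply/integrableP; split => //; under eq_integral do rewrite gee0_abs//.
  exact: gfin.
move=> /integrable_ae => /(_ measurableT); apply: filterS2 fg => x -> /(_ I).
by move=> /fin_numPlt/andP[].
Qed.

Lemma lint_eq0_ae f : (forall x, 0 <= f x) -> ae_emeasurable f ->
  \int[mu]_x f x = 0 -> {ae mu, forall x, f x = 0}.
Proof.
move=> f0 /(ae_emeasurable_ge0 f0)[g [mg g0 fg]].
rewrite (ae_eq_lint f0 g0 fg) => gfin.
have /ae_eq_integral_abs : \int[mu]_x `|g x| = 0.
  by under eq_integral do rewrite gee0_abs//.
move=> /(_ measurableT mg); apply: filterS2 fg => x ->; exact.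
Qed.

End nonneg_integral.

(** * Null sets of a product *)

Section product_ae.
Context d (T : measurableType d) (R : realType).
Variable mu : {sigma_finite_measure set T -> \bar R}.
Local Open Scope ereal_scope.
Local Notation mm := (mu \x mu).
Implicit Types (P : T -> T -> Prop) (k : T -> T -> \bar R) (f : T -> \bar R).

Let indic_ge0 (A : set (T * T)) x : 0 <= (\1_A x)%:E :> \bar R.
Proof. by rewrite lee_fin. Qed.

Let mindic (A : set (T * T)) : measurable A ->
  measurable_fun setT (fun x => (\1_A x)%:E : \bar R).
Proof. by move=> mA; exact/measurable_EFinP/measurable_indic. Qed.

Lemma negligible_xsection (N : set (T * T)) : measurable N -> mm N = 0 ->
  {ae mu, forall x, mu (xsection N x) = 0}.
Proof.
move=> mN N0; apply: lint_eq0_ae => //.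
by apply: ae_emeasurableW; exact: measurable_fun_xsection.
Qed.

(** The product measure is defined by one kind of sections; Tonelli's theorem for
indicators gives the other. *)
Lemma product_measureE2 (N : set (T * T)) : measurable N ->
  mm N = \int[mu]_y mu (ysection N y).
Proof.
move=> mN; have := fubini_tonelli2 (m1 := mu) (m2 := mu) _ (mindic mN) (indic_ge0 N).
rewrite integral_indic ?setIT// => ->; apply: eq_integral => y _.
exact: (congr1 (fun h => h y) (indic_fubini_tonelli_GE mu mN)).
Qed.

Lemma negligible_ysection (N : set (T * T)) : measurable N -> mm N = 0 ->
  {ae mu, forall y, mu (ysection N y) = 0}.
Proof.
move=> mN; rewrite product_measureE2// => N0; apply: lint_eq0_ae => //.
by apply: ae_emeasurableW; exact: measurable_fun_ysection.
Qed.

Lemma ae_prod_x P : {ae mm, forall p, P p.1 p.2} ->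
  {ae mu, forall x, {ae mu, forall y, P x y}}.
Proof.
move=> [N [mN N0 PN]]; apply: filterS (negligible_xsection mN N0) => x Nx.
exists (xsection N x); split => //; first exact: measurable_xsection.
by move=> y Pxy; rewrite /xsection/= inE; exact: (PN (x, y)).
Qed.

Lemma ae_prod_y P : {ae mm, forall p, P p.1 p.2} ->
  {ae mu, forall y, {ae mu, forall x, P x y}}.
Proof.
move=> [N [mN N0 PN]]; apply: filterS (negligible_ysection mN N0) => y Ny.
exists (ysection N y); split => //; first exact: measurable_ysection.
by move=> x Pxy; rewrite /ysection/= inE; exact: (PN (x, y)).
Qed.

(** The converse of [ae_prod_y] holds for measurable properties only. *)
Lemma prod_ae_y (N : set (T * T)) : measurable N ->
  {ae mu, forall y, {ae mu, forall x, ~ N (x, y)}} -> {ae mm, forall p, ~ N p}.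
Proof.
move=> mN Ny; exists N; split => //; last by move=> p /=; exact: contrapT.
rewrite product_measureE2//.
rewrite (ae_eq_int (g := fun=> 0)) ?integral0//.
apply: filterS Ny => y Nx; apply: measure_negligible.
  exact: measurable_ysection.
by apply: negligibleS Nx => x; rewrite /ysection/= inE => ?; exact.
Qed.

Lemma ae_prod1 (Q : T -> Prop) : {ae mu, forall x, Q x} ->
  {ae mm, forall p, Q p.1}.
Proof.
move=> [N [mN N0 QN]]; exists (N `*` setT); split.
- exact: measurableX.
- by rewrite product_measure1E//= N0 mul0e.
- by move=> p /QN.
Qed.

Lemma ae_prod2 (Q : T -> Prop) : {ae mu, forall x, Q x} ->
  {ae mm, forall p, Q p.2}.
Proof.
move=> [N [mN N0 QN]]; exists (setT `*` N); split.
- exact: measurableX.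
- by rewrite product_measure1E//= N0 mule0.
- by move=> p /QN.
Qed.

Definition ae_emeasurable2 k := ae_emeasurable mm (fun p => k p.1 p.2).

Lemma ae_emeasurable2_fst f : ae_emeasurable mu f ->
  ae_emeasurable2 (fun x y => f x).
Proof.
move=> [g mg fg]; exists (g \o fst); first exact: measurableT_comp.
exact: ae_prod1 fg.
Qed.

Lemma ae_prod_eq_xy (U : Type) (k : T -> T -> U) (g : T * T -> U) :
  {ae mm, forall p, k p.1 p.2 = g p} ->
  {ae mu, forall x, {ae mu, forall y, k x y = g (x, y)}} /\
  {ae mu, forall y, {ae mu, forall x, k x y = g (x, y)}}.
Proof.
move=> kg; have kg' : {ae mm, forall p, k p.1 p.2 = g (p.1, p.2)}.
  by apply: filterS kg => -[].
by split; [exact: (ae_prod_x kg')|exact: (ae_prod_y kg')].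
Qed.

Lemma ae_emeasurable_sec k : ae_emeasurable2 k ->
  {ae mu, forall x, ae_emeasurable mu (k x)} /\
  {ae mu, forall y, ae_emeasurable mu (fun x => k x y)}.
Proof.
move=> [g mg /ae_prod_eq_xy[kx ky]]; split.
  apply: filterS kx => x kx; exists (fun y => g (x, y)) => //.
  exact: measurableT_comp.
apply: filterS ky => y ky; exists (fun x => g (x, y)) => //.
exact: measurableT_comp.
Qed.

Lemma ae_emeasurable_lint k : (forall x y, 0 <= k x y) -> ae_emeasurable2 k ->
  ae_emeasurable mu (fun x => \int[mu]_y k x y) /\
  ae_emeasurable mu (fun y => \int[mu]_x k x y).
Proof.
move=> k0 /ae_emeasurable_ge0[//|g [mg g0 /ae_prod_eq_xy[kx ky]]]; split.
  exists (fun x => \int[mu]_y g (x, y)).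
    exact: (measurable_fun_fubini_tonelli_F g).
  by apply: filterS kx => x; exact: ae_eq_int.
exists (fun y => \int[mu]_x g (x, y)).
  exact: (measurable_fun_fubini_tonelli_G g).
by apply: filterS ky => x; exact: ae_eq_int.
Qed.

Lemma lint_swap k : (forall x y, 0 <= k x y) -> ae_emeasurable2 k ->
  \int[mu]_x \int[mu]_y k x y = \int[mu]_y \int[mu]_x k x y.
Proof.
move=> k0 /ae_emeasurable_ge0[//|g [mg g0 /ae_prod_eq_xy[kx ky]]].
transitivity (\int[mu]_x \int[mu]_y g (x, y)).
  by apply: ae_eq_int; apply: filterS kx => x; exact: ae_eq_int.
rewrite fubini_tonelli//.
by apply: ae_eq_int; apply: filterS ky => x kx'; apply/esym/ae_eq_int.
Qed.

End product_ae.

(** * Complex measurability and integration *)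

Section complex_measurability.
Context d (T : measurableType d) (R : realType).
Variable mu : {measure set T -> \bar R}.
Implicit Types F G : T -> R[i].

Lemma cmeasurable_rnorm F : cmeasurable F ->
  measurable_fun [set: T] (fun x => rnorm (F x)).
Proof.
move=> [mr mi]; under eq_fun do rewrite rnormE.
apply: (measurableT_comp (continuous_measurable_fun (@sqrt_continuous R))).
by apply: measurable_funD; exact: measurable_funX.
Qed.

Lemma cmeasurable_cst (c : R[i]) : cmeasurable (fun _ : T => c).
Proof. by split. Qed.

Lemma cmeasurable_real (f : T -> R) : measurable_fun [set: T] f ->
  cmeasurable (fun x => (f x)%:C).
Proof. by split. Qed.

Lemma cmeasurableD F G : cmeasurable F -> cmeasurable G ->
  cmeasurable (fun x => F x + G x).
Proof.
move=> [Fr Fi] [Gr Gi]; split.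
  by under eq_fun do rewrite ReD; exact: measurable_funD.
by under eq_fun do rewrite ImD; exact: measurable_funD.
Qed.

Lemma cmeasurableM F G : cmeasurable F -> cmeasurable G ->
  cmeasurable (fun x => F x * G x).
Proof.
move=> [Fr Fi] [Gr Gi]; split.
  under eq_fun do rewrite ReM.
  by apply: measurable_funB; exact: measurable_funM.
under eq_fun do rewrite ImM.
by apply: measurable_funD; exact: measurable_funM.
Qed.

Lemma cmeasurable_conj F : cmeasurable F ->
  cmeasurable (fun x => Num.conj (F x)).
Proof.
move=> [Fr Fi]; split; first by under eq_fun do rewrite Re_conj.
by under eq_fun do rewrite Im_conj; exact: measurable_funN.
Qed.

Lemma ae_measurableW F : cmeasurable F -> ae_measurable mu F.
Proof. by exists F => //; exact: aeW. Qed.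

Lemma ae_measurable_ae F G : {ae mu, forall x, F x = G x} ->
  ae_measurable mu G -> ae_measurable mu F.
Proof.
by move=> FG [G' mG' GG']; exists G' => //; apply: filterS2 FG GG' => x -> ->.
Qed.

Lemma ae_measurableD F G : ae_measurable mu F -> ae_measurable mu G ->
  ae_measurable mu (fun x => F x + G x).
Proof.
move=> [F' mF FF'] [G' mG GG']; exists (fun x => F' x + G' x).
  exact: cmeasurableD.
by apply: filterS2 FF' GG' => x -> ->.
Qed.

Lemma ae_measurableM F G : ae_measurable mu F -> ae_measurable mu G ->
  ae_measurable mu (fun x => F x * G x).
Proof.
move=> [F' mF FF'] [G' mG GG']; exists (fun x => F' x * G' x).
  exact: cmeasurableM.
by apply: filterS2 FF' GG' => x -> ->.
Qed.

Lemma ae_measurable_conj F : ae_measurable mu F ->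
  ae_measurable mu (fun x => Num.conj (F x)).
Proof.
move=> [F' mF FF']; exists (fun x => Num.conj (F' x)).
  exact: cmeasurable_conj.
by apply: filterS FF' => x ->.
Qed.

Lemma ae_measurableZ (c : R[i]) F : ae_measurable mu F ->
  ae_measurable mu (fun x => c * F x).
Proof.
by move=> mF; apply: ae_measurableM => //; apply: ae_measurableW; exact: cmeasurable_cst.
Qed.

Lemma ae_measurableN F : ae_measurable mu F -> ae_measurable mu (fun x => - F x).
Proof.
move=> /(ae_measurableZ (-1)); apply: ae_measurable_ae.
by apply: aeW => x; rewrite mulN1r.
Qed.

Lemma ae_measurableB F G : ae_measurable mu F -> ae_measurable mu G ->
  ae_measurable mu (fun x => F x - G x).
Proof. by move=> mF mG; apply: ae_measurableD => //; exact: ae_measurableN. Qed.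

Lemma ae_measurable_rnorm F : ae_measurable mu F ->
  ae_emeasurable mu (fun x => (rnorm (F x))%:E).
Proof.
move=> [G mG FG]; exists (fun x => (rnorm (G x))%:E).
  exact/measurable_EFinP/cmeasurable_rnorm.
by apply: filterS FG => x ->.
Qed.

Lemma ae_measurable_rnormC F : ae_measurable mu F ->
  ae_measurable mu (fun x => (rnorm (F x))%:C).
Proof.
move=> [G mG FG]; exists (fun x => (rnorm (G x))%:C).
  exact/cmeasurable_real/cmeasurable_rnorm.
by apply: filterS FG => x ->.
Qed.

End complex_measurability.

Section complex_integral.
Context d (T : measurableType d) (R : realType).
Variable mu : {measure set T -> \bar R}.
Implicit Types F G : T -> R[i].

Definition cintegrable F : Prop :=
  ae_measurable mu F /\ (\int[mu]_x (rnorm (F x))%:E < +oo)%E.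

Lemma rnormE_ge0 F x : (0 <= (rnorm (F x))%:E)%E.
Proof. by rewrite lee_fin rnorm_ge0. Qed.

Lemma cintegrable_rep F : cintegrable F -> exists G, [/\ cmeasurable G,
  {ae mu, forall x, F x = G x},
  mu.-integrable setT (fun x => (complex.Re (G x))%:E) &
  mu.-integrable setT (fun x => (complex.Im (G x))%:E)].
Proof.
move=> [[G mG FG] Ffin]; exists G; split => //.
- apply/integrableP; split; first exact/measurable_EFinP/mG.1.
  apply: le_lt_trans Ffin; apply: ae_le_lint => // [x|]; first exact: rnormE_ge0.
  by apply: filterS FG => x ->; rewrite lee_fin Re_le_rnorm.
- apply/integrableP; split; first exact/measurable_EFinP/mG.2.
  apply: le_lt_trans Ffin; apply: ae_le_lint => // [x|]; first exact: rnormE_ge0.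
  by apply: filterS FG => x ->; rewrite lee_fin Im_le_rnorm.
Qed.

Lemma cintegral_ae F G : {ae mu, forall x, F x = G x} ->
  cintegral mu F = cintegral mu G.
Proof.
move=> FG; rewrite /cintegral /Rintegral.
by congr (_ +i* _); congr fine; apply: ae_eq_int; apply: filterS FG => x ->.
Qed.

Lemma cintegrable_ae F G : {ae mu, forall x, F x = G x} ->
  cintegrable G -> cintegrable F.
Proof.
move=> FG [mG Gfin]; split; first exact: ae_measurable_ae mG.
rewrite (@ae_eq_lint _ _ _ _ _ (fun x => (rnorm (G x))%:E))//.
- by move=> x; exact: rnormE_ge0.
- by move=> x; exact: rnormE_ge0.
- by apply: filterS FG => x ->.
Qed.

Lemma cintegrable_le F (g : T -> \bar R) : ae_measurable mu F ->
  (forall x, (0 <= g x)%E) ->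
  {ae mu, forall x, ((rnorm (F x))%:E <= g x)%E} ->
  (\int[mu]_x g x < +oo)%E -> cintegrable F.
Proof.
move=> mF g0 Fg gfin; split => //; apply: le_lt_trans gfin.
by apply: ae_le_lint => // x; exact: rnormE_ge0.
Qed.

Lemma cintegrableD F G : cintegrable F -> cintegrable G ->
  cintegrable (fun x => F x + G x).
Proof.
move=> [mF Ffin] [mG Gfin].
apply: (@cintegrable_le _ (fun x => (rnorm (F x))%:E + (rnorm (G x))%:E)%E).
- exact: ae_measurableD.
- by move=> x; rewrite adde_ge0 ?rnormE_ge0.
- by apply: aeW => x; rewrite lee_fin rnormD.
- rewrite (lintD (rnormE_ge0 F) (rnormE_ge0 G) (ae_measurable_rnorm mF)
    (ae_measurable_rnorm mG)).
  exact: lte_add_pinfty.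
Qed.

Lemma cintegrableZ (c : R[i]) F : cintegrable F -> cintegrable (fun x => c * F x).
Proof.
move=> [mF Ffin]; split; first exact: ae_measurableZ.
under eq_integral do rewrite rnormM EFinM.
rewrite lintZ ?rnorm_ge0//; first last.
- exact: ae_measurable_rnorm.
- exact: rnormE_ge0.
by rewrite lte_mul_pinfty// lee_fin rnorm_ge0.
Qed.

Lemma cintegrableN F : cintegrable F -> cintegrable (fun x => - F x).
Proof.
by move=> /(cintegrableZ (-1)); apply: cintegrable_ae; apply: aeW => x; rewrite mulN1r.
Qed.

Lemma cintegrable_conj F : cintegrable F -> cintegrable (fun x => Num.conj (F x)).
Proof.
move=> [mF Ffin]; split; first exact: ae_measurable_conj.
by under eq_integral do rewrite rnorm_conj.
Qed.

Lemma cintegralD F G : cintegrable F -> cintegrable G ->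
  cintegral mu (fun x => F x + G x) = cintegral mu F + cintegral mu G.
Proof.
move=> /cintegrable_rep[F' [mF FF' iFr iFi]] /cintegrable_rep[G' [mG GG' iGr iGi]].
rewrite (cintegral_ae FF') (cintegral_ae GG').
rewrite (@cintegral_ae _ (fun x => F' x + G' x)); last first.
  by apply: filterS2 FF' GG' => x -> ->.
apply/eqP; rewrite eq_complex ReD ImD /cintegral/= -!RintegralD//.
by apply/andP; split; apply/eqP; apply: eq_Rintegral => x _; rewrite ?ReD ?ImD.
Qed.

Lemma cintegralZ (c : R[i]) F : cintegrable F ->
  cintegral mu (fun x => c * F x) = c * cintegral mu F.
Proof.
move=> /cintegrable_rep[F' [mF FF' iFr iFi]].
rewrite (cintegral_ae FF').
rewrite (@cintegral_ae _ (fun x => c * F' x)); last first.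
  by apply: filterS FF' => x ->.
have iZ (r : R) (f : T -> R) : mu.-integrable setT (EFin \o f) ->
    mu.-integrable setT (EFin \o (fun x => r * f x)).
  by move=> /(integrableZl measurableT r).
apply/eqP; rewrite eq_complex ReM ImM /cintegral/=.
rewrite -!RintegralZl// -RintegralB ?iZ// -RintegralD ?iZ//.
by apply/andP; split; apply/eqP; apply: eq_Rintegral => x _; rewrite ?ReM ?ImM.
Qed.

Lemma cintegralN F : cintegrable F ->
  cintegral mu (fun x => - F x) = - cintegral mu F.
Proof.
move=> iF; rewrite -mulN1r -cintegralZ//; apply: cintegral_ae.
by apply: aeW => x; rewrite mulN1r.
Qed.

Lemma cintegralB F G : cintegrable F -> cintegrable G ->
  cintegral mu (fun x => F x - G x) = cintegral mu F - cintegral mu G.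
Proof.
by move=> iF iG; rewrite cintegralD ?cintegralN//; exact: cintegrableN.
Qed.

Lemma cintegrableB F G : cintegrable F -> cintegrable G ->
  cintegrable (fun x => F x - G x).
Proof. by move=> iF iG; apply: cintegrableD => //; exact: cintegrableN. Qed.

Lemma cintegral_conj F : cintegrable F ->
  cintegral mu (fun x => Num.conj (F x)) = Num.conj (cintegral mu F).
Proof.
move=> /cintegrable_rep[F' [mF FF' iFr iFi]].
rewrite (cintegral_ae FF').
rewrite (@cintegral_ae _ (fun x => Num.conj (F' x))); last first.
  by apply: filterS FF' => x ->.
apply/eqP; rewrite eq_complex Re_conj Im_conj /cintegral/=.
rewrite -[X in _ && (_ == X)]mulN1r -RintegralZl//.
by apply/andP; split; apply/eqP; apply: eq_Rintegral => x _;
  rewrite ?Re_conj ?Im_conj ?mulN1r.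
Qed.

Lemma cintegral0 : cintegral mu (fun=> 0) = 0.
Proof. by rewrite /cintegral /Rintegral/= integral0. Qed.

Lemma cintegral_sum (J : Type) (r : seq J) (F : J -> T -> R[i]) :
  (forall j, cintegrable (F j)) ->
  cintegrable (fun x => \sum_(j <- r) F j x) /\
  cintegral mu (fun x => \sum_(j <- r) F j x) = \sum_(j <- r) cintegral mu (F j).
Proof.
move=> iF; elim: r => [|j r [IHi IH]].
  split; last first.
    rewrite big_nil (@cintegral_ae _ (fun=> 0)) ?cintegral0//.
    by apply: aeW => x; rewrite big_nil.
  split.
    by apply: ae_measurableW; under eq_fun do rewrite big_nil; exact: cmeasurable_cst.
  by under eq_integral do rewrite big_nil rnorm0; rewrite integral0.
split.
  apply: (@cintegrable_ae _ (fun x => F j x + \sum_(j <- r) F j x)).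
    by apply: aeW => x; rewrite big_cons.
  exact: cintegrableD.
rewrite big_cons -IH -cintegralD//.
by apply: cintegral_ae; apply: aeW => x; rewrite big_cons.
Qed.

Lemma Re_cintegral F : complex.Re (cintegral mu F) = \int[mu]_x complex.Re (F x).
Proof. by []. Qed.

(** Rotating the integral onto the positive axis reduces the estimate to real
parts. *)
Lemma le_rnorm_cintegral F : cintegrable F ->
  ((rnorm (cintegral mu F))%:E <= \int[mu]_x (rnorm (F x))%:E)%E.
Proof.
move=> iF; set c := phase (cintegral mu F).
have iG := cintegrableZ c iF.
have : rnorm (cintegral mu F) = complex.Re (cintegral mu (fun x => c * F x)).
  by rewrite cintegralZ// phaseE.
move=> ->; rewrite Re_cintegral.
have [G [mG FG iGr _]] := cintegrable_rep iG.
rewrite /Rintegral (ae_eq_int (g := fun x => (complex.Re (G x))%:E)); last first.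
  by apply: filterS FG => x ->.
rewrite fineK; last exact: integrable_fin_num.
apply: le_trans (lee_abs _) _.
apply: le_trans (le_abse_integral _ _ _) _ => //.
  exact/measurable_EFinP/mG.1.
apply: ae_le_lint => // [x|]; first exact: rnormE_ge0.
apply: filterS FG => x Gx; rewrite lee_fin -Gx; apply: le_trans (Re_le_rnorm _) _.
by rewrite rnormM rnorm_phase mul1r.
Qed.

End complex_integral.

(** * Cutting an integral along the levels of a function *)

Section restriction.
Context d (T : measurableType d) (R : realType).
Variable mu : {measure set T -> \bar R}.
Implicit Types (F : T -> R[i]) (P : pred T) (f : T -> \bar R).

Lemma measurable_pred P : measurable [set x | P x] -> measurable_fun setT P.
Proof.
move=> mP; apply: (@measurable_fun_bool _ _ _ _ true); rewrite setTI.
by congr measurable: mP; apply/seteqP; split=> x.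
Qed.

Lemma ae_measurable_if P F : measurable [set x | P x] ->
  ae_measurable mu F -> ae_measurable mu (fun x => if P x then F x else 0).
Proof.
move=> mP [G [mGr mGi] FG]; exists (fun x => if P x then G x else 0).
  split.
    rewrite (_ : (fun _ => _) = fun x => if P x then complex.Re (G x) else 0).
      by apply: measurable_fun_ifT => //; exact: measurable_pred.
    by apply/funext => x; case: (P x).
  rewrite (_ : (fun _ => _) = fun x => if P x then complex.Im (G x) else 0).
    by apply: measurable_fun_ifT => //; exact: measurable_pred.
  by apply/funext => x; case: (P x).
by apply: filterS FG => x ->.
Qed.

Lemma cintegrable_if P F : measurable [set x | P x] ->
  cintegrable mu F -> cintegrable mu (fun x => if P x then F x else 0).
Proof.
move=> mP [mF Ffin]; apply: (cintegrable_le _ (rnormE_ge0 F) _ Ffin).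
  exact: ae_measurable_if.
by apply: aeW => x; case: (P x); rewrite ?rnorm0 ?lee_fin ?rnorm_ge0.
Qed.

Section levels.
Variable iota : T -> nat.
Hypothesis miota : forall n, measurable [set x | iota x = n].

Lemma measurable_eq_level n : measurable [set x | (iota x == n)%N].
Proof. by congr measurable: (miota n); apply/seteqP; split=> x /= /eqP. Qed.

Lemma measurable_lt_level n : measurable [set x | (iota x < n)%N].
Proof.
elim: n => [|n IH].
  by rewrite (_ : mkset _ = set0)//; apply/seteqP; split.
rewrite (_ : mkset _ = [set x | (iota x < n)%N] `|` [set x | iota x = n]).
  exact: measurableU.
apply/seteqP; split => x /=.
  by rewrite ltnS leq_eqVlt => /orP[/eqP|]; [right|left].
by move=> [/leqW//|->].
Qed.

Lemma measurable_ge_level n : measurable [set x | (n <= iota x)%N].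
Proof.
rewrite (_ : mkset _ = ~` [set x | (iota x < n)%N]).
  by apply: measurableC; exact: measurable_lt_level.
by apply/seteqP; split => x /=; [rewrite leqNgt => /negP|
  move=> /negP; rewrite -leqNgt].
Qed.

(** Dominated convergence along the levels of an integer-valued function. *)
Lemma lint_tail f (e : R) : (forall x, (0 <= f x)%E) -> ae_emeasurable mu f ->
  (\int[mu]_x f x < +oo)%E -> 0 < e ->
  exists n, (\int[mu]_x (if (n <= iota x)%N then f x else 0) < e%:E)%E.
Proof.
move=> f0 /(ae_emeasurable_ge0 f0)[g [mg g0 fg]] ffin e0.
pose h n x := (if (n <= iota x)%N then g x else 0)%E.
have ig : mu.-integrable setT g.
  apply/integrableP; split => //.
  under eq_integral => x _ do rewrite gee0_abs//.
  by rewrite -(ae_eq_int fg).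
have mh n : measurable_fun setT (h n).
  apply: measurable_fun_ifT => //.
  by apply: measurable_pred; exact: measurable_ge_level.
have P1 x : setT x -> h n x @[n --> \oo] --> (0%E : \bar R).
  move=> _; apply: cvg_near_cst; exists (iota x).+1 => // n /= ltn.
  by rewrite /h leqNgt ltn.
have P2 x : forall n, setT x -> (`|h n x| <= g x)%E.
  by move=> n _; rewrite /h; case: ifP => _; rewrite ?abse0// gee0_abs.
have [_ _] := @dominated_convergence _ T R mu setT measurableT h (cst 0%E) g
  mh (measurable_cst _) (aeW _ P1) ig (aeW _ P2).
rewrite integral0 => /fine_cvgP[[n1 _ hfin]].
move=> /cvgrPdist_lt/(_ e e0)[n0 _ /(_ (n0 + n1)%N)]; rewrite /= leq_addr.
move=> /(_ isT); rewrite sub0r normrN => he.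
exists (n0 + n1)%N; rewrite (ae_eq_int (g := h (n0 + n1)%N)); last first.
  by apply: filterS fg => x ->.
have := hfin (n0 + n1)%N; rewrite /= leq_addl => /(_ isT) hf.
rewrite -(fineK hf) lte_fin; apply: le_lt_trans he.
exact: ler_norm.
Qed.

Lemma cintegral_level_cvg F : cintegrable mu F -> forall e : R, 0 < e ->
  exists n0, forall n, (n0 <= n)%N ->
  rnorm (cintegral mu F - cintegral mu (fun x => if (iota x < n)%N then F x else 0)) < e.
Proof.
move=> iF e e0; have [mF Ffin] := iF.
have [n0 tail] := lint_tail (rnormE_ge0 F) (ae_measurable_rnorm mF) Ffin e0.
exists n0 => n n0n.
have iFn := cintegrable_if (measurable_lt_level n) iF.
rewrite -cintegralB// -lte_fin.
apply: le_lt_trans (le_rnorm_cintegral (cintegrableB iF iFn)) _.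
apply: le_lt_trans tail; apply: le_lint => x; first by rewrite lee_fin rnorm_ge0.
case: ltnP => [ltn|len].
  by rewrite subrr rnorm0; case: ifP => _; rewrite lee_fin ?rnorm_ge0.
by rewrite (leq_trans n0n len) subr0.
Qed.

End levels.

End restriction.

(** * Fubini's theorem for complex kernels *)

Section complex_fubini.
Context d (T : measurableType d) (R : realType).
Variable mu : {sigma_finite_measure set T -> \bar R}.
Local Notation mm := (mu \x mu)%E.
Implicit Types (F : T -> R[i]) (k : T -> T -> R[i]).

Definition ae_measurable2 k := ae_measurable mm (fun p => k p.1 p.2).

Lemma ae_measurable2_fst F : ae_measurable mu F ->
  ae_measurable2 (fun x y => F x).
Proof.
move=> [g [mr mi] fg]; exists (g \o fst); last exact: ae_prod1 fg.
by split; [exact: (measurableT_comp mr)|exact: (measurableT_comp mi)].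
Qed.

Lemma ae_measurable2_snd F : ae_measurable mu F ->
  ae_measurable2 (fun x y => F y).
Proof.
move=> [g [mr mi] fg]; exists (g \o snd); last exact: ae_prod2 fg.
by split; [exact: (measurableT_comp mr)|exact: (measurableT_comp mi)].
Qed.

Lemma cmeasurable_pair1 (G : T * T -> R[i]) x : cmeasurable G ->
  cmeasurable (fun y => G (x, y)).
Proof.
by move=> [mr mi]; split; [exact: (measurableT_comp mr)|exact: (measurableT_comp mi)].
Qed.

Lemma cmeasurable_pair2 (G : T * T -> R[i]) y : cmeasurable G ->
  cmeasurable (fun x => G (x, y)).
Proof.
by move=> [mr mi]; split; [exact: (measurableT_comp mr)|exact: (measurableT_comp mi)].
Qed.

Lemma ae_measurable_sec k : ae_measurable2 k ->
  {ae mu, forall x, ae_measurable mu (k x)} /\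
  {ae mu, forall y, ae_measurable mu (k ^~ y)}.
Proof.
move=> [g mg /ae_prod_eq_xy[kx ky]]; split.
  apply: filterS kx => x kx; exists (fun y => g (x, y)) => //.
  exact: cmeasurable_pair1.
apply: filterS ky => y ky; exists (fun x => g (x, y)) => //.
exact: cmeasurable_pair2.
Qed.

Lemma ae_measurable2_rnorm k : ae_measurable2 k ->
  ae_emeasurable2 mu (fun x y => (rnorm (k x y))%:E).
Proof. exact: ae_measurable_rnorm. Qed.

Lemma ae_measurable2_swap k : ae_measurable2 k ->
  ae_measurable2 (fun x y => k y x).
Proof.
move=> [g mg kg].
have msw : measurable_fun setT (fun p : T * T => (p.2, p.1)).
  exact: measurable_fun_pair.
exists (fun p => g (p.2, p.1)).
  by split; [exact: (measurableT_comp mg.1 msw)|exact: (measurableT_comp mg.2 msw)].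
have [N [mN N0 kgN]] := kg.
exists ((fun p : T * T => (p.2, p.1)) @^-1` N); split.
- by rewrite -[_ @^-1` _]setTI; exact: msw.
- have mN' : measurable ((fun p : T * T => (p.2, p.1)) @^-1` N).
    by rewrite -[_ @^-1` _]setTI; exact: msw.
  apply: etrans (product_measureE2 mu mN') _.
  rewrite (ae_eq_int (g := fun=> 0%E)) ?integral0//.
  by apply: filterS (negligible_xsection mN N0) => y <-.
- by move=> [x y] /= kxy; apply: kgN.
Qed.

Lemma cfubini k : ae_measurable2 k ->
  (\int[mu]_x \int[mu]_y (rnorm (k x y))%:E < +oo)%E ->
  [/\ {ae mu, forall x, cintegrable mu (k x)},
      cintegrable mu (fun x => cintegral mu (k x)),
      cintegrable mu (fun y => cintegral mu (k ^~ y)) &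
      cintegral mu (fun x => cintegral mu (k x)) =
      cintegral mu (fun y => cintegral mu (k ^~ y))].
Proof.
move=> mk kfin; have mk2 := ae_measurable2_rnorm mk.
have k0 x y : (0 <= (rnorm (k x y))%:E)%E by rewrite lee_fin rnorm_ge0.
have [msx msy] := ae_measurable_sec mk.
have [mlx mly] := ae_emeasurable_lint k0 mk2.
have kfin2 := kfin; rewrite (lint_swap k0 mk2) in kfin2.
have ix : {ae mu, forall x, cintegrable mu (k x)}.
  have := lint_lty_ae (fun x => integral_ge0 mu (fun y _ => k0 x y)) mlx kfin.
  by apply: filterS2 msx.
have iy : {ae mu, forall y, cintegrable mu (k ^~ y)}.
  have := lint_lty_ae (fun y => integral_ge0 mu (fun x _ => k0 x y)) mly kfin2.
  by apply: filterS2 msy.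
have [G mG kG] := mk; have [kGx kGy] := ae_prod_eq_xy kG.
have iRe (h : R[i] -> R) : measurable_fun setT (fun p => h (G p)) ->
    (forall z, `|h z| <= rnorm z) -> mm.-integrable setT (fun p => (h (G p))%:E).
  move=> mh hle; apply/integrable12ltyP; first exact/measurable_EFinP.
  apply: le_lt_trans kfin; apply: ae_le_lint.
  - by move=> x; exact: integral_ge0.
  - by move=> x; exact: integral_ge0.
  apply: filterS kGx => x kGx; apply: ae_le_lint => //.
  by apply: filterS kGx => y ->; rewrite lee_fin.
have iR := iRe (@complex.Re R) mG.1 (@Re_le_rnorm R).
have iI := iRe (@complex.Im R) mG.2 (@Im_le_rnorm R).
have cx : {ae mu, forall x, cintegral mu (k x) = cintegral mu (fun y => G (x, y))}.
  by apply: filterS kGx => x; exact: cintegral_ae.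
have cy : {ae mu, forall y, cintegral mu (k ^~ y) = cintegral mu (fun x => G (x, y))}.
  by apply: filterS kGy => x; exact: cintegral_ae.
have mx : cmeasurable (fun x => cintegral mu (fun y => G (x, y))).
  by split; apply: measurableT_comp => //;
    [exact: measurable_fubini_F iR|exact: measurable_fubini_F iI].
have my : cmeasurable (fun y => cintegral mu (fun x => G (x, y))).
  by split; apply: measurableT_comp => //;
    [exact: measurable_fubini_G iR|exact: measurable_fubini_G iI].
have ix2 : cintegrable mu (fun x => cintegral mu (k x)).
  apply: (cintegrable_le _ _ _ kfin).
  - by apply: ae_measurable_ae cx _; exact: ae_measurableW.
  - by move=> x; exact: integral_ge0.
  - by apply: filterS ix => x; exact: le_rnorm_cintegral.
have iy2 : cintegrable mu (fun y => cintegral mu (k ^~ y)).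
  apply: (cintegrable_le _ _ _ kfin2).
  - by apply: ae_measurable_ae cy _; exact: ae_measurableW.
  - by move=> x; exact: integral_ge0.
  - by apply: filterS iy => y; exact: le_rnorm_cintegral.
split; [exact: ix|exact: ix2|exact: iy2|].
rewrite (cintegral_ae cx) (cintegral_ae cy).
have swap (f : T * T -> \bar R) : mm.-integrable setT f ->
    (\int[mu]_x (fine (\int[mu]_y f (x, y)))%:E =
     \int[mu]_y (fine (\int[mu]_x f (x, y)))%:E)%E.
  move=> f_int.
  transitivity (\int[mu]_x \int[mu]_y f (x, y))%E.
    apply: ae_eq_int; apply: filterS (ae_integrable1 f_int) => x fx.
    by rewrite fineK//; exact: integrable_fin_num.
  rewrite (Fubini f_int); apply: ae_eq_int.
  apply: filterS (ae_integrable2 f_int) => y fy.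
  by rewrite fineK//; exact: integrable_fin_num.
apply/eqP; rewrite eq_complex; apply/andP; split; apply/eqP; congr fine.
  exact: (swap _ iR).
exact: (swap _ iI).
Qed.

End complex_fubini.

(** * Schur bounds of weighted kernels *)

Section kernel_bounds.
Context d (X : borelTopologicalType d) (R : realType).
Variable mu : {sigma_finite_measure set X -> \bar R}.
Variable m : X -> X -> R.
Hypothesis hm : admissible_weight m.
Implicit Types (k : X -> X -> R[i]) (F : X -> R[i]^o) (c : R).

(** Schur bounds: membership in the algebra with a finite real bound of the
norm, in the form of almost everywhere estimates of rows and columns. *)
Record kbound k c : Prop := {
  kbound_ge0 : 0 <= c ;
  kbound_meas : ae_measurable2 mu k ;
  kbound_row : {ae mu, forall x,
    (\int[mu]_y (rnorm (k x y) * m x y)%:E <= c%:E)%E} ;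
  kbound_col : {ae mu, forall y,
    (\int[mu]_x (rnorm (k x y) * m x y)%:E <= c%:E)%E} }.

Lemma weight_ge0 x y : 0 <= m x y.
Proof. exact: le_trans ler01 (weight_ge1 hm x y). Qed.

Lemma rnorm_weight k x y : rnorm (k x y * (m x y)%:C) = rnorm (k x y) * m x y.
Proof. by rewrite rnormM rnorm_real ger0_norm// weight_ge0. Qed.

Lemma rnorm_weight_ge0 (z : R[i]) x y : (0 <= (rnorm z * m x y)%:E)%E.
Proof. by rewrite lee_fin mulr_ge0 ?rnorm_ge0 ?weight_ge0. Qed.

Lemma Am_normE k : Am_norm mu m k =
  maxe (ess_sup mu (fun x => \int[mu]_y (rnorm (k x y) * m x y)%:E)%E)
       (ess_sup mu (fun y => \int[mu]_x (rnorm (k x y) * m x y)%:E)%E).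
Proof.
by rewrite /Am_norm /A1_norm; congr (maxe (ess_sup mu _) (ess_sup mu _));
  apply/funext => x; under eq_integral do rewrite rnorm_weight.
Qed.

Lemma kbound_Am k c : kbound k c -> Am mu m k /\ (Am_norm mu m k <= c%:E)%E.
Proof.
case=> c0 mk kr kc; have kn : (Am_norm mu m k <= c%:E)%E.
  by rewrite Am_normE ge_max; apply/andP; split; apply/ess_supP.
by split => //; split => //; exact: le_lt_trans kn (ltry _).
Qed.

Lemma Am_norm_ge0 k : (0 < mu setT)%E -> (0 <= Am_norm mu m k)%E.
Proof.
move=> mu0; rewrite Am_normE le_max; apply/orP; left.
apply: ess_sup_gee => //; apply: aeW => x.
by apply: integral_ge0 => y _; exact: rnorm_weight_ge0.
Qed.

(** The essential suprema in the norm are nonnegative on a space of positive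
measure only: over a null space they are -oo. *)
Lemma Am_kbound k : (0 < mu setT)%E -> Am mu m k ->
  kbound k (fine (Am_norm mu m k)) /\
  (Am_norm mu m k = (fine (Am_norm mu m k))%:E)%E.
Proof.
move=> mu0 [mk kfin]; have k0 := Am_norm_ge0 k mu0.
have kE : Am_norm mu m k = (fine (Am_norm mu m k))%:E.
  by rewrite fineK// ge0_fin_numE.
have kle : (Am_norm mu m k <= (fine (Am_norm mu m k))%:E)%E by rewrite -kE.
move: kle; rewrite {1}Am_normE ge_max => /andP[/ess_supP r /ess_supP c].
by split; [split => //; exact: fine_ge0|exact: kE].
Qed.

Lemma ae_emeasurable_weight : ae_emeasurable2 mu (fun x y => (m x y)%:E).
Proof. by apply: ae_emeasurableW; apply/measurable_EFinP; exact: (weight_measurable hm). Qed.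

Lemma weight_meas_fst y : measurable_fun [set: X] (m ^~ y).
Proof. exact: (cmeasurable_pair2 y (cmeasurable_real (weight_measurable hm))).1. Qed.

Lemma weight_meas_snd x : measurable_fun [set: X] (m x).
Proof. exact: (cmeasurable_pair1 x (cmeasurable_real (weight_measurable hm))).1. Qed.

Lemma kweight_meas k : ae_measurable2 mu k ->
  ae_emeasurable2 mu (fun x y => (rnorm (k x y) * m x y)%:E).
Proof.
move=> mk; have := ae_emeasurableM (ae_measurable2_rnorm mk) ae_emeasurable_weight.
by apply: ae_emeasurable_ae; apply: aeW => p; rewrite EFinM.
Qed.

(** Every kernel below is estimated by a combination of two known ones. *)
Lemma kbound_lin k k1 k2 (a1 a2 c1 c2 : R) : ae_measurable2 mu k ->
  0 <= a1 -> 0 <= a2 -> kbound k1 c1 -> kbound k2 c2 ->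
  {ae (mu \x mu)%E, forall p, rnorm (k p.1 p.2) <=
    a1 * rnorm (k1 p.1 p.2) + a2 * rnorm (k2 p.1 p.2)} ->
  kbound k (a1 * c1 + a2 * c2).
Proof.
move=> mk a10 a20 [c10 mk1 r1 l1] [c20 mk2 r2 l2] kle.
have key (f : X -> R) (f1 f2 : X -> R) :
    (forall x, 0 <= f x) -> (forall x, 0 <= f1 x) -> (forall x, 0 <= f2 x) ->
    ae_emeasurable mu (fun x => (f1 x)%:E) ->
    ae_emeasurable mu (fun x => (f2 x)%:E) ->
    {ae mu, forall x, f x <= a1 * f1 x + a2 * f2 x} ->
    (\int[mu]_x (f1 x)%:E <= c1%:E)%E -> (\int[mu]_x (f2 x)%:E <= c2%:E)%E ->
    (\int[mu]_x (f x)%:E <= (a1 * c1 + a2 * c2)%:E)%E.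
  move=> f0 f10 f20 mf1 mf2 ff I1 I2.
  have g10 x : (0 <= (f1 x)%:E)%E by rewrite lee_fin.
  have g20 x : (0 <= (f2 x)%:E)%E by rewrite lee_fin.
  apply: (@le_trans _ _ (\int[mu]_x (a1%:E * (f1 x)%:E + a2%:E * (f2 x)%:E)))%E.
    apply: ae_le_lint => [x|x|]; first by rewrite lee_fin.
      by rewrite adde_ge0// mule_ge0// lee_fin.
    by apply: filterS ff => x; rewrite -!EFinM -EFinD lee_fin.
  rewrite lintD.
  - by rewrite !lintZ// EFinD !EFinM leeD// lee_pmul// ?lee_fin ?integral_ge0.
  - by move=> x; rewrite mule_ge0// lee_fin.
  - by move=> x; rewrite mule_ge0// lee_fin.
  - by apply: ae_emeasurableM => //; apply: ae_emeasurableW.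
  - by apply: ae_emeasurableM => //; apply: ae_emeasurableW.
have kw0 k' x y : 0 <= rnorm (k' x y) * m x y by rewrite mulr_ge0 ?rnorm_ge0 ?weight_ge0.
have kwle x y : rnorm (k x y) <= a1 * rnorm (k1 x y) + a2 * rnorm (k2 x y) ->
    rnorm (k x y) * m x y <=
    a1 * (rnorm (k1 x y) * m x y) + a2 * (rnorm (k2 x y) * m x y).
  by move=> kxy; rewrite !mulrA -mulrDl ler_wpM2r// weight_ge0.
have [s1x s1y] := ae_emeasurable_sec (kweight_meas mk1).
have [s2x s2y] := ae_emeasurable_sec (kweight_meas mk2).
split => //; first by rewrite addr_ge0// mulr_ge0.
- have kx := @ae_prod_x _ _ _ _ (fun x y => rnorm (k x y) <=
    a1 * rnorm (k1 x y) + a2 * rnorm (k2 x y)) kle.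
  apply: filterS3 (filterI r1 r2) (filterI s1x s2x) kx => x [] ? ? [] ? ? kx.
  apply: (key _ (fun y => rnorm (k1 x y) * m x y)
    (fun y => rnorm (k2 x y) * m x y)) => //.
  by apply: filterS kx => y; exact: kwle.
- have ky := @ae_prod_y _ _ _ _ (fun x y => rnorm (k x y) <=
    a1 * rnorm (k1 x y) + a2 * rnorm (k2 x y)) kle.
  apply: filterS3 (filterI l1 l2) (filterI s1y s2y) ky => x [] ? ? [] ? ? ky.
  apply: (key _ (fun y => rnorm (k1 y x) * m y x)
    (fun y => rnorm (k2 y x) * m y x)) => //.
  by apply: filterS ky => y; exact: kwle.
Qed.

Lemma kbound_le k k1 c1 : ae_measurable2 mu k -> kbound k1 c1 ->
  {ae (mu \x mu)%E, forall p, rnorm (k p.1 p.2) <= rnorm (k1 p.1 p.2)} ->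
  kbound k c1.
Proof.
move=> mk k1c kk; have -> : c1 = 1 * c1 + 0 * c1 by rewrite mul1r mul0r addr0.
apply: (kbound_lin mk ler01 (lexx _) k1c k1c).
by apply: filterS kk => p; rewrite mul1r mul0r addr0.
Qed.

Lemma kboundD k1 k2 c1 c2 : kbound k1 c1 -> kbound k2 c2 ->
  kbound (fun x y => k1 x y + k2 x y) (c1 + c2).
Proof.
move=> h1 h2; rewrite -[c1]mul1r -[c2]mul1r.
apply: (kbound_lin _ ler01 ler01 h1 h2).
  exact: (ae_measurableD (kbound_meas h1) (kbound_meas h2)).
by apply: aeW => p; rewrite !mul1r rnormD.
Qed.

Lemma kboundB k1 k2 c1 c2 : kbound k1 c1 -> kbound k2 c2 ->
  kbound (fun x y => k1 x y - k2 x y) (c1 + c2).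
Proof.
move=> h1 h2; rewrite -[c1]mul1r -[c2]mul1r.
apply: (kbound_lin _ ler01 ler01 h1 h2).
  exact: (ae_measurableB (kbound_meas h1) (kbound_meas h2)).
by apply: aeW => p; rewrite !mul1r rnormB.
Qed.

Lemma kbound_abs k c : kbound k c -> kbound (fun x y => (rnorm (k x y))%:C) c.
Proof.
move=> h; apply: (kbound_le _ h).
  exact: (ae_measurable_rnormC (kbound_meas h)).
by apply: aeW => p; rewrite rnorm_real ger0_norm ?rnorm_ge0.
Qed.

Lemma kbound_adj k c : kbound k c -> kbound (fun x y => Num.conj (k y x)) c.
Proof.
case=> c0 mk r l; split => //.
- exact: (ae_measurable_conj (ae_measurable2_swap mk)).
- apply: filterS l => x; apply: le_trans; rewrite le_eqVlt; apply/orP; left.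
  by apply/eqP; apply: eq_integral => y _; rewrite rnorm_conj (weight_sym hm).
- apply: filterS r => x; apply: le_trans; rewrite le_eqVlt; apply/orP; left.
  by apply/eqP; apply: eq_integral => y _; rewrite rnorm_conj (weight_sym hm).
Qed.

(** Schur's test in the weighted space of integrable functions: integrate the
columns first. *)
Lemma schur_L1 k c (v : X -> R) (g : X -> R[i]) : kbound k c ->
  (forall x, 0 <= v x) -> measurable_fun [set: X] v ->
  (forall x y, v x <= m x y * v y) -> ae_measurable mu g ->
  (\int[mu]_x \int[mu]_y (rnorm (k x y * g y) * v x)%:E <=
   c%:E * \int[mu]_y (v y * rnorm (g y))%:E)%E.
Proof.
move=> [c0 mk _ l] v0 mv vm mg.
have mkg : ae_measurable2 mu (fun x y => k x y * g y).
  by apply: ae_measurableM => //; exact: ae_measurable2_snd.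
have mev : ae_emeasurable mu (fun x => (v x)%:E).
  by apply: ae_emeasurableW; exact/measurable_EFinP.
rewrite (@lint_swap _ _ _ mu); first last.
- have := ae_emeasurableM (ae_measurable2_rnorm mkg) (ae_emeasurable2_fst mev).
  by apply: ae_emeasurable_ae; apply: aeW => p; rewrite EFinM.
- by move=> x y; rewrite lee_fin mulr_ge0 ?rnorm_ge0.
have mvg : ae_emeasurable mu (fun y => (v y * rnorm (g y))%:E).
  have := ae_emeasurableM mev (ae_measurable_rnorm mg).
  by apply: ae_emeasurable_ae; apply: aeW => p; rewrite EFinM.
rewrite -lintZ//; last by move=> y; rewrite lee_fin mulr_ge0 ?rnorm_ge0.
have [_ sy] := ae_emeasurable_sec (kweight_meas mk).
apply: ae_le_lint.
- by move=> y; apply: integral_ge0 => x _; rewrite lee_fin mulr_ge0 ?rnorm_ge0.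
- by move=> y; rewrite mule_ge0// lee_fin// mulr_ge0 ?rnorm_ge0.
apply: filterS2 l sy => y ly sy.
apply: (@le_trans _ _ (\int[mu]_x ((v y * rnorm (g y))%:E *
    (rnorm (k x y) * m x y)%:E)))%E.
  apply: le_lint => x; first by rewrite lee_fin mulr_ge0 ?rnorm_ge0.
  rewrite -EFinM lee_fin rnormM.
  rewrite [leRHS](_ : _ = rnorm (k x y) * rnorm (g y) * (m x y * v y)); last by ring.
  by rewrite ler_wpM2l ?mulr_ge0 ?rnorm_ge0.
rewrite lintZ//; last 2 first.
- by move=> x; exact: rnorm_weight_ge0.
- by rewrite mulr_ge0 ?rnorm_ge0.
by rewrite muleC lee_wpmul2r// lee_fin mulr_ge0 ?rnorm_ge0.
Qed.

Lemma kbound_indic (A B : set X) (c a b : R) : measurable A -> measurable B ->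
  (mu A <= a%:E)%E -> (mu B <= a%:E)%E -> 0 <= c -> 0 <= a ->
  (forall x y, A x -> B y -> m x y <= c) ->
  kbound (fun x y => (\1_A x)%:C * (\1_B y)%:C) (c * a).
Proof.
move=> mA mB muA muB c0 a0 mc.
have mI (E : set X) : measurable E -> ae_measurable mu (fun x => (\1_E x : R)%:C).
  by move=> mE; apply: ae_measurableW; apply: cmeasurable_real; exact: measurable_indic.
have rI (E : set X) x : rnorm (\1_E x : R)%:C = \1_E x.
  by rewrite rnorm_real ger0_norm// indicE.
have pt x y : ((rnorm ((\1_A x : R)%:C * (\1_B y : R)%:C) * m x y)%:E
    <= (c * (\1_A x * \1_B y))%:E)%E.
  rewrite lee_fin rnormM !rI !indicE.
  case: (boolP (x \in A)) => xA; last by rewrite !(mul0r, mulr0).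
  case: (boolP (y \in B)) => yB; last by rewrite !(mul0r, mulr0).
  by rewrite !mul1r mulr1; apply: mc; exact/set_mem.
split.
- exact: mulr_ge0.
- apply: ae_measurableM; first exact: ae_measurable2_fst (mI _ mA).
  exact: ae_measurable2_snd (mI _ mB).
- apply: aeW => x; apply: (@le_trans _ _ (\int[mu]_y (c%:E * (\1_B y)%:E)))%E.
    apply: le_lint => y; first exact: rnorm_weight_ge0.
    apply: le_trans (pt x y) _; rewrite -EFinM lee_fin ler_wpM2l//.
    by rewrite ler_piMl ?indicE// lern1 leq_b1.
  rewrite lintZ//; last first.
    by apply: ae_emeasurableW; apply/measurable_EFinP/measurable_indic.
  by rewrite integral_indic// setIT EFinM lee_wpmul2l.
- apply: aeW => y; apply: (@le_trans _ _ (\int[mu]_x (c%:E * (\1_A x)%:E)))%E.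
    apply: le_lint => x; first exact: rnorm_weight_ge0.
    apply: le_trans (pt x y) _; rewrite -EFinM lee_fin ler_wpM2l//.
    by rewrite ler_piMr ?indicE// lern1 leq_b1.
  rewrite lintZ//; last first.
    by apply: ae_emeasurableW; apply/measurable_EFinP/measurable_indic.
  by rewrite integral_indic// setIT EFinM lee_wpmul2l.
Qed.

End kernel_bounds.

(** * Solid spaces under the action of kernels *)

Section solid.
Context d (X : borelTopologicalType d) (R : realType).
Variable mu : {sigma_finite_measure set X -> \bar R}.
Variables (Y : set (X -> R[i]^o)) (NY : (X -> R[i]^o) -> R).
Hypothesis hY : solid_space mu Y NY.
Implicit Types (F G : X -> R[i]^o) (k : X -> X -> R[i]).

Lemma solid_meas F : Y F -> ae_measurable mu F.
Proof. by move=> /(solid_L1loc hY)[]. Qed.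

Lemma solid_ge0 F : Y F -> 0 <= NY F.
Proof. exact: banach_ge0 (solid_banach hY) _. Qed.

Lemma solid0 : Y 0.
Proof. exact: banach0 (solid_banach hY). Qed.

Lemma solidZ (a : R[i]) F : Y F -> Y (a *: F) /\ NY (a *: F) = rnorm a * NY F.
Proof.
move=> YF; split; last exact: banachZ (solid_banach hY) _ _ YF.
by rewrite -[a *: F]addr0; apply: (banach_lin (solid_banach hY)) => //; exact: solid0.
Qed.

Lemma solidD F G : Y F -> Y G -> Y (F + G) /\ NY (F + G) <= NY F + NY G.
Proof.
move=> YF YG; split; last exact: (banachD (solid_banach hY)).
by rewrite -[F]scale1r; exact: (banach_lin (solid_banach hY)).
Qed.

Lemma solidB F G : Y F -> Y G -> Y (F - G) /\ NY (F - G) <= NY F + NY G.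
Proof.
move=> YF YG; rewrite -scaleN1r.
have [YG' NG] := solidZ (-1) YG; have := solidD YF YG'.
by rewrite NG rnormN rnorm1 mul1r.
Qed.

Lemma solid_dom (c : R) G F : ae_measurable mu G -> Y F -> 0 <= c ->
  {ae mu, forall x, rnorm (G x : R[i]) <= c * rnorm (F x : R[i])} ->
  Y G /\ NY G <= c * NY F.
Proof.
move=> mG YF c0 GF.
have [YcF NcF] := solidZ c%:C YF.
have cFE x : rnorm ((c%:C *: F) x : R[i]) = c * rnorm (F x : R[i]).
  by rewrite /GRing.scale/= rnormM rnorm_real ger0_norm.
have [] := solid_solid hY (G := G) _ YcF.
- split => // Q cQ; apply: le_lt_trans ((solid_L1loc hY YcF).2 Q cQ).
  rewrite [leLHS]integral_mkcond [leRHS]integral_mkcond; apply: ae_le_lint.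
  + by move=> x; rewrite patchE; case: ifP; rewrite // lee_fin rnorm_ge0.
  + by move=> x; rewrite patchE; case: ifP; rewrite // lee_fin rnorm_ge0.
  + by apply: filterS GF => x GF; rewrite !patchE; case: ifP; rewrite // lee_fin cFE.
- by apply: filterS GF => x; rewrite cFE.
- by rewrite NcF rnorm_real ger0_norm.
Qed.

Lemma solid_le G F : ae_measurable mu G -> Y F ->
  {ae mu, forall x, rnorm (G x : R[i]) <= rnorm (F x : R[i])} ->
  Y G /\ NY G <= NY F.
Proof.
move=> mG YF GF; rewrite -[NY F]mul1r; apply: solid_dom => //.
by apply: filterS GF => x; rewrite mul1r.
Qed.

Lemma solid_ae G F : {ae mu, forall x, G x = F x} -> Y F ->
  Y G /\ NY G = NY F.
Proof.
move=> GF YF; have mG := ae_measurable_ae GF (solid_meas YF).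
have [YG NG] : Y G /\ NY G <= NY F.
  by apply: solid_le => //; apply: filterS GF => x ->.
split => //; apply/eqP; rewrite eq_le NG/=.
have [] := solid_le (solid_meas YF) YG => //.
by apply: filterS GF => x ->.
Qed.

Let eq_le1 (a b : R) : a = b -> a <= b. Proof. by move=> ->. Qed.

Lemma solid_abs F : Y F ->
  Y (fun x => (rnorm (F x : R[i]))%:C : R[i]^o) /\
  NY (fun x => (rnorm (F x : R[i]))%:C : R[i]^o) = NY F.
Proof.
move=> YF; have mG := ae_measurable_rnormC (solid_meas YF).
have nE x : rnorm ((rnorm (F x : R[i]))%:C : R[i]) = rnorm (F x : R[i]).
  by rewrite rnorm_real ger0_norm ?rnorm_ge0.
have [YG NG] := solid_le mG YF (aeW _ (fun x => eq_le1 (nE x))).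
split => //; apply/eqP; rewrite eq_le NG/=.
by have [] := solid_le (solid_meas YF) YG (aeW _ (fun x => eq_le1 (esym (nE x)))).
Qed.

Lemma solid_eq0 F : Y F -> NY F = 0 -> {ae mu, forall x, F x = 0}.
Proof. by move=> YF /(banach_eq0 (solid_banach hY) YF). Qed.

Lemma solid_null F : {ae mu, forall x, F x = 0} -> NY F = 0.
Proof.
move=> F0; have YF := (solid_ae (F := 0) F0 solid0).1.
exact/(banach_eq0 (solid_banach hY) YF).
Qed.

Section action.
Variable m : X -> X -> R.
Hypothesis hm : admissible_weight m.
Hypothesis hact : Am_acts mu m Y NY.

Lemma kbound_cint k c F : kbound mu m k c -> Y F ->
  {ae mu, forall x, cintegrable mu (fun y => k x y * F y)}.
Proof.
move=> kc YF; have [kdef _ _] := hact (kbound_Am hm kc).1 YF.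
have [mk _] := ae_measurable_sec (kbound_meas kc).
apply: filterS2 mk kdef => x mk kfin; split => //.
by apply: ae_measurableM => //; exact: solid_meas.
Qed.

Lemma kbound_act k c F : kbound mu m k c -> Y F ->
  Y (kernel_act mu k F) /\ NY (kernel_act mu k F) <= c * NY F.
Proof.
move=> kc YF; have [kA kn] := kbound_Am hm kc.
have [_ YkF NkF] := hact kA YF; split => //.
rewrite -lee_fin; apply: le_trans NkF _; rewrite EFinM lee_wpmul2r//.
by rewrite lee_fin solid_ge0.
Qed.

Definition abs_act k F x : \bar R := (\int[mu]_y (rnorm (k x y * F y))%:E)%E.

Lemma abs_act_ge0 k F x : (0 <= abs_act k F x)%E.
Proof. by apply: integral_ge0 => y _; rewrite lee_fin rnorm_ge0. Qed.

(** The moduli of a kernel and of a function satisfy the same bounds as the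
kernel and the function themselves. *)
Lemma kbound_abs_act k c F : kbound mu m k c -> Y F ->
  [/\ {ae mu, forall x, (abs_act k F x < +oo)%E},
      Y (fun x => (fine (abs_act k F x))%:C : R[i]^o) &
      NY (fun x => (fine (abs_act k F x))%:C : R[i]^o) <= c * NY F].
Proof.
move=> kc YF; have [YaF NaF] := solid_abs YF.
have kint := kbound_cint kc YF.
have [YkF NkF] := kbound_act (kbound_abs hm kc) YaF.
have E x : (fine (abs_act k F x))%:C =
  kernel_act mu (fun x y => (rnorm (k x y))%:C) (fun x => (rnorm (F x : R[i]))%:C : R[i]^o) x.
  apply/eqP; rewrite eq_complex; apply/andP; split; apply/eqP => /=.
    congr fine; apply: eq_integral => y _.
    by rewrite rnormM mul0r subr0.
  rewrite /Rintegral (ae_eq_int (g := fun=> 0%E)) ?integral0//.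
  by apply: aeW => y; rewrite /= mulr0 mul0r addr0.
split; first by apply: filterS kint => x [].
- by under eq_fun do rewrite E.
- by under eq_fun do rewrite E; rewrite -NaF.
Qed.

End action.

End solid.

(** * The transform of a tight frame *)

Section continuous_measurable.
Context d (X : borelTopologicalType d) (R : realType).

Lemma continuous_borel (g : X -> R) : continuous g -> measurable_fun [set: X] g.
Proof.
move=> /continuousP cg; apply: (measurability _ (RGenOInfty.measurableE R)).
move=> /= _ [_ [a ->]] <-; apply: measurableI => //.
by rewrite borel_measurableE; apply: sub_sigma_algebra; apply: cg; exact: interval_open.
Qed.

Lemma continuous_contraction (f : X -> R[i]^o) (h : R[i] -> R) : continuous f ->
  (forall z w, `|h z - h w| <= rnorm (z - w)) -> continuous (fun x => h (f x)).
Proof.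
move=> cf hle x; apply/cvgrPdist_lt => e e0.
have e0' : 0 < e%:C :> R[i] by rewrite ltcR.
have /cvgrPdist_lt/(_ _ e0') := cf x; apply: filterS => y.
by rewrite normC_rnorm ltcR; exact: le_lt_trans.
Qed.

Lemma continuous_cmeasurable (f : X -> R[i]^o) : continuous f ->
  cmeasurable (f : X -> R[i]).
Proof.
move=> cf; split; apply: continuous_borel; apply: (continuous_contraction cf) => z w.
  by apply: le_trans (Re_le_rnorm _); rewrite ReD; case: w.
by apply: le_trans (Im_le_rnorm _); rewrite ImD; case: w.
Qed.

End continuous_measurable.

Section frame.
Context d (X : borelTopologicalType d) (R : realType).
Variable mu : {sigma_finite_measure set X -> \bar R}.
Variable H : completeNormedModType R[i].
Variables (ip : {dot H for Num.conj}) (psi : X -> H) (A : R).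
Hypothesis hip : hilbert ip.
Hypothesis hfr : continuous_tight_frame mu ip psi A.

Lemma ipC f g : ip g f = Num.conj (ip f g).
Proof. by rewrite hermC expr0 mul1r. Qed.

Lemma ipDl f g h : ip (f + g) h = ip f h + ip g h.
Proof. exact: linearDl. Qed.

Lemma ipZl a f h : ip (a *: f) h = a * ip f h.
Proof. exact: linearZl_LR. Qed.

Lemma ipDr f g h : ip h (f + g) = ip h f + ip h g.
Proof. by rewrite linearDr. Qed.

Lemma ipZr a f h : ip h (a *: f) = Num.conj a * ip h f.
Proof. by rewrite linearZr_LR. Qed.

Lemma voice_cmeasurable f : cmeasurable (voice ip psi f : X -> R[i]).
Proof. apply: (@continuous_cmeasurable _ _ _ (voice ip psi f)).
exact: (@frame_weakly_continuous _ _ _ _ _ _ _ _ hfr f).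
Qed.

Lemma voice_sqr_fin f :
  (\int[mu]_x (rnorm (voice ip psi f x : R[i]) ^+ 2)%:E < +oo)%E.
Proof. by rewrite (frame_tight hfr) ltry. Qed.

Lemma cintegrable_voiceM f g :
  cintegrable mu (fun x => voice ip psi f x * Num.conj (voice ip psi g x)).
Proof.
have mf := voice_cmeasurable f; have mg := voice_cmeasurable g.
have msq h : measurable_fun setT (fun x => (rnorm (voice ip psi h x : R[i]) ^+ 2)%:E).
  by apply/measurable_EFinP/measurable_funX/cmeasurable_rnorm; exact: voice_cmeasurable.
apply: (@cintegrable_le _ _ _ _ _ (fun x => (rnorm (voice ip psi f x : R[i]) ^+ 2)%:E +
    (rnorm (voice ip psi g x : R[i]) ^+ 2)%:E)%E).
- by apply: ae_measurableW; apply: cmeasurableM => //; exact: cmeasurable_conj.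
- by move=> x; rewrite -EFinD lee_fin addr_ge0 ?sqr_ge0.
- apply: aeW => x; rewrite -EFinD lee_fin rnormM rnorm_conj.
  by have := sqr_ge0 (rnorm (voice ip psi f x : R[i]) - rnorm (voice ip psi g x : R[i]));
    nra.
- rewrite ge0_integralD//; [|by move=> x _; rewrite lee_fin sqr_ge0..].
  by apply: lte_add_pinfty; exact: voice_sqr_fin.
Qed.

(** Polarization of the tight frame identity: a sesquilinear form vanishing on
the diagonal vanishes. *)
Lemma frame_polarization f g :
  cintegral mu (fun x => voice ip psi f x * Num.conj (voice ip psi g x)) =
  A%:C * ip f g.
Proof.
pose B f g := cintegral mu (fun x => voice ip psi f x * Num.conj (voice ip psi g x))
  - A%:C * ip f g.
suff B0 : B f g = 0 by apply/eqP; rewrite -subr_eq0 -/(B f g) B0.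
have Bdiag h : B h h = 0.
  rewrite /B (@cintegral_ae _ _ _ _ _
    (fun x => (rnorm (voice ip psi h x : R[i]) ^+ 2)%:C)); last first.
    by apply: aeW => x; rewrite -normCK normC_rnorm rmorphXn.
  rewrite [X in X - _](_ : _ = (A * rnorm h ^+ 2)%:C); last first.
    rewrite /cintegral/= /Rintegral (frame_tight hfr)/=.
    by rewrite integral0.
  rewrite hip rmorphM rmorphXn (_ : `|h| = (rnorm h)%:C) ?subrr//.
  rewrite /rnorm; have := normr_ge0 h; move: `|h| => [a b]; rewrite lecE/= => /andP[/eqP-> _].
  by [].
have BD f1 f2 h : B (f1 + f2) h = B f1 h + B f2 h.
  rewrite /B ipDl mulrDr opprD addrACA -cintegralD; [|exact: cintegrable_voiceM..].
  by congr (_ + _); apply: cintegral_ae; apply: aeW => x; rewrite /voice ipDl mulrDl.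
have BDr f1 f2 h : B h (f1 + f2) = B h f1 + B h f2.
  rewrite /B ipDr mulrDr opprD addrACA -cintegralD; [|exact: cintegrable_voiceM..].
  congr (_ + _); apply: cintegral_ae; apply: aeW => x.
  by rewrite /voice ipDl conjD mulrDr.
have BZ a f1 h : B (a *: f1) h = a * B f1 h.
  rewrite /B ipZl mulrBr -cintegralZ; last exact: cintegrable_voiceM.
  by congr (_ - _); [apply: cintegral_ae; apply: aeW => x; rewrite /voice ipZl mulrA|
    rewrite mulrCA].
have BZr a f1 h : B h (a *: f1) = Num.conj a * B h f1.
  rewrite /B ipZr mulrBr -cintegralZ; last exact: cintegrable_voiceM.
  congr (_ - _); last by rewrite mulrCA.
  by apply: cintegral_ae; apply: aeW => x; rewrite /voice ipZl conjM mulrCA.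
have B1 : B f g + B g f = 0.
  by have := Bdiag (f + g); rewrite BD !BDr !Bdiag addr0 add0r.
have B2 : B f g - B g f = 0.
  have := Bdiag ('i *: f + g); rewrite BD !BDr !Bdiag addr0 add0r BZ BZr (_ : Num.conj 'i = - 'i :> R[i]); last first.
    by apply/eqP; rewrite eq_complex Re_conj Im_conj/= oppr0 !eqxx.
  rewrite mulNr -mulrBr => /eqP; rewrite mulf_eq0 => /orP[/eqP i0|/eqP//].
  by have := congr1 (@complex.Im R) i0 => /= /eqP; rewrite oner_eq0.
have half (a b : R[i]) : a + b = 0 -> a - b = 0 -> a = 0.
  move=> ab0 /eqP; rewrite subr_eq0 => /eqP ab; move: ab0; rewrite -ab => /eqP.
  by rewrite -mulr2n mulrn_eq0 => /eqP.
exact: half B1 B2.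
Qed.

Lemma frame_kernelE x y : frame_kernel ip psi A x y =
  (A^-1)%:C * Num.conj (voice ip psi (psi x) y).
Proof. by rewrite /frame_kernel /voice -ipC. Qed.

Lemma frame_kernel_conj x y :
  frame_kernel ip psi A y x = Num.conj (frame_kernel ip psi A x y).
Proof.
by rewrite [in RHS]frame_kernelE conjM conjK conjR.
Qed.

Lemma frame_kernel_voice x y :
  frame_kernel ip psi A x y = (A^-1)%:C * voice ip psi (psi y) x.
Proof. by []. Qed.

Lemma frame_kernel_cmeasurable x : cmeasurable (frame_kernel ip psi A x).
Proof.
rewrite (_ : frame_kernel ip psi A x = fun y => (A^-1)%:C *
  Num.conj (voice ip psi (psi x) y)); last by apply/funext => y; rewrite frame_kernelE.
apply: cmeasurableM; first exact: cmeasurable_cst.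
by apply: cmeasurable_conj; exact: voice_cmeasurable.
Qed.

Lemma frame_kernel_cmeasurable2 y : cmeasurable (frame_kernel ip psi A ^~ y).
Proof. by apply: cmeasurableM; [exact: cmeasurable_cst|exact: voice_cmeasurable]. Qed.

(** The reproducing formula holds at every point, being polarization against
the frame vector at that point. *)
Lemma voice_repr f x :
  cintegrable mu (fun y => frame_kernel ip psi A x y * voice ip psi f y) /\
  kernel_act mu (frame_kernel ip psi A) (voice ip psi f) x = voice ip psi f x.
Proof.
have E : {ae mu, forall y, frame_kernel ip psi A x y * voice ip psi f y =
    (A^-1)%:C * (voice ip psi f y * Num.conj (voice ip psi (psi x) y))}.
  by apply: aeW => y; rewrite frame_kernelE -mulrA [Num.conj _ * _]mulrC.
have iV := cintegrable_voiceM f (psi x).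
split; first by apply: cintegrable_ae E _; exact: cintegrableZ.
rewrite /kernel_act (cintegral_ae E) cintegralZ// frame_polarization mulrA -rmorphM.
by rewrite mulVf ?mul1r// gt_eqF// (frame_gt0 hfr).
Qed.

End frame.

(** * Measurable selection *)

Section ae_positive.
Context d (T : measurableType d) (R : realType).
Variable mu : {measure set T -> \bar R}.

Lemma ae_exists (P : T -> Prop) (U : set T) : measurable U -> (0 < mu U)%E ->
  {ae mu, forall x, P x} -> exists x, U x /\ P x.
Proof.
move=> mU U0 [N [mN N0 PN]]; apply: contrapT => nUP.
have UN : U `<=` N by move=> x Ux; apply: PN => Px; apply: nUP; exists x.
by move: U0; rewrite (subset_measure0 mU mN UN N0) ltxx.
Qed.

End ae_positive.

Section measurable_selection.
Context d (T : measurableType d).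

(** Taking the first set that contains the point makes the choice measurable. *)
Lemma first_index (Q : nat -> set T) : (forall n, measurable (Q n)) ->
  exists f : T -> nat, (forall n, measurable [set x | f x = n]) /\
    forall x n, Q n x -> Q (f x) x.
Proof.
move=> mQ; pose P x n := `[< Q n x >].
pose f x := if pselect (exists n, P x n) is left h then ex_minn h else 0%N.
have fP x n : Q n x -> Q (f x) x.
  move=> Qn; rewrite /f; case: pselect => [h|[]]; last by exists n; exact/asboolP.
  by case: ex_minnP => k /asboolP.
exists f; split => // n.
have mlow : measurable (\bigcup_(k < n) Q k).
  by apply: bigcup_measurable => k _; exact: mQ.
have mall : measurable (\bigcup_k Q k) by apply: bigcup_measurable => k _; exact: mQ.
have -> : [set x | f x = n] = (Q n `\` \bigcup_(k < n) Q k) `|`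
    (if n == 0%N then ~` (\bigcup_k Q k) else set0).
  apply/seteqP; split => x /=.
    rewrite /f; case: pselect => [h|h <-].
      case: ex_minnP => k /asboolP Qk kmin <-; left; split => // -[l /= lk /asboolP Ql].
      by have := kmin _ Ql; rewrite leqNgt lk.
    by right => /= -[k _ Qk]; apply: h; exists k; exact/asboolP.
  move=> [[Qn nlow]|].
    rewrite /f; case: pselect => [h|[]]; last by exists n; exact/asboolP.
    case: ex_minnP => k /asboolP Qk kmin; apply/eqP; rewrite eqn_leq.
    rewrite kmin /=; last exact/asboolP.
    by rewrite leqNgt; apply/negP => kn; apply: nlow; exists k.
  case: eqP => // -> nall; rewrite /f; case: pselect => // h.
  by exfalso; have [k /asboolP Qk] := h; apply: nall; exists k.
apply: measurableU; first exact: measurableD.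
by case: eqP => _ //; exact: measurableC.
Qed.

Context (R : realType).

Lemma measurable_glue (kk : T -> nat) (F : nat -> T -> R) :
  (forall n, measurable [set x | kk x = n]) ->
  (forall n, measurable_fun [set: T] (F n)) ->
  measurable_fun [set: T] (fun x => F (kk x) x).
Proof.
move=> mk mF _ B mB; rewrite setTI.
rewrite (_ : _ @^-1` B = \bigcup_n ([set x | kk x = n] `&` (F n @^-1` B))).
  apply: bigcup_measurable => n _; apply: measurableI; first exact: mk.
  by rewrite -[_ @^-1` _]setTI; exact: mF.
apply/seteqP; split => x /=; first by exists (kk x).
by move=> [n _ [<-]].
Qed.

Lemma cmeasurable_glue (kk : T -> nat) (F : nat -> T -> R[i]) :
  (forall n, measurable [set x | kk x = n]) ->
  (forall n, cmeasurable (F n)) -> cmeasurable (fun x => F (kk x) x).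
Proof.
move=> mk mF; split.
  by apply: (@measurable_glue kk (fun n x => complex.Re (F n x))) => // n; exact: (mF n).1.
by apply: (@measurable_glue kk (fun n x => complex.Im (F n x))) => // n; exact: (mF n).2.
Qed.

End measurable_selection.

Section unimodular.
Context (R : realType).

Lemma rnorm_realM (r : R) (z : R[i]) : 0 <= r -> rnorm (r%:C * z) = r * rnorm z.
Proof. by move=> r0; rewrite rnormM rnorm_real ger0_norm. Qed.

(** Normalized rational points form a countable dense subset of the circle. *)
Lemma dense_unimodular : exists om : nat -> R[i], (forall k, rnorm (om k) = 1) /\
  forall (z : R[i]) (e : R), rnorm z = 1 -> 0 < e -> exists k, rnorm (z - om k) < e.
Proof.
pose q (ab : rat * rat) : R[i] := ratr ab.1 +i* ratr ab.2.
pose nq ab := if q ab == 0 then 1 else ((rnorm (q ab))^-1)%:C * q ab.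
exists (fun k => if choice.unpickle k is Some ab then nq ab else 1); split.
  move=> k; case: choice.unpickle => [ab|]; last exact: rnorm1.
  rewrite /nq; case: eqP => [_|/eqP q0]; first exact: rnorm1.
  rewrite rnorm_realM ?invr_ge0 ?rnorm_ge0// mulVf//.
  by apply: contra_neq q0 => /rnorm_eq0.
move=> z e z1 e0.
have e40 : 0 < Num.min e 1 / 4 by rewrite divr_gt0// lt_min e0 ltr01.
have app (x : R) : exists a : rat, `|x - ratr a| < Num.min e 1 / 4.
  have : x - Num.min e 1 / 4 < x + Num.min e 1 / 4 by lra.
  move=> /rat_in_itvoo[a]; rewrite in_itv/= => /andP[a1 a2]; exists a.
  by rewrite ltr_norml; apply/andP; split; lra.
have [a ha] := app (complex.Re z); have [b hb] := app (complex.Im z).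
have zq : rnorm (z - q (a, b)) < Num.min e 1 / 2.
  apply: le_lt_trans (rnorm_le_ReIm _) _.
  have -> : complex.Re (z - q (a, b)) = complex.Re z - ratr a by rewrite ReD.
  have -> : complex.Im (z - q (a, b)) = complex.Im z - ratr b by rewrite ImD.
  lra.
have me1 : Num.min e 1 <= 1 by rewrite ge_min lexx orbT.
have mee : Num.min e 1 <= e by rewrite ge_min lexx.
have tri : `|1 - rnorm (q (a, b))| <= rnorm (z - q (a, b)).
  rewrite ler_norml; apply/andP; split.
    have := rnormD (q (a, b) - z) z; rewrite subrK z1 rnormBC; lra.
  by have := rnormD (z - q (a, b)) (q (a, b)); rewrite subrK z1; lra.
have q0 : q (a, b) != 0.
  by apply/eqP => q0; move: zq; rewrite q0 subr0 z1; lra.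
have rq0 : rnorm (q (a, b)) != 0 by apply: contra_neq q0 => /rnorm_eq0.
exists (choice.pickle (a, b)); rewrite choice.pickleK /nq (negbTE q0).
rewrite -(subrK (q (a, b)) z) -addrA; apply: le_lt_trans (rnormD _ _) _.
have -> : q (a, b) - ((rnorm (q (a, b)))^-1)%:C * q (a, b) =
    (1 - (rnorm (q (a, b)))^-1)%:C * q (a, b) by rewrite rmorphB mulrBl rmorph1 mul1r.
rewrite rnormM rnorm_real.
have -> : `|1 - (rnorm (q (a, b)))^-1| * rnorm (q (a, b)) = `|1 - rnorm (q (a, b))|.
  rewrite -{2}[rnorm (q (a, b))]ger0_norm ?rnorm_ge0// -normrM mulrBl mul1r mulVf//.
  by rewrite distrC.
lra.
Qed.

End unimodular.

(** * Sampled kernels *)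

Section sampling_record.
Context d (X : borelTopologicalType d) (R : realType).
Variable mu : {sigma_finite_measure set X -> \bar R}.
Variables (K : X -> X -> R[i]) (m : X -> X -> R) (nK : R).
Variables (I : countType) (U : I -> set X) (xs : I -> X).
Variables (ind : X -> I) (gam : X -> R[i]) (eta : R).

Definition sampled_kernel x y : R[i] := gam y * K x (xs (ind y)).

Definition kernel_defect x y : R[i] := K x y - sampled_kernel x y.

(** The factor 2 in the smallness condition accounts for two approximations in
[null_contract]: that of a vector by samples, and that of the values of a
functional by its values at the samples. *)
Record sampling : Prop := {
  smp_in : forall x, U (ind x) x ;
  smp_meas : forall i, measurable [set x | ind x = i] ;
  smp_phase_meas : cmeasurable gam ;
  smp_phase : forall x, rnorm (gam x) = 1 ;
  smp_small : 2 * eta * nK < 1 ;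
  smp_defect : kbound mu m kernel_defect eta }.

End sampling_record.

Section levels_sum.
Context d (X : borelTopologicalType d) (R : realType).
Variable mu : {sigma_finite_measure set X -> \bar R}.
Variable iota : X -> nat.
Hypothesis miota : forall n, measurable [set x | iota x = n].

Lemma cintegral_steps (a : nat -> R[i]) (W : X -> R[i]) n : cintegrable mu W ->
  cintegrable mu (fun y => if (iota y < n)%N then a (iota y) * W y else 0) /\
  cintegral mu (fun y => if (iota y < n)%N then a (iota y) * W y else 0) =
  \sum_(j < n) a j * cintegral mu (fun y => if iota y == j then W y else 0).
Proof.
move=> iW; pose F (j : 'I_n) y := a j * (if iota y == j then W y else 0).
have iF j : cintegrable mu (F j).
  by apply: cintegrableZ; apply: cintegrable_if => //; exact: measurable_eq_level.
have [iS SE] := cintegral_sum (index_enum 'I_n) iF.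
have E y : (if (iota y < n)%N then a (iota y) * W y else 0) = \sum_j F j y.
  have [ltn|len] := ltnP (iota y) n.
    rewrite (bigD1 (Ordinal ltn))//= /F eqxx big1 ?addr0// => j jx.
    by case: eqP => [ixj|]; [case/eqP: jx; exact: val_inj|rewrite mulr0].
  rewrite big1// => j _; rewrite /F; case: eqP => [ixj|]; last by rewrite mulr0.
  by have := ltn_ord j; rewrite -ixj ltnNge len.
split; first by apply: cintegrable_ae iS; exact: aeW.
rewrite (cintegral_ae (aeW _ E)) SE; apply: eq_bigr => j _.
by rewrite /F cintegralZ//; apply: cintegrable_if => //; exact: measurable_eq_level.
Qed.

End levels_sum.

(** * Operators close to the identity *)

Section perturbation.
Context (R : realType) (V : lmodType R[i]) (B : set V) (N : V -> R).
Hypothesis hB : banach B N.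

Lemma banachB u w : B u -> B w -> B (u - w).
Proof. by move=> Bu Bw; rewrite addrC -scaleN1r; apply: (banach_lin hB). Qed.

Lemma banach_add u w : B u -> B w -> B (u + w).
Proof. by move=> Bu Bw; rewrite -[u]scale1r; apply: (banach_lin hB). Qed.

Lemma banach_normN u : B u -> N (- u) = N u.
Proof. by move=> Bu; rewrite -scaleN1r (banachZ hB)// rnormN rnorm1 mul1r. Qed.

Lemma banach_normB u w : B u -> B w -> N (u - w) <= N u + N w.
Proof.
move=> Bu Bw; rewrite -(banach_normN Bw); apply: (banachD hB) => //.
by rewrite -sub0r; apply: banachB => //; exact: (banach0 hB).
Qed.

Lemma banach_dist u w : B u -> B w -> N (u - w) = N (w - u).
Proof. by move=> Bu Bw; rewrite -banach_normN ?opprB//; exact: banachB. Qed.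

Lemma banach_norm0 : N 0 = 0.
Proof. exact/(banach_eq0 hB (banach0 hB)). Qed.

Variables (T : V -> V) (q : R).
Hypothesis TB : forall u, B u -> B (T u).
Hypothesis Tlin : forall (a : R[i]) u w, B u -> B w -> T (a *: u + w) = a *: T u + T w.
Hypothesis q0 : 0 <= q.
Hypothesis q1 : q < 1.
Hypothesis Tq : forall u, B u -> N (u - T u) <= q * N u.

Let T_sub u w : B u -> B w -> T (u - w) = T u - T w.
Proof. by move=> Bu Bw; rewrite addrC -scaleN1r Tlin// scaleN1r addrC. Qed.

Lemma near_identity_lower u : B u -> N u <= (1 - q)^-1 * N (T u).
Proof.
move=> Bu; rewrite ler_pdivlMl ?subr_gt0// mulrBl mul1r lerBlDl.
have Tu := TB Bu; rewrite -{1}[u](subrK (T u)).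
apply: le_trans (banachD hB _ Tu) _; first exact: banachB.
by rewrite lerD2r Tq.
Qed.

Lemma near_identity_inj u w : B u -> B w -> T u = T w -> u = w.
Proof.
move=> Bu Bw Tuw; have Buw := banachB Bu Bw.
apply/eqP; rewrite -subr_eq0; apply/eqP/(banach_eq0 hB Buw)/eqP.
rewrite eq_le (banach_ge0 hB Buw) andbT.
by apply: le_trans (near_identity_lower Buw) _; rewrite T_sub// Tuw subrr banach_norm0 mulr0.
Qed.

Let residual u n := iter n (fun r => r - T r) u.
(** The partial sums w_n of Neumann's series applied to u; the residual
u - T w_n is the n-th iterate of 1 - T at u. *)
Fixpoint neumann_sum u n : V := if n is n'.+1 then neumann_sum u n' + residual u n' else 0.

Let residual_B u n : B u -> B (residual u n).
Proof. by move=> Bu; elim: n => //= n IH; apply: banachB => //; exact: TB. Qed.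

Let residual_le u n : B u -> N (residual u n) <= q ^+ n * N u.
Proof.
move=> Bu; elim: n => [|n IH]; first by rewrite expr0 mul1r.
apply: le_trans (Tq (residual_B n Bu)) _.
by rewrite exprS -mulrA ler_wpM2l.
Qed.

Let neumann_B u n : B u -> B (neumann_sum u n).
Proof.
move=> Bu; elim: n => [|n IH]; first exact: (banach0 hB).
by apply: banach_add => //; exact: residual_B.
Qed.

Let neumann_residual u n : B u -> u - T (neumann_sum u n) = residual u n.
Proof.
move=> Bu; have B0 := banach0 hB; elim: n => [|n IH] /=.
  by have := T_sub B0 B0; rewrite !subrr => ->; rewrite subr0.
rewrite -[neumann_sum u n]scale1r Tlin ?scale1r//.
- by rewrite opprD addrA IH.
- exact: neumann_B.
- exact: residual_B.
Qed.

Let neumann_cauchy u n k : B u ->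
  (1 - q) * N (neumann_sum u (n + k) - neumann_sum u n) <= (q ^+ n - q ^+ (n + k)) * N u.
Proof.
move=> Bu; elim: k => [|k IH]; first by rewrite addn0 !subrr mul0r banach_norm0 mulr0.
rewrite addnS /= addrAC.
apply: le_trans (ler_wpM2l _ (banachD hB _ _)) _.
- by rewrite subr_ge0 ltW.
- by apply: banachB; exact: neumann_B.
- exact: residual_B.
rewrite mulrDr; apply: le_trans (lerD IH (ler_wpM2l _ (residual_le _ Bu))) _.
  by rewrite subr_ge0 ltW.
by rewrite exprS; lra.
Qed.

Lemma near_identity_onto u : B u -> exists2 w, B w & T w = u.
Proof.
move=> Bu; have c0 := banach_ge0 hB Bu.
have qq : 0 < 1 - q by rewrite subr_gt0.
have qcv : (fun n => q ^+ n * N u) @ \oo --> (0 : R).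
  rewrite -[X in _ --> X](mul0r (N u)).
  by apply: cvgMl; apply: cvg_expr; rewrite ger0_norm.
have step n k : (1 - q) * N (neumann_sum u (n + k) - neumann_sum u n) <= q ^+ n * N u.
  apply: le_trans (neumann_cauchy n k Bu) _.
  by rewrite ler_wpM2r// gerBl exprn_ge0.
have [w Bw wcv] : exists2 w, B w & (fun n => N (neumann_sum u n - w)) @ \oo --> (0 : R).
  apply: (banach_complete hB) => [n|e e0]; first exact: neumann_B.
  have e1 : 0 < (1 - q) * e by rewrite mulr_gt0.
  have [n0 _ small] := proj1 (cvgr0Pnorm_lt _) qcv _ e1.
  exists n0; have main p r : (n0 <= p)%N -> (p <= r)%N ->
      N (neumann_sum u r - neumann_sum u p) < e.
    move=> p0 pr; rewrite -(ltr_pM2l qq) -(subnKC pr).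
    apply: le_lt_trans (step _ _) _; have := small p p0.
    by rewrite /= ger0_norm// mulr_ge0// exprn_ge0.
  move=> p r p0 r0; have [pr|rp] := leqP p r; last by apply: main => //; exact: ltnW.
  by rewrite banach_dist; [exact: main|exact: neumann_B|exact: neumann_B].
exists w => //; have BTw := TB Bw; have BuT := banachB Bu BTw.
apply/esym/eqP; rewrite -subr_eq0; apply/eqP/(banach_eq0 hB BuT)/eqP.
rewrite eq_le (banach_ge0 hB BuT) andbT.
have lecv : (fun n => q ^+ n * N u + (1 + q) * N (neumann_sum u n - w)) @ \oo --> (0 : R).
  rewrite -[X in _ --> X]addr0; apply: cvgD => //.
  by rewrite -[X in _ --> X](mulr0 (1 + q)); exact: cvgMr.
apply: (closed_cvg (fun x => N (u - T w) <= x)) lecv; first exact: closed_ge.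
apply: nearW => n; have Bn := neumann_B n Bu; have Bnw := banachB Bn Bw.
have -> : u - T w = residual u n + T (neumann_sum u n - w).
  by rewrite -neumann_residual// T_sub// addrA subrK.
apply: le_trans (banachD hB (residual_B n Bu) (TB Bnw)) _.
apply: lerD; first exact: residual_le.
rewrite -[T (neumann_sum u n - w)](subKr (neumann_sum u n - w)).
apply: le_trans (banach_normB Bnw (banachB Bnw (TB Bnw))) _.
by rewrite mulrDl mul1r lerD2l Tq.
Qed.

Lemma near_identity_inverse : exists J : V -> V,
  [/\ forall u, B u -> B (J u),
      forall (a : R[i]) u w, B u -> B w -> J (a *: u + w) = a *: J u + J w,
      forall u, B u -> T (J u) = u,
      forall u, B u -> J (T u) = u &
      forall u, B u -> N (J u) <= (1 - q)^-1 * N u].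
Proof.
have ex u : exists w, B u -> B w /\ T w = u.
  have [Bu|Bu] := pselect (B u); last by exists 0.
  by have [w Bw Tw] := near_identity_onto Bu; exists w.
have [J hJ] := boolp.choice ex; exists J.
have JB u : B u -> B (J u) by move=> /hJ[].
have TJ u : B u -> T (J u) = u by move=> /hJ[].
split => //.
- move=> a u w Bu Bw; apply: near_identity_inj.
  + by apply: JB; exact: (banach_lin hB).
  + by apply: (banach_lin hB); exact: JB.
  + by rewrite Tlin ?TJ//; [exact: (banach_lin hB)|exact: JB|exact: JB].
- by move=> u Bu; apply: near_identity_inj => //; [exact/JB/TB|rewrite TJ//; exact: TB].
- by move=> u Bu; rewrite -{2}(TJ u Bu); exact/near_identity_lower/JB.
Qed.

End perturbation.

(** * Weighted suprema and unconditional sums *)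

Section complex_limits.
Context (R : realType).

Lemma cvg_complex (T : Type) (F : set_system T) {FF : Filter F} (u : T -> R[i]^o) (l : R[i]^o) :
  (forall e : R, 0 < e -> \forall n \near F, rnorm (u n - l : R[i]) < e) ->
  u @ F --> l.
Proof.
move=> ul; apply/cvgrPdist_lt => e e0.
have e1 : e = (complex.Re e)%:C by rewrite RRe_real// gtr0_real.
have e2 : 0 < complex.Re e by move: e0; rewrite {1}e1 -[0]/((0 : R)%:C) ltcR.
apply: filterS (ul _ e2) => n un.
by rewrite distrC e1 normC_rnorm ltcR.
Qed.

End complex_limits.

Section weighted_sup.
Context (R : realType) (I : Type) (i0 : I) (t : I -> R).
Hypothesis t0 : forall i, 0 < t i.
Implicit Types c : I -> R[i]^o.

Definition wbounded c := exists M, forall i, t i * rnorm (c i : R[i]) <= M.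

Definition wsup c : R := sup (range (fun i => t i * rnorm (c i : R[i]))).

Lemma wsup_le c M : (forall i, t i * rnorm (c i : R[i]) <= M) -> wsup c <= M.
Proof.
move=> cM; apply: ge_sup; first by exists (t i0 * rnorm (c i0 : R[i])), i0.
by move=> _ [i _ <-].
Qed.

Lemma le_wsup c i : wbounded c -> t i * rnorm (c i : R[i]) <= wsup c.
Proof.
move=> [M cM]; apply: ub_le_sup; last by exists i.
by exists M => _ [j _ <-].
Qed.

Lemma wsup_ge0 c : wbounded c -> 0 <= wsup c.
Proof.
by move=> /(le_wsup i0); apply: le_trans; rewrite mulr_ge0 ?rnorm_ge0 ?(ltW (t0 _)).
Qed.

Lemma wboundedZ (a : R[i]) c : wbounded c -> wbounded (a *: c) /\
  wsup (a *: c) <= rnorm a * wsup c.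
Proof.
move=> bc; have le i : t i * rnorm ((a *: c) i : R[i]) <= rnorm a * wsup c.
  by rewrite !fctE rnormM mulrCA ler_wpM2l ?rnorm_ge0// le_wsup.
by split; [exists (rnorm a * wsup c)|exact: wsup_le].
Qed.

Lemma wboundedD c c' : wbounded c -> wbounded c' -> wbounded (c + c') /\
  wsup (c + c') <= wsup c + wsup c'.
Proof.
move=> bc bc'; have le i : t i * rnorm ((c + c') i : R[i]) <= wsup c + wsup c'.
  apply: le_trans (lerD (le_wsup i bc) (le_wsup i bc')).
  by rewrite !fctE -mulrDr ler_wpM2l ?(ltW (t0 _))// rnormD.
by split; [exists (wsup c + wsup c')|exact: wsup_le].
Qed.

Lemma wsupZ (a : R[i]) c : wbounded c -> wsup (a *: c) = rnorm a * wsup c.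
Proof.
move=> bc; apply/eqP; rewrite eq_le (wboundedZ a bc).2/=.
have [->|a0] := eqVneq a 0.
  by rewrite rnorm0 mul0r wsup_ge0//; exact: (wboundedZ 0 bc).1.
have r0 : 0 < rnorm a.
  by rewrite lt0r rnorm_ge0 andbT; apply: contra_neq a0 => /rnorm_eq0.
have := (wboundedZ a^-1 (wboundedZ a bc).1).2.
by rewrite scalerA mulVf// scale1r rnormV -ler_pdivrMl ?invr_gt0// invrK.
Qed.

Lemma wsup_eq0 c : wbounded c -> wsup c = 0 -> c = 0.
Proof.
move=> bc c0; apply/funext => i; apply: (@rnorm_eq0 R); apply/eqP.
rewrite eq_le rnorm_ge0 andbT -(pmulr_rle0 _ (t0 i)) -c0.
exact: le_wsup.
Qed.

End weighted_sup.

Section unconditional_sums.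
Context (R : realType) (I : countType).
Implicit Types (a b : I -> R[i]) (J : {fset I}).

(** Unconditional summability, with real tolerances in place of the
neighbourhoods of R[i]. *)
Definition usum a (s : R[i]) := forall e : R, 0 < e ->
  \forall J \near totally, rnorm (\sum_(i <- (J : {fset I})) a i - s) < e.

Lemma totally_above (J0 : {fset I}) (Q : {fset I} -> Prop) :
  (forall J, (forall i, i \in J0 -> i \in J) -> Q J) -> \forall J \near totally, Q J.
Proof. by move=> h; exists J0 => // J /= /fsubsetP; exact: h. Qed.

Lemma sum_fset_le (b : I -> R) (J0 J : {fset I}) : (forall i, 0 <= b i) ->
  (forall i, i \in J0 -> i \in J) -> \sum_(i <- J0) b i <= \sum_(i <- J) b i.
Proof.
move=> b0 sub; have -> : \sum_(i <- J0) b i =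
    \sum_(i <- J) (if i \in J0 then b i else 0).
  rewrite -(@big_fset_incl _ _ _ _ J0 J) => [||i iJ /negbTE->//].
    by rewrite big_seq [RHS]big_seq; apply: eq_bigr => i ->.
  by apply/fsubsetP.
by apply: ler_sum => i _; case: ifP.
Qed.

Lemma bounded_sums_real (b : I -> R) M : (forall i, 0 <= b i) ->
  (forall J, \sum_(i <- J) b i <= M) -> exists s, forall e, 0 < e ->
  \forall J \near totally, `|\sum_(i <- (J : {fset I})) b i - s| < e.
Proof.
move=> b0 bM; pose E := range (fun J : {fset I} => \sum_(i <- J) b i).
have E0 : E !=set0 by exists (\sum_(i <- fset0) b i), fset0.
have Eub : has_ubound E by exists M => _ [J _ <-].
exists (sup E) => e e0; have [_ [J0 _ <-] hJ0] := sup_adherent e0 (conj E0 Eub).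
apply: (@totally_above J0) => J sub.
have le1 := sum_fset_le b0 sub.
have le2 : \sum_(i <- J) b i <= sup E by apply: ub_le_sup => //; exists J.
by rewrite ltr_norml; apply/andP; split; lra.
Qed.

Lemma usum_bound a s M : usum a s -> (forall J, rnorm (\sum_(i <- J) a i) <= M) ->
  rnorm s <= M.
Proof.
move=> as_ aM; apply/ler_addgt0Pr => e e0.
have [J hJ] := @filter_ex _ _ (@totally_filter I) _ (as_ e e0).
have := rnormD (s - \sum_(i <- J) a i) (\sum_(i <- J) a i); rewrite subrK rnormBC.
by have := aM J; lra.
Qed.

Lemma usum_lin (c : R[i]) a b s t : usum a s -> usum b t ->
  usum (fun i => c * a i + b i) (c * s + t).
Proof.
move=> as_ bt e e0; have n0 := rnorm_ge0 c; have n1 : 0 < rnorm c + 1 by lra.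
have e1 : 0 < e / 2 / (rnorm c + 1) by rewrite !divr_gt0.
have e2 : 0 < e / 2 by rewrite divr_gt0.
have ff := @totally_filter I.
apply: filterS2 (as_ _ e1) (bt _ e2) => J aJ bJ.
rewrite big_split/= -mulr_sumr.
have -> : c * (\sum_(i <- J) a i) + \sum_(i <- J) b i - (c * s + t) =
  c * (\sum_(i <- J) a i - s) + (\sum_(i <- J) b i - t) by ring.
apply: le_lt_trans (rnormD _ _) _; rewrite rnormM (splitr e).
apply: ler_ltD bJ; rewrite ltr_pdivlMr// in aJ.
by apply: le_trans _ (ltW aJ); rewrite mulrC ler_wpM2l ?rnorm_ge0// lerDl.
Qed.

Lemma usum_unique a s t : usum a s -> usum a t -> s = t.
Proof.
move=> as_ at_; apply/eqP; rewrite -subr_eq0; apply/eqP/(@rnorm_eq0 R)/eqP.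
rewrite eq_le rnorm_ge0 andbT; have := usum_lin (-1) at_ as_.
rewrite mulN1r [- t + s]addrC => /(@usum_bound _ _ 0); apply => J.
rewrite big1 ?rnorm0// => i _; by rewrite mulN1r addNr.
Qed.

Lemma usum_ext a b s : (forall i, a i = b i) -> usum a s -> usum b s.
Proof. by move=> /funext ->. Qed.

(** The real and imaginary parts are differences of nonnegative families with
bounded finite sums. *)
Lemma usum_exists a M : (forall J, \sum_(i <- J) rnorm (a i) <= M) ->
  exists s, usum a s.
Proof.
move=> aM; have ff := @totally_filter I.
have half (f : R[i] -> R) : (forall z, `|f z| <= rnorm z) -> exists s, forall e, 0 < e ->
    \forall J \near totally, `|\sum_(i <- (J : {fset I})) f (a i) - s| < e.
  move=> fle.
  have [s0 h0] := bounded_sums_real (fun i => rnorm_ge0 (a i)) aM.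
  have [|J|s1 h1] := @bounded_sums_real (fun i => rnorm (a i) + f (a i)) (M + M).
  - by move=> i; have := fle (a i); rewrite ler_norml => /andP[]; lra.
  - rewrite big_split lerD//; apply: le_trans (aM J); apply: ler_sum => i _.
    exact: le_trans (ler_norm _) (fle _).
  exists (s1 - s0) => e e0; have e2 : 0 < e / 2 by rewrite divr_gt0.
  apply: filterS2 (h0 _ e2) (h1 _ e2) => J; rewrite big_split/=.
  rewrite !ltr_norml => /andP[? ?] /andP[? ?]; apply/andP; split; lra.
have [sr hr] := half _ (@Re_le_rnorm R); have [si hi] := half _ (@Im_le_rnorm R).
exists (sr +i* si) => e e0; have e2 : 0 < e / 2 by rewrite divr_gt0.
apply: filterS2 (hr _ e2) (hi _ e2) => J Jr Ji.
have E (z : R[i]) : z - (sr +i* si) = (complex.Re z - sr) +i* (complex.Im z - si) by case: z.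
have rE : complex.Re (\sum_(i <- J) a i) = \sum_(i <- J) complex.Re (a i).
  by elim/big_rec2 : _ => // i x y _ <-; rewrite ReD.
have iE : complex.Im (\sum_(i <- J) a i) = \sum_(i <- J) complex.Im (a i).
  by elim/big_rec2 : _ => // i x y _ <-; rewrite ImD.
rewrite E; apply: le_lt_trans (rnorm_le_ReIm _) _ => /=.
by rewrite rE iE (splitr e) ltrD.
Qed.

Lemma usum_cvg a s : usum a s ->
  (fun J : {fset I} => (\sum_(i <- J) a i : R[i]) : R[i]^o) @ totally --> (s : R[i]^o).
Proof.
by move=> us; apply: (@cvg_complex R _ _ (@totally_filter I)) => e e0; exact: us.
Qed.

End unconditional_sums.

(** * Integrals over cells *)

Section cell_sums.
Context d (X : borelTopologicalType d) (R : realType).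
Variable mu : {sigma_finite_measure set X -> \bar R}.
Variables (I : countType) (ind : X -> I).
Hypothesis ind_meas : forall i, measurable [set x | ind x = i].

Lemma levels_pickle  n : measurable [set x | choice.pickle (ind x) = n].
Proof.
have [[i pi]|ni] := pselect (exists i : I, choice.pickle i = n).
  rewrite (_ : mkset _ = [set x | ind x = i]); first exact: ind_meas.
  apply/seteqP; split => x /=; last by move=> ->.
  by rewrite -pi => /(pcan_inj choice.pickleK).
rewrite (_ : mkset _ = set0)//; apply/seteqP; split => x //= xn.
by apply: ni; exists (ind x).
Qed.

Lemma ind_glue (F : I -> X -> R[i]) : (forall i, cmeasurable (F i)) ->
  cmeasurable (fun x => F (ind x) x).
Proof.
move=> mF; pose G n := if choice.unpickle n is Some i then F i else fun=> 0.
have -> : (fun x => F (ind x) x) = (fun x => G (choice.pickle (ind x)) x).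
  by apply/funext => x; rewrite /G choice.pickleK.
apply: (@cmeasurable_glue _ _ _ _ G); first exact: levels_pickle.
by move=> n; rewrite /G; case: choice.unpickle => // ; exact: cmeasurable_cst.
Qed.

Definition cut i (F : X -> R[i]^o) : X -> R[i]^o :=
  fun y => if ind y == i then F y else 0.

Lemma cut_meas i (F : X -> R[i]^o) : ae_measurable mu F -> ae_measurable mu (cut i F).
Proof.
move=> mF; apply: ae_measurable_if => //.
rewrite (_ : mkset _ = [set x | ind x = i]); first exact: ind_meas.
by apply/seteqP; split => x /= /eqP.
Qed.

Lemma sum_cut (J : {fset I}) (F : I -> X -> R[i]^o) y :
  \sum_(i <- J) cut i (F i) y = if ind y \in J then F (ind y) y else 0 :> R[i].
Proof.
rewrite /cut; case: ifP => yJ.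
  rewrite (bigD1_seq (ind y)) ?fset_uniq//= eqxx big1 ?addr0// => i /negbTE.
  by rewrite eq_sym => ->.
by rewrite big_seq big1// => i iJ; case: eqP => // yi; rewrite yi iJ in yJ.
Qed.

Lemma cintegral_cells (J : {fset I}) (F : I -> X -> R[i]^o) :
  (forall i, cintegrable mu (cut i (F i))) ->
  cintegrable mu (fun y => if ind y \in J then F (ind y) y else 0) /\
  cintegral mu (fun y => if ind y \in J then F (ind y) y else 0) =
  \sum_(i <- J) cintegral mu (cut i (F i)).
Proof.
move=> iF; have [iS SE] := cintegral_sum J iF.
have E y := esym (sum_cut J F y).
by split; [exact: cintegrable_ae (aeW _ E) iS|rewrite (cintegral_ae (aeW _ E)) SE].
Qed.

Lemma cut_cint i (F : X -> R[i]^o) : cintegrable mu F -> cintegrable mu (cut i F).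
Proof.
move=> iF; apply: cintegrable_if => //.
rewrite (_ : mkset _ = [set x | ind x = i]); first exact: ind_meas.
by apply/seteqP; split => x /= /eqP.
Qed.

(** The cells of small index form a finite set, and those left out contribute
at most a tail of the integral of the modulus. *)
Lemma cintegral_cells_usum (F : X -> R[i]^o) : cintegrable mu F ->
  usum (fun i => cintegral mu (cut i F)) (cintegral mu F).
Proof.
move=> iF e e0; have ip := levels_pickle.
have [n0 tail] := lint_tail ip (rnormE_ge0 F) (ae_measurable_rnorm iF.1) iF.2 e0.
apply: (@totally_above _ [fset i in pmap choice.unpickle (seq.iota 0 n0)]%fset) => J sub.
have [iJ <-] := cintegral_cells J (fun i => cut_cint i iF).
rewrite rnormBC -cintegralB// -lte_fin.
apply: le_lt_trans (le_rnorm_cintegral (cintegrableB iF iJ)) _.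
apply: le_lt_trans tail; apply: le_lint => x; first by rewrite lee_fin rnorm_ge0.
case: leqP => [_|lt].
  by case: ifP => _; rewrite ?subrr ?rnorm0 ?subr0 lee_fin ?rnorm_ge0.
rewrite sub ?subrr ?rnorm0// in_fset/= mem_pmap; apply/mapP.
by exists (choice.pickle (ind x)); rewrite ?choice.pickleK// mem_iota.
Qed.

End cell_sums.

(** * Pointwise estimates from the covering *)

Section setting.
Context d (X : borelTopologicalType d) (R : realType).
Variable mu : {sigma_finite_measure set X -> \bar R}.
Variable H : completeNormedModType R[i].
Variables (ip : {dot H for Num.conj}) (psi : X -> H) (A : R).
Variables (m : X -> X -> R) (z0 : X).
Variables (Y : set (X -> R[i]^o)) (NY : (X -> R[i]^o) -> R).
Variables (I : countType) (U : I -> set X) (xs : I -> X).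
Variables (O : X -> X -> R[i]) (C D nK nO : R).

Local Notation K := (frame_kernel ip psi A).

(** The standing assumptions. The oscillation enters only through a kernel O
with a finite Schur bound that dominates, on each set of the covering, the
distance of two columns of K up to a unimodular factor. *)
Record coorbit_setting : Prop := {
  set_hilbert : hilbert ip ;
  set_frame : continuous_tight_frame mu ip psi A ;
  set_weight : admissible_weight m ;
  set_solid : solid_space mu Y NY ;
  set_acts : Am_acts mu m Y NY ;
  set_kernel : kbound mu m K nK ;
  set_osc : kbound mu m O nO ;
  set_osc_le : forall i y z, U i y -> U i z -> exists2 g : R[i], rnorm g = 1 &
    forall x, rnorm (K x y - g * K x z) <= rnorm (O x y) ;
  set_small : 2 * nO * nK < 1 ;
  set_meas : forall i, measurable (U i) ;
  set_fin : forall i, (mu (U i) < +oo)%E ;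
  set_cover : forall x, exists i, U i x ;
  set_lower : 0 < D /\ forall i, (D%:E <= mu (U i))%E ;
  set_local : forall i x y, U i x -> U i y -> m x y <= C ;
  set_sample : forall i, U i (xs i) }.

Hypothesis S : coorbit_setting.

Let hm := set_weight S.
Let hY := set_solid S.
Let hact := set_acts S.
Let hfr := set_frame S.
Let hip := set_hilbert S.

Definition vweight x := m x z0.
Local Notation v := vweight.
Local Notation V := (voice ip psi).

Lemma local_ge1 : 1 <= C.
Proof.
have [i Ui] := set_cover S z0.
exact: le_trans (weight_ge1 hm z0 z0) (set_local S Ui Ui).
Qed.

Lemma v_ge1 x : 1 <= v x. Proof. exact: weight_ge1. Qed.

Lemma v_gt0 x : 0 < v x. Proof. exact: lt_le_trans (v_ge1 x). Qed.

Lemma v_ge0 x : 0 <= v x. Proof. exact: ltW (v_gt0 x). Qed.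

Lemma v_submul x y : v x <= m x y * v y.
Proof. exact: weight_submul. Qed.

Lemma v_meas : measurable_fun [set: X] v.
Proof. exact: weight_meas_fst hm z0. Qed.

Lemma kernel_conj x y : K y x = Num.conj (K x y).
Proof. exact: frame_kernel_conj. Qed.

Lemma cell_gt0 i : (0 < mu (U i))%E.
Proof. by have [D0 /(_ i)] := set_lower S; apply: lt_le_trans; rewrite lte_fin. Qed.

Lemma cell_fin i : mu (U i) = (fine (mu (U i)))%:E.
Proof. by rewrite fineK// ge0_fin_numE// set_fin. Qed.

Lemma cell_fine_gt0 i : 0 < fine (mu (U i)).
Proof. by rewrite -lte_fin -cell_fin cell_gt0. Qed.

Lemma cell_fine_ge i : D <= fine (mu (U i)).
Proof. by rewrite -lee_fin -cell_fin; have [_] := set_lower S. Qed.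

(** A majorant of the columns of K that is controlled on the covering sets. *)
Definition majorant x y : R[i] := (rnorm (K x y) + rnorm (O x y))%:C.
Local Notation B := majorant.

Lemma rnorm_majorant x y : rnorm (B x y) = rnorm (K x y) + rnorm (O x y).
Proof. by rewrite rnorm_real ger0_norm// addr_ge0 ?rnorm_ge0. Qed.

Lemma majorant_bound : kbound mu m B (nK + nO).
Proof.
have := kboundD hm (kbound_abs hm (set_kernel S)) (kbound_abs hm (set_osc S)).
by congr kbound; apply/funext => x; apply/funext => y; rewrite /B rmorphD.
Qed.

Lemma majorant_le i y z x : U i y -> U i z -> rnorm (K x z) <= rnorm (B x y).
Proof.
move=> Uy Uz; have [g g1 /(_ x) hg] := set_osc_le S Uy Uz.
rewrite rnorm_majorant -[rnorm (K x z)]mul1r -g1 -rnormM.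
rewrite -[g * _](subrK (K x y)) addrC; apply: le_trans (rnormD _ _) _.
by rewrite lerD2l rnormBC.
Qed.

Lemma osc_ge0 : 0 <= nO. Proof. exact: kbound_ge0 (set_osc S). Qed.
Lemma kernel_ge0 : 0 <= nK. Proof. exact: kbound_ge0 (set_kernel S). Qed.

Definition colC := C * (nK + nO).
(** Schur's bound holds almost everywhere; the covering transfers it from one
good point of a set of positive measure to every point of that set. *)
Lemma kernel_col p : (\int[mu]_x (rnorm (K x p) * m x p)%:E <= colC%:E)%E.
Proof.
have [i Up] := set_cover S p.
have [_ My] := ae_emeasurable_sec (kweight_meas hm (kbound_meas majorant_bound)).
have [y [Uy [By my]]] := ae_exists (set_meas S i) (cell_gt0 i)
  (filterI (kbound_col majorant_bound) My).
rewrite /colC EFinM; apply: (@le_trans _ _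
  (\int[mu]_x (C%:E * (rnorm (B x y) * m x y)%:E)))%E; last first.
  rewrite lintZ//; first by rewrite lee_wpmul2l// lee_fin (le_trans _ local_ge1).
    by move=> x; exact: rnorm_weight_ge0.
  by rewrite (le_trans _ local_ge1).
apply: le_lint => x; first exact: rnorm_weight_ge0.
rewrite -EFinM lee_fin mulrCA.
apply: ler_pM; [exact: rnorm_ge0|exact: weight_ge0|exact: majorant_le Up|].
rewrite mulrC; apply: le_trans (weight_submul hm x p y) _.
by rewrite ler_wpM2l ?weight_ge0// (set_local S Uy Up).
Qed.

Lemma kernel_row p : (\int[mu]_y (rnorm (K p y) * m p y)%:E <= colC%:E)%E.
Proof.
have := kernel_col p; congr (_ <= _)%E; apply: eq_integral => x _.
by rewrite [K x p]kernel_conj rnorm_conj (weight_sym hm).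
Qed.

Lemma kernel_row_v p :
  (\int[mu]_y (rnorm (K p y) * v y)%:E <= (colC * v p)%:E)%E.
Proof.
apply: (@le_trans _ _ (\int[mu]_y ((v p)%:E * (rnorm (K p y) * m p y)%:E)))%E.
  apply: le_lint => y; first by rewrite lee_fin mulr_ge0 ?rnorm_ge0 ?v_ge0.
  rewrite -EFinM lee_fin mulrCA ler_wpM2l ?rnorm_ge0// mulrC (weight_sym hm p).
  exact: v_submul.
rewrite lintZ ?v_ge0//.
- by rewrite muleC EFinM lee_wpmul2r ?kernel_row// lee_fin v_ge0.
- by move=> y; exact: rnorm_weight_ge0.
- apply: ae_emeasurableW; apply/measurable_EFinP; apply: measurable_funM.
    by apply: cmeasurable_rnorm; exact: frame_kernel_cmeasurable hfr p.
  exact: weight_meas_snd.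
Qed.

Lemma kernel_col_v p :
  (\int[mu]_y (rnorm (K y p) * v y)%:E <= (colC * v p)%:E)%E.
Proof.
have := kernel_row_v p; congr (_ <= _)%E; apply: eq_integral => x _.
by rewrite [K x p]kernel_conj rnorm_conj.
Qed.

(** The functions [one i] show that Y is rich enough: it contains the
indicators of the covering sets. *)
Definition one i : X -> R[i]^o := fun x => (\1_(U i) x : R)%:C.

Lemma one_meas i : ae_measurable mu (one i : X -> R[i]).
Proof.
apply: ae_measurableW; apply: cmeasurable_real; apply: measurable_indic.
exact: set_meas.
Qed.

Lemma weight_pair i j (x y : X) p q : U i p -> U j q -> U i x -> U j y ->
  m x y <= C ^+ 2 * m p q.
Proof.
move=> Up Uq Ux Uy; apply: le_trans (weight_submul hm x y p) _.
have C0 : 0 <= C by exact: le_trans local_ge1.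
rewrite expr2 -mulrA; apply: ler_pM; [exact: weight_ge0..|exact: set_local Up|].
apply: le_trans (weight_submul hm p y q) _.
by rewrite mulrC ler_wpM2r ?weight_ge0// (set_local S Uq Uy).
Qed.

(** The operator with this kernel integrates over U j and spreads the result
over U i. *)
Lemma one_one_bound i j p q : U i p -> U j q ->
  kbound mu m (fun x y => (\1_(U i) x)%:C * (\1_(U j) y)%:C)
    (C ^+ 2 * m p q * (fine (mu (U i)) + fine (mu (U j)))).
Proof.
move=> Up Uq; apply: kbound_indic => //; try exact: set_meas.
- by rewrite cell_fin lee_fin lerDl ltW// cell_fine_gt0.
- by rewrite [leLHS]cell_fin lee_fin lerDr ltW// cell_fine_gt0.
- by rewrite mulr_ge0 ?weight_ge0// exprn_ge0// (le_trans _ local_ge1).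
- by rewrite addr_ge0// ltW// cell_fine_gt0.
- by move=> x y; exact: weight_pair Up Uq.
Qed.

Lemma int_one i : (\int[mu]_x (\1_(U i) x)%:E = mu (U i))%E.
Proof. by rewrite integral_indic ?setIT//; exact: set_meas. Qed.

Definition mass j (F : X -> R[i]^o) : \bar R :=
  (\int[mu]_y (\1_(U j) y * rnorm (F y : R[i]))%:E)%E.

Lemma one_spread i j p q F : Y F -> U i p -> U j q ->
  [/\ (mass j F < +oo)%E,
      Y (fun x => (fine (mass j F) * \1_(U i) x)%:C : R[i]^o) &
      NY (fun x => (fine (mass j F) * \1_(U i) x)%:C : R[i]^o) <=
        C ^+ 2 * m p q * (fine (mu (U i)) + fine (mu (U j))) * NY F].
Proof.
move=> YF Up Uq; have kb := one_one_bound Up Uq.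
have [afin Ya Na] := kbound_abs_act hY hm hact kb YF.
have aE x : abs_act mu (fun x y => (\1_(U i) x)%:C * (\1_(U j) y)%:C) F x =
    ((\1_(U i) x)%:E * mass j F)%E.
  rewrite /abs_act /mass -lintZ.
  - apply: eq_integral => y _; rewrite !rnormM !rnorm_real !ger0_norm ?indicE//.
    by rewrite -EFinM mulrA.
  - by move=> y; rewrite lee_fin mulr_ge0 ?rnorm_ge0// indicE.
  - by rewrite indicE.
  - have := ae_emeasurableM (ae_measurable_rnorm (one_meas j))
      (ae_measurable_rnorm (solid_meas hY YF)).
    apply: ae_emeasurable_ae; apply: aeW => y.
    by rewrite -EFinM /one rnorm_real ger0_norm// indicE.
have mfin : (mass j F < +oo)%E.
  have [x [Ux]] := ae_exists (set_meas S i) (cell_gt0 i) afin.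
  by rewrite aE indicE mem_set//= mul1e.
have fE : (fun x => (fine (abs_act mu (fun x y => (\1_(U i) x)%:C * (\1_(U j) y)%:C) F x))%:C : R[i]^o) =
    (fun x => (fine (mass j F) * \1_(U i) x)%:C : R[i]^o).
  apply/funext => x; rewrite aE fineM//; first by rewrite mulrC.
  by rewrite ge0_fin_numE ?mfin// integral_ge0// => y _;
    rewrite lee_fin mulr_ge0 ?rnorm_ge0// indicE.
by rewrite fE in Ya Na.
Qed.

Lemma mass_ge0 j F : (0 <= mass j F)%E.
Proof.
by apply: integral_ge0 => y _; rewrite lee_fin mulr_ge0 ?rnorm_ge0// indicE.
Qed.

Lemma mass_meas j F : Y F ->
  ae_emeasurable mu (fun y => (\1_(U j) y * rnorm (F y : R[i]))%:E).
Proof.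
move=> YF; have := ae_emeasurableM (ae_measurable_rnorm (one_meas j))
  (ae_measurable_rnorm (solid_meas hY YF)).
apply: ae_emeasurable_ae; apply: aeW => y.
by rewrite -EFinM /one rnorm_real ger0_norm// indicE.
Qed.

(** A nonzero element of Y has mass on some set of the covering, and this mass
is spread over any other one. *)
Lemma one_in_solid i : Y (one i) /\ 0 < NY (one i).
Proof.
have [F YF F0] := solid_nontrivial hY.
have [j mj] : exists j, mass j F <> 0.
  apply: contrapT => nmass; apply: F0.
  have Fj j : {ae mu, forall x, U j x -> F x = 0}.
    have mj : mass j F = 0 by apply: contrapT => mj; apply: nmass; exists j.
    have f0 y : (0 <= (\1_(U j) y * rnorm (F y : R[i]))%:E)%E.
      by rewrite lee_fin mulr_ge0 ?rnorm_ge0// indicE.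
    apply: filterS (lint_eq0_ae f0 (mass_meas j YF) mj) => x + Ux.
    by rewrite indicE mem_set//= mul1r => -[]; exact: rnorm_eq0.
  have : {ae mu, forall x, forall n,
      if choice.unpickle n is Some j then U j x -> F x = 0 else True}.
    by apply: ae_foralln => n; case: choice.unpickle => [j|]; [exact: Fj|exact: aeW].
  apply: filterS => x Fx; have [j Uj] := set_cover S x.
  by have := Fx (choice.pickle j); rewrite choice.pickleK; exact.
have [mfin Ym Nm] := one_spread YF (set_sample S i) (set_sample S j).
have mpos : 0 < fine (mass j F).
  by rewrite fine_gt0// mfin andbT lt0e mass_ge0 andbT; exact/eqP.
have oE : one i = ((fine (mass j F))^-1)%:C *:
    (fun x => (fine (mass j F) * \1_(U i) x)%:C : R[i]^o).
  apply/funext => x; rewrite /one /GRing.scale/= /GRing.scale/= -rmorphM mulrA.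
  by rewrite mulVf ?mul1r// gt_eqF.
have Yo : Y (one i) by rewrite oE; exact: (solidZ hY _ Ym).1.
split => //; rewrite lt0r (solid_ge0 hY Yo) andbT; apply/eqP => o0.
have [x [Ux]] := ae_exists (set_meas S i) (cell_gt0 i) (solid_eq0 hY Yo o0).
rewrite /one indicE mem_set//= => /(congr1 (@complex.Re R))/= /eqP.
by rewrite oner_eq0.
Qed.

(** The mass of F on U i is spread over a fixed set around the base point of v;
the weight between the two sets is v, up to constants. *)
Lemma mass_bound : exists2 c, 0 <= c & forall i p F, U i p -> Y F ->
  (mass i F < +oo)%E /\ fine (mass i F) <= c * v p * NY F * fine (mu (U i)).
Proof.
have [i0 Ui0] := set_cover S z0.
have [Yo No] := one_in_solid i0.
have C0 : 0 <= C by exact: le_trans local_ge1.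
have D0 : 0 < D by have [] := set_lower S.
exists (C ^+ 2 * (fine (mu (U i0)) / D + 1) / NY (one i0)).
  rewrite mulr_ge0 ?invr_ge0 ?(ltW No)// mulr_ge0 ?exprn_ge0// addr_ge0//.
  by rewrite divr_ge0 ?(ltW D0) ?(ltW (cell_fine_gt0 i0)).
move=> i p F Up YF; have [mfin Ym Nm] := one_spread YF Ui0 Up.
split => //; have mE : (fun x => (fine (mass i F) * \1_(U i0) x)%:C : R[i]^o) =
    (fine (mass i F))%:C *: one i0.
  by apply/funext => x; rewrite /one /GRing.scale/= /GRing.scale/= -rmorphM.
move: Nm; rewrite mE (solidZ hY _ Yo).2 rnorm_real ger0_norm ?fine_ge0 ?mass_ge0//.
rewrite -ler_pdivlMr// => /le_trans; apply.
rewrite (weight_sym hm z0) -/(v p).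
have e0 : 0 <= C ^+ 2 * v p * NY F / NY (one i0).
  by rewrite !mulr_ge0 ?invr_ge0 ?(ltW No) ?exprn_ge0 ?v_ge0 ?(solid_ge0 hY YF).
rewrite [leLHS](_ : _ = C ^+ 2 * v p * NY F / NY (one i0) *
  (fine (mu (U i0)) + fine (mu (U i)))); last by ring.
rewrite [leRHS](_ : _ = C ^+ 2 * v p * NY F / NY (one i0) *
  ((fine (mu (U i0)) / D + 1) * fine (mu (U i)))); last by ring.
apply: ler_wpM2l => //; rewrite mulrDl mul1r lerD2r mulrAC ler_pdivlMr//.
by rewrite ler_wpM2l ?(cell_fine_ge i)// ltW// cell_fine_gt0.
Qed.

Lemma kernel_act_meas p F : Y F -> ae_measurable mu (fun z => K p z * F z).
Proof.
move=> YF; apply: ae_measurableM; last exact: (solid_meas hY YF).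
by apply: ae_measurableW; exact: frame_kernel_cmeasurable hfr p.
Qed.

(** The integral over row p is below the action of the majorant at each point of
a covering set around p, hence below its average over that set. *)
Lemma kernel_abs_bound : exists2 c, 0 <= c & forall p F, Y F ->
  (abs_act mu K F p <= (c * v p * NY F)%:E)%E.
Proof.
have [c c0 mb] := mass_bound.
have nKO : 0 <= nK + nO by rewrite addr_ge0 ?kernel_ge0 ?osc_ge0.
exists (c * (nK + nO)); first exact: mulr_ge0.
move=> p F YF; have [i Up] := set_cover S p.
have [bfin Yb Nb] := kbound_abs_act hY hm hact (kbound_adj hm majorant_bound) YF.
set b := fun x y => Num.conj (B y x) in bfin Yb Nb.
have le_b y : U i y -> (abs_act mu K F p <= abs_act mu b F y)%E.
  move=> Uy; apply: le_lint => z; first by rewrite lee_fin rnorm_ge0.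
  rewrite lee_fin rnormM [leRHS]rnormM ler_wpM2r ?rnorm_ge0// /b rnorm_conj.
  by rewrite kernel_conj rnorm_conj; exact: majorant_le Uy Up.
have [y [Uy yfin]] := ae_exists (set_meas S i) (cell_gt0 i) bfin.
have afin : (abs_act mu K F p)%E \is a fin_num.
  by rewrite ge0_fin_numE ?abs_act_ge0//; exact: le_lt_trans (le_b y Uy) yfin.
rewrite -(fineK afin) lee_fin.
have [mfin] := mb _ _ _ Up Yb; set M := mass i _ => Mle.
have low : ((fine (abs_act mu K F p) * fine (mu (U i)))%:E <= M)%E.
  rewrite EFinM -cell_fin -int_one.
  rewrite -lintZ; last 3 first.
  - by move=> x; rewrite lee_fin.
  - by rewrite fine_ge0// abs_act_ge0.
  - by apply: ae_emeasurableW; apply/measurable_EFinP/measurable_indic; exact: set_meas.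
  apply: ae_le_lint.
  - by move=> x; rewrite -EFinM lee_fin mulr_ge0 ?fine_ge0 ?abs_act_ge0// indicE.
  - by move=> x; rewrite lee_fin mulr_ge0 ?rnorm_ge0// indicE.
  apply: filterS bfin => x xfin; rewrite -EFinM lee_fin mulrC indicE.
  case: (boolP (x \in U i)) => [/set_mem Ux|_]; last by rewrite !mul0r.
  rewrite !mul1r rnorm_real ger0_norm ?fine_ge0 ?abs_act_ge0//.
  by apply: fine_le; [exact: afin|rewrite ge0_fin_numE ?abs_act_ge0|exact: le_b].
rewrite -(ler_pM2r (cell_fine_gt0 i)).
have : fine (abs_act mu K F p) * fine (mu (U i)) <= fine M.
  by rewrite -lee_fin fineK// ge0_fin_numE// mass_ge0.
move=> /le_trans; apply; apply: le_trans Mle _.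
rewrite ler_wpM2r ?(ltW (cell_fine_gt0 i))//.
rewrite [leRHS](_ : _ = c * v p * ((nK + nO) * NY F)); last by ring.
by rewrite ler_wpM2l// mulr_ge0 ?v_ge0.
Qed.

(** The column of K at p is dominated by the action of the majorant on the
indicator of a covering set around p. *)
Lemma kernel_column_solid p : Y (fun x => K x p : R[i]^o).
Proof.
have [i Up] := set_cover S p; have [Yo _] := one_in_solid i.
have [bfin Yb _] := kbound_abs_act hY hm hact majorant_bound Yo.
have U0 := cell_fine_gt0 i.
apply: (@proj1 _ _ (solid_dom hY (c := (fine (mu (U i)))^-1) _ Yb _ _)).
- by apply: ae_measurableW; exact: frame_kernel_cmeasurable2 hfr p.
- by rewrite invr_ge0 ltW.
apply: filterS bfin => x xfin.
rewrite rnorm_real ger0_norm ?fine_ge0 ?abs_act_ge0// mulrC ler_pdivlMr//.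
rewrite -lee_fin fineK ?ge0_fin_numE ?abs_act_ge0// EFinM -cell_fin.
rewrite -int_one -lintZ ?rnorm_ge0//; last first.
  by apply: ae_emeasurableW; apply/measurable_EFinP/measurable_indic; exact: set_meas.
apply: le_lint => y; first by rewrite mule_ge0// lee_fin rnorm_ge0.
rewrite -EFinM lee_fin rnormM /one rnorm_real ger0_norm// indicE.
case: (boolP (y \in U i)) => [/set_mem Uy|_]; last by rewrite !mulr0.
by rewrite !mulr1; exact: majorant_le Uy Up.
Qed.

(** * Functionals defined by functions *)

Local Notation HH := (H1 mu ip psi v).
Local Notation NH := (H1_norm mu ip psi v).

Lemma frame_inv_gt0 : 0 < A^-1. Proof. by rewrite invr_gt0 (frame_gt0 hfr). Qed.

Lemma H1_lint g : Lw_norm mu 1%E v (V g) = (\int[mu]_x (v x * rnorm (V g x : R[i]))%:E)%E.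
Proof.
rewrite /Lw_norm Lnorm1; apply: eq_integral => x _.
by rewrite gee0_abs// lee_fin mulr_ge0 ?rnorm_ge0 ?(v_ge0).
Qed.

Lemma weighted_ge0 (F : X -> R[i]) x : (0 <= (v x * rnorm (F x))%:E)%E.
Proof. by rewrite lee_fin mulr_ge0 ?rnorm_ge0 ?(v_ge0). Qed.

Lemma weighted_meas (F : X -> R[i]) : ae_measurable mu F ->
  ae_emeasurable mu (fun x => (v x * rnorm (F x))%:E).
Proof.
move=> mF; have mv : ae_emeasurable mu (fun x => (v x)%:E).
  by apply: ae_emeasurableW; exact/measurable_EFinP/(v_meas).
apply: ae_emeasurable_ae (ae_emeasurableM mv (ae_measurable_rnorm mF)).
exact: aeW.
Qed.

Lemma H1P g : HH g <-> (\int[mu]_x (v x * rnorm (V g x : R[i]))%:E < +oo)%E.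
Proof.
rewrite -H1_lint; split=> [[]//|gfin]; split => //.
by apply: ae_measurableW; exact: voice_cmeasurable hfr g.
Qed.

Lemma H1_norm_ge0 g : 0 <= NH g.
Proof. by rewrite /H1_norm H1_lint fine_ge0// integral_ge0// => x _; exact: weighted_ge0. Qed.

Lemma H1_normE g : HH g ->
  (\int[mu]_x (v x * rnorm (V g x : R[i]))%:E)%E = (NH g)%:E.
Proof.
move=> /H1P gfin; rewrite /H1_norm H1_lint fineK// ge0_fin_numE//.
by apply: integral_ge0 => x _; exact: weighted_ge0.
Qed.

Lemma voiceD g h x : V (g + h) x = V g x + V h x.
Proof. by rewrite /voice ipDl. Qed.

Lemma voiceZ a g x : V (a *: g) x = a * V g x.
Proof. by rewrite /voice ipZl. Qed.

Lemma H1_lin a g h : HH g -> HH h -> HH (a *: g + h).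
Proof.
move=> /H1P gfin /H1P hfin; apply/H1P.
apply: (@le_lt_trans _ _ (\int[mu]_x ((rnorm a)%:E * (v x * rnorm (V g x : R[i]))%:E +
   (v x * rnorm (V h x : R[i]))%:E)))%E.
  apply: le_lint => x; first exact: weighted_ge0.
  rewrite -EFinM -EFinD lee_fin voiceD voiceZ mulrCA -mulrDr.
  by rewrite ler_wpM2l ?(v_ge0)//; apply: le_trans (rnormD _ _) _; rewrite rnormM.
have mV f : ae_emeasurable mu (fun x => (v x * rnorm (V f x : R[i]))%:E).
  by apply: weighted_meas; apply: ae_measurableW; exact: voice_cmeasurable hfr f.
rewrite lintD.
- rewrite lintZ ?rnorm_ge0//; last by move=> x; exact: weighted_ge0.
  by rewrite lte_add_pinfty// lte_mul_pinfty// lee_fin rnorm_ge0.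
- by move=> x; rewrite mule_ge0 ?weighted_ge0// lee_fin rnorm_ge0.
- by move=> x; exact: weighted_ge0.
- by apply: ae_emeasurableM => //; apply: ae_emeasurableW.
- exact: mV.
Qed.

Lemma H1_0 : HH 0.
Proof.
apply/H1P; under eq_integral => x _ do rewrite -(scale0r 0) voiceZ mul0r rnorm0 mulr0.
by rewrite integral0.
Qed.

Lemma H1Z a g : HH g -> HH (a *: g).
Proof. by move=> gH; rewrite -[a *: g]addr0; apply: H1_lin => //; exact: H1_0. Qed.

Lemma H1D g h : HH g -> HH h -> HH (g + h).
Proof. by move=> gH hH; rewrite -[g]scale1r; exact: H1_lin. Qed.

Lemma H1_sum (J : Type) (r : seq J) (g : J -> H) : (forall j, HH (g j)) ->
  HH (\sum_(j <- r) g j).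
Proof.
move=> gH; elim: r => [|j r IH]; first by rewrite big_nil; exact: H1_0.
by rewrite big_cons; exact: H1D.
Qed.

Lemma voice_psi p x : V (psi p) x = A%:C * K x p.
Proof.
rewrite frame_kernel_voice mulrA -rmorphM divff ?mul1r//.
by rewrite gt_eqF ?(frame_gt0 hfr).
Qed.

(** The column bound at every point, and not only at almost every point, is what
places each frame vector in H1. *)
Lemma H1_psi p : HH (psi p) /\ NH (psi p) <= A * colC * v p.
Proof.
have A0 := ltW (frame_gt0 hfr).
have bd : (\int[mu]_x (v x * rnorm (V (psi p) x : R[i]))%:E <=
    (A * colC * v p)%:E)%E.
  under eq_integral => x _ do
    rewrite voice_psi rnormM rnorm_real ger0_norm// mulrCA [v x * _]mulrC EFinM.
  rewrite lintZ//.
  - by rewrite -mulrA EFinM lee_wpmul2l// (kernel_col_v).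
  - by move=> x; rewrite mulrC; exact: (weighted_ge0 (K ^~ p)).
  - under eq_fun do rewrite mulrC; apply: weighted_meas.
    by apply: ae_measurableW; exact: frame_kernel_cmeasurable2 hfr p.
have pH : HH (psi p) by apply/H1P; exact: le_lt_trans bd (ltry _).
by split => //; rewrite -lee_fin -H1_normE.
Qed.

Definition pair (F : X -> R[i]^o) g := cintegral mu (fun x => F x * Num.conj (V g x)).

Lemma pair_cint (F : X -> R[i]^o) (c : R) g : ae_measurable mu F ->
  {ae mu, forall x, rnorm (F x : R[i]) <= c * v x} -> HH g ->
  cintegrable mu (fun x => F x * Num.conj (V g x)) /\
  rnorm (pair F g) <= c * NH g.
Proof.
move=> mF Fc gH.
have mV : ae_measurable mu (V g : X -> R[i]).
  by apply: ae_measurableW; exact: voice_cmeasurable hfr g.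
have c0 : (0 < mu setT)%E -> 0 <= c.
  move=> mu0; have [x [_]] := ae_exists measurableT mu0 Fc.
  by move=> /(le_trans (rnorm_ge0 _)); rewrite pmulr_lge0// (v_gt0).
have bd : (\int[mu]_x (rnorm (F x * Num.conj (V g x)))%:E <= (c * NH g)%:E)%E.
  have mu0 : (0 < mu setT)%E.
    have [i _] := set_cover S z0; apply: lt_le_trans (cell_gt0 i) _.
    by apply: le_measure; rewrite ?inE//; exact: set_meas S i.
  rewrite EFinM -H1_normE// -lintZ ?c0//; last 2 first.
  - by move=> x; exact: weighted_ge0.
  - exact: weighted_meas.
  apply: ae_le_lint.
  - by move=> x; rewrite lee_fin rnorm_ge0.
  - by move=> x; rewrite mule_ge0 ?weighted_ge0// lee_fin c0.
  apply: filterS Fc => x Fc; rewrite rnormM rnorm_conj -EFinM lee_fin mulrA.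
  by rewrite ler_wpM2r ?rnorm_ge0.
have iF : cintegrable mu (fun x => F x * Num.conj (V g x)).
  split; last exact: le_lt_trans bd (ltry _).
  by apply: ae_measurableM => //; exact: ae_measurable_conj.
split => //; rewrite -lee_fin; apply: le_trans bd; exact: le_rnorm_cintegral.
Qed.

Lemma act_cint p F : Y F -> cintegrable mu (fun z => K p z * F z).
Proof.
move=> YF; split; first exact: (kernel_act_meas).
by have [c _ /(_ p F YF)] := kernel_abs_bound; move=> /le_lt_trans; apply; rewrite ltry.
Qed.

Lemma act_lin p a F G : Y F -> Y G ->
  kernel_act mu K (a *: F + G) p = a * kernel_act mu K F p + kernel_act mu K G p.
Proof.
move=> YF YG; rewrite /kernel_act -cintegralZ; last exact: act_cint.
rewrite -cintegralD; [|exact/cintegrableZ/act_cint|exact: act_cint].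
by apply: cintegral_ae; apply: aeW => y; rewrite mulrDr mulrCA.
Qed.

Lemma act_bound : exists2 c, 0 <= c & forall p F, Y F ->
  rnorm (kernel_act mu K F p : R[i]) <= c * v p * NY F.
Proof.
have [c c0 kb] := kernel_abs_bound; exists c => // p F YF.
rewrite -lee_fin; apply: le_trans (kb p F YF).
exact: le_rnorm_cintegral (act_cint p YF).
Qed.

Lemma act_solid F : Y F -> Y (kernel_act mu K F) /\ NY (kernel_act mu K F) <= nK * NY F.
Proof. exact: (kbound_act hY hm hact (set_kernel S)). Qed.

Lemma act_pair_cint F g : Y F -> HH g ->
  cintegrable mu (fun x => kernel_act mu K F x * Num.conj (V g x)).
Proof.
move=> YF gH; have [c c0 ab] := act_bound.
apply: (proj1 (@pair_cint _ (c * NY F) _ _ _ gH)).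
  exact: solid_meas hY _ (act_solid YF).1.
by apply: aeW => x; rewrite mulrAC; exact: ab.
Qed.

(** Moving K to the other factor is Fubini's theorem, the double integral being
dominated by the weighted bound of [kernel_abs_bound]. *)
Lemma pair_act F g : Y F -> HH g -> pair (kernel_act mu K F) g = pair F g.
Proof.
move=> YF gH; have [c c0 kb] := kernel_abs_bound.
have mV : ae_measurable mu (V g : X -> R[i]).
  by apply: ae_measurableW; exact: voice_cmeasurable hfr g.
pose k y z := Num.conj (V g y) * (K y z * F z).
have mk : ae_measurable2 mu k.
  apply: ae_measurableM; first exact: ae_measurable2_fst (ae_measurable_conj mV).
  apply: ae_measurableM; first exact: kbound_meas (set_kernel S).
  exact: ae_measurable2_snd (solid_meas hY YF).
have kfin : (\int[mu]_y \int[mu]_z (rnorm (k y z))%:E < +oo)%E.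
  apply: (@le_lt_trans _ _ (\int[mu]_y ((c * NY F)%:E * (v y * rnorm (V g y : R[i]))%:E)))%E.
    apply: le_lint => y; first by apply: integral_ge0 => z _; rewrite lee_fin rnorm_ge0.
    under eq_integral => z _ do rewrite rnormM rnorm_conj EFinM.
    rewrite lintZ ?rnorm_ge0//; last 2 first.
    - by move=> z; rewrite lee_fin rnorm_ge0.
    - by apply: ae_measurable_rnorm; exact: (kernel_act_meas).
    rewrite -EFinM [X in (_ <= X%:E)%E](_ : _ = rnorm (V g y : R[i]) * (c * v y * NY F)); last by ring.
    by rewrite EFinM lee_wpmul2l ?lee_fin ?rnorm_ge0// kb.
  rewrite lintZ.
  - by rewrite H1_normE// -EFinM ltry.
  - by move=> x; exact: weighted_ge0.
  - by rewrite mulr_ge0// (solid_ge0 hY YF).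
  - exact: weighted_meas.
have [_ _ _ kE] := cfubini mk kfin.
transitivity (cintegral mu (fun y => cintegral mu (k y))).
  apply: cintegral_ae; apply: aeW => y.
  by rewrite /k cintegralZ; [rewrite mulrC|exact: act_cint].
rewrite kE; apply: cintegral_ae; apply: aeW => z.
have [iK KE] := voice_repr hip hfr g z.
transitivity (cintegral mu (fun y => F z * Num.conj (K z y * V g y))).
  apply: cintegral_ae; apply: aeW => y.
  by rewrite /k conjM -frame_kernel_conj; ring.
by rewrite (cintegralZ (F z) (cintegrable_conj iK)) (cintegral_conj iK) -[V g z]KE.
Qed.

(** The functional with transform K F, by [rho_voice]. On H1 it is the pairing
with K F instead of F because the first is bounded by the weight v, whatever F
in Y. *)
Definition rho (F : X -> R[i]^o) : H -> R[i]^o :=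
  patch (fun=> 0) HH (fun g => (A^-1)%:C * pair (kernel_act mu K F) g).

Lemma rho_in F g : HH g -> rho F g = (A^-1)%:C * pair (kernel_act mu K F) g.
Proof. by move=> gH; rewrite /rho /patch mem_set. Qed.

Lemma rho_out F g : ~ HH g -> rho F g = 0.
Proof. by move=> gH; rewrite /rho /patch memNset. Qed.

Lemma pair_psi F p : Y F -> (A^-1)%:C * pair F (psi p) = kernel_act mu K F p.
Proof.
move=> YF; rewrite /pair /kernel_act -cintegralZ.
  by apply: cintegral_ae; apply: aeW => y; rewrite frame_kernelE; ring.
apply: cintegrable_ae (cintegrableZ A%:C (act_cint p YF)).
by apply: aeW => y; rewrite voice_psi conjM conjR -frame_kernel_conj; ring.
Qed.

Lemma rho_voice F : Y F -> extended_voice psi (rho F) = kernel_act mu K F.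
Proof.
move=> YF; apply/funext => p; rewrite /extended_voice rho_in; last exact: (H1_psi p).1.
by rewrite pair_act ?pair_psi//; exact: (H1_psi p).1.
Qed.

Lemma pair_lin F a g h : cintegrable mu (fun x => F x * Num.conj (V g x)) ->
  cintegrable mu (fun x => F x * Num.conj (V h x)) ->
  pair F (a *: g + h) = Num.conj a * pair F g + pair F h.
Proof.
move=> ig ih; rewrite /pair -cintegralZ// -cintegralD//; last exact: cintegrableZ.
apply: cintegral_ae; apply: aeW => x; rewrite voiceD voiceZ conjD conjM; ring.
Qed.

Lemma rho_antidual F : Y F -> antidual mu ip psi v (rho F).
Proof.
move=> YF; split; first exact: rho_out.
- move=> a g h gH hH; rewrite !rho_in//; last exact: H1_lin.
  rewrite pair_lin; [ring|exact: act_pair_cint..].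
- have [c c0 ab] := act_bound; exists (A^-1 * (c * NY F)) => g gH.
  rewrite rho_in// rnormM rnorm_real ger0_norm ?(ltW frame_inv_gt0)//.
  rewrite -mulrA ler_wpM2l ?(ltW frame_inv_gt0)//.
  apply: (proj2 (@pair_cint _ (c * NY F) _ _ _ gH)).
    exact: solid_meas hY _ (act_solid YF).1.
  by apply: aeW => x; rewrite mulrAC; exact: ab.
Qed.

Local Notation BB := (Co mu ip psi v Y).
Local Notation NB := (Co_norm psi NY).

Lemma rho_Co F : Y F -> BB (rho F) /\ NB (rho F) <= nK * NY F.
Proof.
move=> YF; rewrite /Co_norm /Co/= rho_voice//; have [? ?] := act_solid YF.
by split => //; split => //; exact: rho_antidual.
Qed.

Lemma rho_lin a F G : Y F -> Y G -> rho (a *: F + G) = a *: rho F + rho G.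
Proof.
move=> YF YG; apply/funext => g.
have [gH|gH] := pselect (HH g); last first.
  by rewrite rho_out//; symmetry; rewrite !fctE !rho_out// scaler0 addr0.
rewrite !fctE/= !rho_in//= /pair.
rewrite (@cintegral_ae _ _ _ _ _ (fun x => a * (kernel_act mu K F x * Num.conj (V g x)) +
  kernel_act mu K G x * Num.conj (V g x))); last first.
  by apply: aeW => x; rewrite act_lin//; ring.
rewrite cintegralD ?cintegralZ; [|exact: act_pair_cint|exact/cintegrableZ/act_pair_cint|exact: act_pair_cint].
by rewrite mulrDr mulrCA.
Qed.

(** * Discretization *)

(** Each point is sent to the covering set of smallest code containing it. *)
Lemma index_selection : exists ind : X -> I, (forall x, U (ind x) x) /\
  forall i, measurable [set x | ind x = i].
Proof.
pose Q n := [set x | exists i, choice.pickle i = n /\ U i x].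
have mQ n : measurable (Q n).
  have [[i pi]|ni] := pselect (exists i : I, choice.pickle i = n).
    rewrite (_ : Q n = U i); first exact: set_meas S i.
    apply/seteqP; split => x /=; last by exists i.
    by move=> [j [pj Uj]]; rewrite (_ : i = j)//; apply: (pcan_inj choice.pickleK); rewrite pi pj.
  rewrite (_ : Q n = set0)//; apply/seteqP; split => x //= [i [pi _]].
  by apply: ni; exists i.
have [f [mf fQ]] := first_index mQ.
have fex x : exists i, choice.pickle i = f x /\ U i x.
  have [i Ui] := set_cover S x; exact: fQ (choice.pickle i) (ex_intro _ i (conj erefl Ui)).
pose ind x := projT1 (cid (fex x)).
have indP x : choice.pickle (ind x) = f x /\ U (ind x) x := projT2 (cid (fex x)).
exists ind; split => [x|i]; first exact: (indP x).2.
rewrite (_ : mkset _ = [set x | f x = choice.pickle i]); first exact: mf.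
apply/seteqP; split => x /=; have [<- _] := indP x; first by move=> ->.
by move=> /(pcan_inj choice.pickleK).
Qed.

(** The unimodular factors of the oscillation estimate depend on the point in
an arbitrary way. Approximating them from a countable dense set makes a
measurable choice possible, at the price of an arbitrarily small loss. *)
Lemma phase_selection (ind : X -> I) (e : R) : 0 < e ->
  (forall x, U (ind x) x) -> (forall i, measurable [set x | ind x = i]) ->
  exists gam : X -> R[i], [/\ cmeasurable gam, forall x, rnorm (gam x) = 1 &
    kbound mu m (fun x y => K x y - gam y * K x (xs (ind y)))
      ((1 + e) * nO + e * nK)].
Proof.
move=> e0 Uind mind; have [om [om1 omd]] := dense_unimodular R.
have [Kt mKt KKt] := kbound_meas (set_kernel S).
have [Ot mOt OOt] := kbound_meas (set_osc S).
pose Kx i x := K x (xs i).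
have mKx i : cmeasurable (Kx i) by exact: frame_kernel_cmeasurable2 hfr _.
pose h (g : R[i]) i (p : X * X) : R :=
  Num.max 0 (rnorm (Kt p - g * Kx i p.1) - ((1 + e) * rnorm (Ot p) + e * rnorm (Kt p))).
have mh (g : X * X -> R[i]) (ii : X * X -> nat) (F : nat -> X -> R[i]) :
    cmeasurable g -> (forall n, measurable [set p | ii p = n]) ->
    (forall n, cmeasurable (F n)) ->
    measurable_fun setT (fun p => Num.max 0 (rnorm (Kt p - g p * F (ii p) p.1) -
      ((1 + e) * rnorm (Ot p) + e * rnorm (Kt p)))).
  move=> mg mii mF; apply: measurable_maxr => //; apply: measurable_funB.
    apply: cmeasurable_rnorm.
    have : cmeasurable (fun p : X * X => Kt p + (-1) * (g p * F (ii p) p.1)).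
      apply: cmeasurableD => //; apply: cmeasurableM; first exact: cmeasurable_cst.
      apply: cmeasurableM => //.
      apply: (@cmeasurable_glue _ _ _ ii (fun n p => F n p.1)) => // n.
      by split; [exact: (measurableT_comp (mF n).1)|exact: (measurableT_comp (mF n).2)].
    by congr cmeasurable; apply/funext => p; rewrite mulN1r.
  by apply: measurable_funD; apply: measurable_funM => //; exact: cmeasurable_rnorm.
have mhi g i : measurable_fun setT (h g i).
  apply: (mh (fun=> g) (fun=> 0%N) (fun=> Kx i)) => //.
  move=> n; case: n => [|n]; first by rewrite (_ : mkset _ = setT)//; apply/seteqP; split.
  by rewrite (_ : mkset _ = set0)//; apply/seteqP; split.
pose G g i y := (\int[mu]_x (h g i (x, y))%:E)%E.
have mG g i : measurable_fun setT (G g i).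
  apply: (measurable_fun_fubini_tonelli_G (fun p => (h g i p)%:E)).
    exact/measurable_EFinP.
  by move=> p; rewrite lee_fin le_max lexx.
pose Q k := [set y | G (om k) (ind y) y = 0%E].
have mQ k : measurable (Q k).
  have mpi := levels_pickle mind.
  rewrite (_ : Q k = \bigcup_n ([set y | choice.pickle (ind y) = n] `&`
      (if choice.unpickle n is Some i then [set y | G (om k) i y = 0%E] else set0))).
    apply: bigcup_measurable => n _; apply: measurableI; first exact: mpi.
    case: choice.unpickle => // i; rewrite (_ : mkset _ = G (om k) i @^-1` [set 0%E])//.
    by rewrite -[_ @^-1` _]setTI; exact: mG.
  apply/seteqP; split => y /=.
    by move=> Gy; exists (choice.pickle (ind y)) => //; split => //=; rewrite choice.pickleK.
  by move=> [n _ [<-]]; rewrite choice.pickleK.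
have [kk [mkk kkQ]] := first_index mQ.
pose gam y := om (kk y).
have mgam : cmeasurable gam.
  exact: (@cmeasurable_glue _ _ _ kk (fun n _ => om n)).
have [_ KKy] := ae_prod_eq_xy KKt; have [_ OOy] := ae_prod_eq_xy OOt.
have Qae : {ae mu, forall y, Q (kk y) y}.
  apply: filterS2 KKy OOy => y Ky Oy.
  have [g g1 gle] := set_osc_le S (Uind y) (set_sample S (ind y)).
  have [k gk] := omd g e g1 e0.
  apply: (kkQ y k); rewrite /Q/= /G.
  rewrite (ae_eq_int (g := fun=> 0%E)) ?integral0//.
  apply: filterS2 Ky Oy => x Kx0 Ox0; congr EFin; apply/eqP.
  rewrite /h/= eq_sym; apply/eqP/esym/max_idPl; rewrite subr_le0 -Kx0 -Ox0.
  have bd : rnorm (K x (xs (ind y))) <= rnorm (K x y) + rnorm (O x y).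
    have := majorant_le x (Uind y) (set_sample S (ind y)).
    by rewrite rnorm_majorant.
  have -> : K x y - om k * Kx (ind y) x =
      (K x y - g * K x (xs (ind y))) + (g - om k) * K x (xs (ind y)) by rewrite /Kx; ring.
  apply: le_trans (rnormD _ _) _; rewrite rnormM.
  have := gle x; have := rnorm_ge0 (K x (xs (ind y))).
  have := rnorm_ge0 (K x y); have := rnorm_ge0 (O x y); have := rnorm_ge0 (g - om k).
  by nra.
exists gam; split => //; first by move=> x; exact: om1.
pose N := [set p : X * X | 0 < Num.max 0 (rnorm (Kt p - gam p.2 * Kx (ind p.2) p.1) -
      ((1 + e) * rnorm (Ot p) + e * rnorm (Kt p)))].
pose FF n : X -> R[i] := if choice.unpickle n is Some i then Kx i else fun=> 0.
have mFF n : cmeasurable (FF n).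
  by rewrite /FF; case: choice.unpickle => // ; exact: cmeasurable_cst.
have FFE y x : FF (choice.pickle (ind y)) x = Kx (ind y) x by rewrite /FF choice.pickleK.
have mg2 : cmeasurable (fun p : X * X => gam p.2).
  by split; [exact: (measurableT_comp mgam.1)|exact: (measurableT_comp mgam.2)].
have mii n : measurable [set p : X * X | choice.pickle (ind p.2) = n].
  rewrite (_ : mkset _ = snd @^-1` [set y | choice.pickle (ind y) = n])//.
  rewrite -[_ @^-1` _]setTI; apply: measurable_snd => //; exact: levels_pickle mind n.
have mN : measurable N.
  have mf := mh _ _ FF mg2 mii mFF.
  rewrite (_ : N = (fun p => Num.max 0 (rnorm (Kt p - gam p.2 * FF (choice.pickle (ind p.2)) p.1) -
      ((1 + e) * rnorm (Ot p) + e * rnorm (Kt p)))) @^-1` `]0, +oo[%classic).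
    by rewrite -[_ @^-1` _]setTI; apply: mf.
  by apply/seteqP; split => p /=; rewrite FFE in_itv/= andbT.
have Nae : {ae (mu \x mu)%E, forall p, ~ N p}.
  apply: prod_ae_y => //; apply: filterS Qae => y Qy.
  have := lint_eq0_ae _ _ Qy => /(_ (fun x => _) _) h0.
  apply: filterS (h0 _ _) => [x /= hx|x|].
  - by rewrite /N/= -/(h (gam y) (ind y) (x, y)); case: hx => ->; rewrite ltxx.
  - by rewrite lee_fin le_max lexx.
  - apply: ae_emeasurableW; apply/measurable_EFinP.
    exact: (measurableT_comp (mhi _ _)).
have mK' : ae_measurable2 mu (fun x y => K x y - gam y * K x (xs (ind y))).
  apply: ae_measurableB; first exact: kbound_meas (set_kernel S).
  apply: ae_measurableW; apply: cmeasurableM => //.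
  have -> : (fun p : X * X => K p.1 (xs (ind p.2))) =
      (fun p => FF (choice.pickle (ind p.2)) p.1) by apply/funext => p; rewrite FFE.
  apply: (@cmeasurable_glue _ _ _ _ (fun n p => FF n p.1) mii) => n.
  by split; [exact: (measurableT_comp (mFF n).1)|exact: (measurableT_comp (mFF n).2)].
apply: (kbound_lin hm mK' _ (ltW e0) (set_osc S) (set_kernel S)).
  by rewrite addr_ge0// ltW.
apply: filterS3 Nae KKt OOt => p Np Kp Op; rewrite Kp Op.
by move/negP: Np; rewrite /N/= -leNgt ge_max lexx/= subr_le0.
Qed.

(** The loss is absorbed by the strict inequality in the smallness condition. *)
Lemma discretization : exists (ind : X -> I) (gam : X -> R[i]) (eta : R),
  [/\ forall x, U (ind x) x, forall i, measurable [set x | ind x = i],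
      cmeasurable gam, forall x, rnorm (gam x) = 1 &
      2 * eta * nK < 1 /\
      kbound mu m (fun x y => K x y - gam y * K x (xs (ind y))) eta].
Proof.
have [ind [Uind mind]] := index_selection.
have K0 := kernel_ge0; have O0 := osc_ge0; have sm := set_small S.
pose s := 2 * (nO + nK) * nK + 1.
have s0 : 0 < s by rewrite /s; nra.
pose e := (1 - 2 * nO * nK) / (2 * s).
have e0 : 0 < e by rewrite divr_gt0 ?mulr_gt0// subr_gt0.
have [gam [mgam gam1 kb]] := phase_selection e0 Uind mind.
exists ind, gam, ((1 + e) * nO + e * nK); split => //; split => //.
have -> : 2 * ((1 + e) * nO + e * nK) * nK = 2 * nO * nK + e * (s - 1) by rewrite /s; ring.
have es : e * s = (1 - 2 * nO * nK) / 2 by rewrite /e; field; lra.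
rewrite mulrBr es; lra.
Qed.

(** * Sequences with a step function in Y *)

Section step_sequences.
Variables (ind : X -> I).
Hypothesis indU : forall x, U (ind x) x.
Hypothesis ind_meas : forall i, measurable [set x | ind x = i].
Variables (w t : I -> R) (Z : set I).
Hypothesis t0 : forall i, 0 < t i.
Implicit Types c : I -> R[i]^o.

Definition step c : X -> R[i]^o := fun y => (w (ind y))%:C * c (ind y).

Lemma stepZ (a : R[i]) c : step (a *: c) = a *: step c.
Proof. by apply/funext => y; rewrite /step !fctE /GRing.scale/= mulrCA. Qed.

Lemma stepD c c' : step (c + c') = step c + step c'.
Proof. by apply/funext => y; rewrite /step !fctE mulrDr. Qed.

Lemma stepB c c' : step (c - c') = step c - step c'.
Proof. by apply/funext => y; rewrite /step !fctE mulrBr. Qed.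

Lemma step_meas c : ae_measurable mu (step c).
Proof.
apply: ae_measurableW; apply: (ind_glue ind_meas (F := fun i _ => (w i)%:C * c i)) => i.
exact: cmeasurable_cst.
Qed.

(** The supremum makes the coordinates continuous, also those that belong to
null cells; coordinates in Z, which the step function cannot see in the
applications, are forced to vanish. *)
Definition step_space : set (I -> R[i]^o) :=
  [set c | [/\ forall i, Z i -> c i = 0, Y (step c) & wbounded t c]].

Definition step_norm c := NY (step c) + wsup t c.

Let i0 := ind z0.

Lemma cut_solid i (F : X -> R[i]^o) : Y F -> Y (cut ind i F) /\ NY (cut ind i F) <= NY F.
Proof.
move=> YF; apply: (solid_le hY _ YF); first by apply: (cut_meas ind_meas); exact: (solid_meas hY YF).
by apply: aeW => x; rewrite /cut; case: ifP => // _; rewrite rnorm0 rnorm_ge0.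
Qed.

Lemma cut_const i (a : R[i]) : Y (cut ind i (fun=> a)) /\
  NY (cut ind i (fun=> a)) <= rnorm a * NY (one i).
Proof.
have [Y1 _] := one_in_solid i; apply: (solid_dom hY _ Y1 (rnorm_ge0 (a : R[i]))).
  by apply: (cut_meas ind_meas); apply: ae_measurableW; exact: cmeasurable_cst.
apply: aeW => x; rewrite /cut /one; case: eqP => [<-|_].
  by rewrite indicE mem_set//= rnorm1 mulr1.
by rewrite rnorm0 mulr_ge0 ?rnorm_ge0.
Qed.

(** Convergence in Y and of the coefficients have the same limit, since this
holds on every cell. *)
Lemma step_limit (u : nat -> I -> R[i]^o) c (F : X -> R[i]^o) :
  (forall n, Y (step (u n))) -> Y F ->
  (fun n => NY (step (u n) - F)) @ \oo --> (0 : R) ->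
  (forall i, (fun n => rnorm (u n i - c i : R[i])) @ \oo --> (0 : R)) ->
  {ae mu, forall x, step c x = F x}.
Proof.
move=> Yu YF uF uc.
have cell i : {ae mu, forall x, ind x = i -> step c x = F x}.
  pose G := cut ind i (fun=> (w i)%:C * c i) - cut ind i F.
  have [Y1 _] := cut_const i ((w i)%:C * c i); have [Y2 _] := cut_solid i YF.
  have YG : Y G := (solidB hY Y1 Y2).1.
  have G0 : NY G = 0.
    apply/eqP; rewrite eq_le (solid_ge0 hY YG) andbT.
    have lim : (fun n => NY (step (u n) - F) +
        `|w i| * NY (one i) * rnorm (u n i - c i : R[i])) @ \oo --> (0 : R).
      rewrite -[X in _ --> X]addr0; apply: cvgD => //.
      rewrite -[X in _ --> X](mulr0 (`|w i| * NY (one i))).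
      by apply: cvgMr; exact: uc.
    apply: (closed_cvg (fun x => NY G <= x)) lim; first exact: closed_ge.
    apply: nearW => n; have YnF := (solidB hY (Yu n) YF).1.
    have [Y3 N3] := cut_solid i YnF.
    have [Y4 N4] := cut_const i ((w i)%:C * (u n i - c i)).
    have -> : G = cut ind i (step (u n) - F) - cut ind i (fun=> (w i)%:C * (u n i - c i)).
      apply/funext => y; rewrite /G ?fctE /cut /step ?fctE; case: eqP => [->|_].
        by ring.
      by rewrite !subrr.
    apply: le_trans (solidB hY Y3 Y4).2 _; apply: lerD => //.
    by apply: le_trans N4 _; rewrite rnormM rnorm_real mulrAC.
  apply: filterS (solid_eq0 hY YG G0) => x; rewrite /G !fctE /cut => + xi.
  by rewrite xi eqxx /step xi => /eqP; rewrite subr_eq0 => /eqP.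
have : {ae mu, forall x, forall n,
    if choice.unpickle n is Some i then ind x = i -> step c x = F x else True}.
  by apply: ae_foralln => n; case: choice.unpickle => [i|]; [exact: cell|exact: aeW].
apply: filterS => x /(_ (choice.pickle (ind x))); rewrite choice.pickleK; exact.
Qed.

Lemma step_norm_ge0 c : step_space c -> 0 <= step_norm c.
Proof.
by move=> [_ Yc bc]; rewrite addr_ge0// ?(solid_ge0 hY Yc)//; exact: (wsup_ge0 i0 t0 bc).
Qed.

Lemma step_norm_coord c i : step_space c -> t i * rnorm (c i : R[i]) <= step_norm c.
Proof.
move=> [_ Yc bc]; apply: le_trans (le_wsup i bc) _.
by rewrite lerDr (solid_ge0 hY Yc).
Qed.

Lemma step_spaceZ (a : R[i]) c : step_space c -> step_space (a *: c).
Proof.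
move=> [zc Yc bc]; split; last exact: (wboundedZ i0 a bc).1.
- by move=> i Zi; rewrite !fctE zc// scaler0.
- by rewrite stepZ; exact: (solidZ hY a Yc).1.
Qed.

Lemma step_spaceD c c' : step_space c -> step_space c' -> step_space (c + c').
Proof.
move=> [zc Yc bc] [zc' Yc' bc']; split; last exact: (wboundedD i0 t0 bc bc').1.
- by move=> i Zi; rewrite !fctE zc// zc'// addr0.
- by rewrite stepD; exact: (solidD hY Yc Yc').1.
Qed.

Lemma step_spaceB c c' : step_space c -> step_space c' -> step_space (c - c').
Proof. by move=> hc hc'; rewrite -scaleN1r; apply: step_spaceD => //; exact: step_spaceZ. Qed.

Lemma step_complete (u : nat -> I -> R[i]^o) : (forall n, step_space (u n)) ->
  (forall e : R, 0 < e -> exists n0, forall p q,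
     (n0 <= p)%N -> (n0 <= q)%N -> step_norm (u p - u q) < e) ->
  exists2 l, step_space l & (fun n => step_norm (u n - l)) @ \oo --> (0 : R).
Proof.
move=> uS cau.
have uY n : Y (step (u n)) by have [] := uS n.
have uB p q : step_space (u p - u q) by exact: step_spaceB.
have [F YF Fcv] : exists2 F, Y F & (fun n => NY (step (u n) - F)) @ \oo --> (0 : R).
  apply: (banach_complete (solid_banach hY)) => // e e0.
  have [n0 hn0] := cau e e0; exists n0 => p q p0 q0.
  apply: le_lt_trans (hn0 p q p0 q0); rewrite /step_norm stepB lerDl.
  by have [_ _ bc] := uB p q; exact: (wsup_ge0 i0 t0 bc).
have ucau i (e : R) : 0 < e -> exists n0, forall p q, (n0 <= p)%N -> (n0 <= q)%N ->
    rnorm (u p i - u q i : R[i]) < e.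
  move=> e0; have [n0 hn0] := cau _ (mulr_gt0 (t0 i) e0); exists n0 => p q p0 q0.
  rewrite -(ltr_pM2l (t0 i)); apply: le_lt_trans (hn0 p q p0 q0).
  exact: (step_norm_coord i (uB p q)).
have lim i : exists l : R[i], forall e : R, 0 < e -> \forall n \near \oo,
    rnorm (u n i - l : R[i]) < e.
  have part (f : R[i] -> R) : (forall a b, f (a - b) = f a - f b) ->
      (forall a, `|f a| <= rnorm a) -> cvgn (fun n => f (u n i : R[i])).
    move=> fB fle; apply: cauchy_cvg; apply/cauchy_ballP => e e0.
    have [n0 hn0] := ucau i e e0; rewrite near_map2; near=> p q => /=; rewrite /ball/= -fB.
    apply: le_lt_trans (fle _) _; apply: hn0; last by near: q; exact: nbhs_infty_ge.
    by near: p; exact: nbhs_infty_ge.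
  have cr := part (@complex.Re R) (fun a b => ltac:(by case: a; case: b)) (@Re_le_rnorm R).
  have ci := part (@complex.Im R) (fun a b => ltac:(by case: a; case: b)) (@Im_le_rnorm R).
  set lr := lim _ in cr; set li := lim _ in ci.
  exists (lr +i* li) => e e0; have e20 : 0 < e / 2 by rewrite divr_gt0.
  have /cvgrPdist_lt/(_ _ e20) nr := cr; have /cvgrPdist_lt/(_ _ e20) ni := ci.
  apply: filterS2 nr ni => n rn im; apply: le_lt_trans (rnorm_le_ReIm _) _.
  have -> : complex.Re (u n i - (lr +i* li)) = - (lr - complex.Re (u n i)).
    by rewrite opprB; case: (u n i).
  have -> : complex.Im (u n i - (lr +i* li)) = - (li - complex.Im (u n i)).
    by rewrite opprB; case: (u n i).
  by rewrite !normrN (splitr e) ltrD.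
have [l hl] := boolp.choice lim.
have lcv i : (fun n => rnorm (u n i - l i : R[i])) @ \oo --> (0 : R).
  apply/cvgr0Pnorm_lt => e e0; apply: filterS (hl i e e0) => n.
  by rewrite ger0_norm ?rnorm_ge0.
have cF := step_limit uY YF Fcv lcv.
have dist (e : R) : 0 < e -> exists n0, forall n, (n0 <= n)%N ->
    forall i, t i * rnorm (u n i - l i : R[i]) <= e.
  move=> e0; have [n0 hn0] := cau e e0; exists n0 => n nn0 i.
  have cv : (fun p => t i * rnorm (u n i - u p i : R[i])) @ \oo --> t i * rnorm (u n i - l i : R[i]).
    apply: cvgMr; apply/cvgrPdist_lt => e' e'0; apply: filterS (hl i e' e'0) => p up.
    apply: le_lt_trans up; rewrite ler_norml; apply/andP; split.
      have := rnormD (u n i - l i : R[i]) (l i - u p i); rewrite addrA subrK [rnorm (l i - _)]rnormBC.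
      lra.
    have := rnormD (u n i - u p i : R[i]) (u p i - l i); rewrite addrA subrK; lra.
  apply: (closed_cvg (fun x => x <= e)) cv; first exact: closed_le.
  near=> p; apply/ltW/(le_lt_trans (step_norm_coord i (uB n p))); apply: hn0 => //.
  by near: p; exact: nbhs_infty_ge.
have Yl : Y (step l) := (solid_ae hY cF YF).1.
have bl : wbounded t l.
  have [n0 hn0] := dist 1 ltr01; have [_ _ [M hM]] := uS n0.
  exists (1 + M) => i; apply: le_trans (lerD (hn0 n0 (leqnn _) i) (hM i)).
  rewrite -mulrDr ler_wpM2l ?(ltW (t0 _))// [rnorm (_ - _)]rnormBC.
  by apply: le_trans (rnormD _ _); rewrite subrK.
have Sl : step_space l.
  split => // i Zi; have : (fun n => rnorm (u n i - l i : R[i])) @ \oo --> rnorm (l i : R[i]).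
    under eq_fun => n do (have [zu _ _] := uS n; rewrite zu// sub0r rnormN).
    exact: cvg_cst.
  by move=> /(cvg_unique (@Rhausdorff R) (lcv i)) /esym /rnorm_eq0.
exists l => //.
have sup0 : (fun n => wsup t (u n - l)) @ \oo --> (0 : R).
  apply/cvgr0Pnorm_le => e e0; have [n0 hn0] := dist e e0.
  near=> n; have [_ _ bn] := step_spaceB (uS n) Sl.
  rewrite ger0_norm; last exact: (wsup_ge0 i0 t0 bn).
  apply: wsup_le => // i; apply: hn0; by near: n; exact: nbhs_infty_ge.
rewrite -[X in _ --> X]addr0; apply: cvgD => //.
under eq_fun => n do rewrite stepB.
apply: cvg_trans Fcv; apply: near_eq_cvg; apply: nearW => n.
have YnF := (solidB hY (uY n) YF).1.
symmetry; apply: (proj2 (solid_ae hY _ YnF)); apply: filterS cF => x; rewrite !fctE => ->.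
exact: erefl.
Unshelve. all: by end_near. Qed.

Lemma step_BK : BK_space step_space step_norm.
Proof.
split.
- split.
  + split; last by exists 0 => i; rewrite rnorm0 mulr0.
    * by [].
    * have -> : step 0 = 0 by rewrite -(scale0r 0) stepZ scale0r.
      exact: (solid0 hY).
  + by move=> a c c' hc hc'; apply: step_spaceD => //; exact: step_spaceZ.
  + exact: step_norm_ge0.
  + move=> c cS; split=> [N0|->].
      have [_ Yc bc] := cS; apply: (wsup_eq0 t0 bc); apply/eqP.
      rewrite eq_le (wsup_ge0 i0 t0 bc) andbT -N0.
      by rewrite lerDr (solid_ge0 hY Yc).
    have Y0 : step 0 = 0 by rewrite -(scale0r 0) stepZ scale0r.
    rewrite /step_norm Y0 (solid_null hY (aeW _ _))// add0r.
    apply/eqP; rewrite eq_le (wsup_ge0 i0 t0) ?andbT; last by exists 0 => i; rewrite rnorm0 mulr0.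
    by apply: (wsup_le i0) => i; rewrite rnorm0 mulr0.
  + move=> a c [_ Yc bc]; rewrite /step_norm stepZ (solidZ hY a Yc).2.
    by rewrite (wsupZ i0 t0)// mulrDr.
  + move=> c c' [_ Yc bc] [_ Yc' bc']; rewrite /step_norm stepD addrACA.
    exact: lerD (solidD hY Yc Yc').2 (wboundedD i0 t0 bc bc').2.
  + exact: step_complete.
- move=> a b [zb Yb [M bM]] ab.
  have [Ya Na] : Y (step a) /\ NY (step a) <= NY (step b).
    apply: (solid_le hY _ Yb); first exact: step_meas.
    by apply: aeW => x; rewrite /step !rnormM ler_wpM2l ?rnorm_ge0.
  have le i : t i * rnorm (a i : R[i]) <= t i * rnorm (b i : R[i]).
    by rewrite ler_wpM2l// ltW.
  split.
    split => //; last by exists M => i; exact: le_trans (bM i).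
    move=> i Zi; apply: (@rnorm_eq0 R); apply/eqP; rewrite eq_le rnorm_ge0 andbT.
    by apply: le_trans (ab i) _; rewrite zb// rnorm0.
  apply: lerD => //; apply: wsup_le => // i; apply: le_trans (le i) _.
  by apply: le_wsup; exists M.
- move=> u l uS lS ul i; apply: cvg_complex => e e0.
  have te := mulr_gt0 (t0 i) e0.
  apply: filterS (proj1 (cvgr0Pnorm_lt _) ul _ te) => n un.
  rewrite -(ltr_pM2l (t0 i)); apply: le_lt_trans un.
  apply: le_trans (ler_norm _).
  exact: (step_norm_coord i (step_spaceB (uS n) lS)).
Qed.

End step_sequences.

(** * The reproducing formula *)

Variables (ind : X -> I) (gam : X -> R[i]) (eta : R).
Hypothesis P : sampling mu K m nK U xs ind gam eta.
Local Notation Kd := (kernel_defect K xs ind gam).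
Local Notation iota := (fun y => choice.pickle (ind y)).

Lemma iota_meas n : measurable [set y | iota y = n].
Proof. exact: levels_pickle (smp_meas P) n. Qed.

Lemma eta_ge0 : 0 <= eta. Proof. exact: kbound_ge0 (smp_defect P). Qed.

Lemma v_schur k c (G : X -> R[i]) : kbound mu m k c -> ae_measurable mu G ->
  (\int[mu]_x \int[mu]_y (rnorm (k x y * G y) * v x)%:E <=
   c%:E * \int[mu]_y (v y * rnorm (G y))%:E)%E.
Proof.
move=> kc mG; apply: (schur_L1 hm kc) => //.
- by move=> x; exact: (v_ge0).
- exact: (v_meas).
- by move=> x y; exact: (v_submul).
Qed.

Lemma voice_meas g : ae_measurable mu (V g : X -> R[i]).
Proof. by apply: ae_measurableW; exact: voice_cmeasurable hfr g. Qed.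

(** Schur's bound for K in the weighted space, as V g is fixed by K. *)
Lemma H1_norm_repr g : HH g -> NH g <= nK * NH g.
Proof.
move=> gH; rewrite -lee_fin EFinM -(H1_normE gH).
apply: le_trans (v_schur (set_kernel S) (voice_meas g)); apply: le_lint => x.
  exact: (weighted_ge0).
have [iK KE] := voice_repr hip hfr g x.
under eq_integral => y _ do rewrite mulrC EFinM.
rewrite lintZ; last 3 first.
- by move=> y; rewrite lee_fin rnorm_ge0.
- exact: (v_ge0).
- exact: ae_measurable_rnorm iK.1.
by rewrite EFinM lee_wpmul2l ?lee_fin ?(v_ge0)// -KE le_rnorm_cintegral.
Qed.

Lemma H1_cintegrable g : HH g -> cintegrable mu (V g : X -> R[i]).
Proof.
move=> /(H1P) gfin; apply: (cintegrable_le (voice_meas g) _ _ gfin).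
  by move=> x; exact: (weighted_ge0).
by apply: aeW => x; rewrite lee_fin ler_peMl ?rnorm_ge0// (v_ge1).
Qed.

Section approximation.
Variable g : H.
Hypothesis gH : HH g.

Let W y := gam y * V g y.

Lemma phase_voice_cint : cintegrable mu W.
Proof.
have [mV Vfin] := H1_cintegrable gH; split.
  by apply: ae_measurableM => //; apply: ae_measurableW; exact: smp_phase_meas P.
by under eq_integral do rewrite rnormM (smp_phase P) mul1r.
Qed.

Definition sample_point j := if choice.unpickle j is Some i then xs i else z0.
Definition sampling_coef (j : nat) : R[i] := cintegral mu (fun y => if iota y == j then W y else 0).

Lemma sample_pointE y : sample_point (iota y) = xs (ind y).
Proof. by rewrite /sample_point choice.pickleK. Qed.

(** The expansion of g in the frame, discretized and restricted to finitely many
cells, so that functionals known only on H1 can be evaluated termwise. *)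
Definition partial_sampling n : H :=
  (A^-1)%:C *: \sum_(j < n) sampling_coef j *: psi (sample_point j).

Lemma partial_sampling_H1 n : HH (partial_sampling n).
Proof.
apply: (H1Z); apply: (H1_sum) => j; apply: (H1Z); exact: (H1_psi _).1.
Qed.

Lemma partial_sampling_voice n x : V (partial_sampling n) x =
  cintegral mu (fun y => if (iota y < n)%N then sampled_kernel K xs ind gam x y * V g y else 0).
Proof.
have [_ E] := cintegral_steps iota_meas (fun j => K x (sample_point j)) n phase_voice_cint.
transitivity (\sum_(j < n) K x (sample_point j) * sampling_coef j).
  rewrite /partial_sampling voiceZ.
  have -> : V (\sum_(j < n) sampling_coef j *: psi (sample_point j)) x =
      \sum_(j < n) V (sampling_coef j *: psi (sample_point j)) x.
    elim/big_rec2 : _ => [|j a b _ <-]; last by rewrite voiceD.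
    by rewrite -(scale0r 0) voiceZ mul0r.
  rewrite mulr_sumr; apply: eq_bigr => j _.
  by rewrite voiceZ frame_kernel_voice; ring.
rewrite -E; apply: cintegral_ae; apply: aeW => y; case: ifP => // _.
by rewrite sample_pointE /sampled_kernel /W; ring.
Qed.

(** The defect of the sampled kernel contributes eta, and the omitted cells the
tail of a convergent integral. *)
Lemma partial_sampling_error (e : R) : 0 < e -> exists n0, forall n, (n0 <= n)%N ->
  NH (g - partial_sampling n) <= eta * NH g + e.
Proof.
move=> e0; have K0 := kernel_ge0; have e10 : 0 < e / (nK + 1).
  by rewrite divr_gt0// ltr_wpDl.
have vV0 x := weighted_ge0 (V g : X -> R[i]) x.
have mvV := weighted_meas (voice_meas g).
have [n0 tail] := lint_tail iota_meas vV0 mvV ((H1P g).1 gH) e10.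
exists n0 => n n0n.
have gnH : HH (g - partial_sampling n).
  by rewrite -scaleN1r addrC; apply: (H1_lin) => //; exact: partial_sampling_H1.
pose G1 y : R[i] := if (iota y < n)%N then 0 else V g y.
have mG1 : ae_measurable mu G1.
  have := ae_measurable_if (measurable_ge_level iota_meas n) (voice_meas g).
  by congr ae_measurable; apply/funext => y; rewrite /G1 ltnNge; case: leqP.
have S1 := v_schur (smp_defect P) (voice_meas g).
have S2 := v_schur (set_kernel S) mG1.
rewrite -lee_fin -(H1_normE gnH).
have m1 : ae_measurable2 mu (fun x y => Kd x y * V g y).
  by apply: ae_measurableM; [exact: kbound_meas (smp_defect P)|exact: ae_measurable2_snd (voice_meas g)].
have m2 : ae_measurable2 mu (fun x y => K x y * G1 y).
  by apply: ae_measurableM; [exact: kbound_meas (set_kernel S)|exact: ae_measurable2_snd mG1].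
have mv2 : ae_emeasurable2 mu (fun x y => (v x)%:E).
  by apply: ae_emeasurable2_fst; apply: ae_emeasurableW; exact/measurable_EFinP/(v_meas).
have mw k : ae_measurable2 mu k -> ae_emeasurable2 mu (fun x y => (rnorm (k x y) * v x)%:E).
  move=> mk; have := ae_emeasurableM (ae_measurable2_rnorm mk) mv2.
  by apply: ae_emeasurable_ae; apply: aeW => p; rewrite EFinM.
have w0 (k : X -> X -> R[i]) x y : (0 <= (rnorm (k x y) * v x)%:E)%E.
  by rewrite lee_fin mulr_ge0 ?rnorm_ge0 ?(v_ge0).
have L1 x : (0 <= \int[mu]_y (rnorm (Kd x y * V g y) * v x)%:E)%E.
  by apply: integral_ge0 => y _; exact: (w0 (fun x y => Kd x y * V g y)).
have L2 x : (0 <= \int[mu]_y (rnorm (K x y * G1 y) * v x)%:E)%E.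
  by apply: integral_ge0 => y _; exact: (w0 (fun x y => K x y * G1 y)).
have [l1 _] := ae_emeasurable_lint (w0 _) (mw _ m1).
have [l2 _] := ae_emeasurable_lint (w0 _) (mw _ m2).
have [s1 _] := ae_emeasurable_sec (mw _ m1).
have [s2 _] := ae_emeasurable_sec (mw _ m2).
have [q1 _] := ae_measurable_sec m1.
have [q2 _] := ae_measurable_sec m2.
apply: (@le_trans _ _ (\int[mu]_x (\int[mu]_y (rnorm (Kd x y * V g y) * v x)%:E +
    \int[mu]_y (rnorm (K x y * G1 y) * v x)%:E)))%E.
  apply: ae_le_lint.
  - by move=> x; exact: (weighted_ge0).
  - by move=> x; rewrite adde_ge0.
  have I2 : (\int[mu]_x \int[mu]_y (rnorm (Kd x y * V g y) * v x)%:E < +oo)%E.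
    apply: le_lt_trans S1 _; rewrite (H1_normE gH) -EFinM; exact: ltry.
  have f1 := lint_lty_ae L1 l1 I2.
  apply: filterS3 (filterI f1 s1) s2 (filterI q1 q2) => x [f1x s1x] s2x [q1x q2x].
  have [iK KE] := voice_repr hip hfr g x.
  have vx := v_gt0 x.
  have iT : cintegrable mu (fun y => if (iota y < n)%N then sampled_kernel K xs ind gam x y * V g y else 0).
    have [iT _] := cintegral_steps iota_meas (fun j => K x (sample_point j)) n phase_voice_cint.
    apply: cintegrable_ae iT; apply: aeW => y; case: ifP => // _.
    by rewrite sample_pointE /sampled_kernel /W; ring.
  rewrite -(lintD (w0 (fun x y => Kd x y * V g y) x)
    (w0 (fun x y => K x y * G1 y) x) s1x s2x).
  under [leRHS]eq_integral do rewrite -EFinD -mulrDl mulrC EFinM.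
  rewrite lintZ; last 3 first.
  - by move=> y; rewrite lee_fin addr_ge0 ?rnorm_ge0.
  - exact: ltW.
  - have := ae_emeasurableD (ae_measurable_rnorm q1x) (ae_measurable_rnorm q2x).
    by apply: ae_emeasurable_ae; apply: aeW => y; rewrite EFinD.
  rewrite EFinM; apply: lee_wpmul2l; first by rewrite lee_fin ltW.
  have -> : V (g - partial_sampling n) x = cintegral mu (fun y => K x y * V g y -
      (if (iota y < n)%N then sampled_kernel K xs ind gam x y * V g y else 0)).
    rewrite cintegralB// -partial_sampling_voice -/(kernel_act mu K (V g) x) KE.
    by rewrite -scaleN1r addrC voiceD voiceZ mulN1r addrC.
  apply: le_trans (le_rnorm_cintegral (cintegrableB iK iT)) _.
  apply: le_lint => y; first by rewrite lee_fin rnorm_ge0.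
  rewrite lee_fin /G1; case: ifP => _.
    by rewrite mulr0 rnorm0 addr0 -mulrBl.
  by rewrite subr0 lerDr rnorm_ge0.
rewrite lintD// EFinD leeD//.
  by apply: le_trans S1 _; rewrite (H1_normE gH) -EFinM.
apply: le_trans S2 _.
apply: (@le_trans _ _ (nK%:E * (e / (nK + 1))%:E))%E.
  rewrite lee_wpmul2l ?lee_fin//; apply: le_trans (ltW tail).
  apply: le_lint => y; first exact: (weighted_ge0).
  rewrite /G1; case: ltnP => [ltn|len].
    by rewrite rnorm0 mulr0; case: ifP => // _; exact: vV0.
  by rewrite (leq_trans n0n len).
rewrite -EFinM lee_fin mulrCA ler_piMr ?(ltW e0)// ler_pdivrMr ?ltr_wpDl// mul1r.
by rewrite lerDl.
Qed.

End approximation.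

(** The properties of the difference between a functional and the one defined by
its transform; they force it to be zero. *)
Record null_functional (del : H -> R[i]) (c : R) : Prop := {
  null_ge0 : 0 <= c ;
  null_lin : forall a g h, HH g -> HH h ->
    del (a *: g + h) = Num.conj a * del g + del h ;
  null_bound : forall g, HH g -> rnorm (del g) <= c * NH g ;
  null_meas : ae_measurable mu (fun p => del (psi p)) ;
  null_pair : forall g, HH g -> pair (fun p => del (psi p)) g = 0 }.

Section null.
Variables (del : H -> R[i]) (c : R).
Hypothesis Del : null_functional del c.

Let c0 := null_ge0 Del.

Lemma null_zero : del 0 = 0.
Proof.
have := null_lin Del 1 (H1_0) (H1_0).
by rewrite scaler0 addr0 rmorph1 mul1r -{1}[del 0]addr0 => /addrI.
Qed.

Lemma null_scale a g : HH g -> del (a *: g) = Num.conj a * del g.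
Proof.
move=> gH; have := null_lin Del a gH (H1_0).
by rewrite addr0 null_zero addr0.
Qed.

Lemma null_sub g h : HH g -> HH h -> del (g - h) = del g - del h.
Proof.
move=> gH hH; rewrite addrC -scaleN1r (null_lin Del)//.
by rewrite rmorphN1 mulN1r addrC.
Qed.

Lemma null_sum n (f : nat -> H) : (forall j, HH (f j)) ->
  del (\sum_(j < n) f j) = \sum_(j < n) del (f j).
Proof.
move=> fH; elim: n => [|n IH]; first by rewrite !big_ord0 null_zero.
rewrite !big_ord_recr/= -IH addrC -[f n]scale1r (null_lin Del)//.
  by rewrite rmorph1 mul1r scale1r addrC.
exact: (H1_sum).
Qed.

Lemma null_psi p : rnorm (del (psi p)) <= c * (A * colC) * v p.
Proof.
have [pH pN] := H1_psi p; apply: le_trans (null_bound Del pH) _.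
by rewrite -mulrA ler_wpM2l.
Qed.

(** The values of the functional vary slowly: neighbouring frame vectors are
close in the norm of H1, by the column bound of the defect. *)
Lemma null_osc : {ae mu, forall y,
  rnorm (Num.conj (gam y) * del (psi (xs (ind y))) - del (psi y)) <= c * (A * eta) * v y}.
Proof.
have A0 := ltW (frame_gt0 hfr).
have [_ md] := ae_emeasurable_sec (kweight_meas hm (kbound_meas (smp_defect P))).
apply: filterS2 (kbound_col (smp_defect P)) md => y Ey my.
have pH := (H1_psi (xs (ind y))).1; have yH := (H1_psi y).1.
have dH : HH (gam y *: psi (xs (ind y)) - psi y).
  by rewrite -scaleN1r addrC; apply: (H1_lin) => //; exact: (H1Z).
rewrite -null_scale// -null_sub//; last exact: (H1Z).
apply: le_trans (null_bound Del dH) _; rewrite -mulrA ler_wpM2l//.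
rewrite -lee_fin -(H1_normE dH).
apply: (@le_trans _ _ (\int[mu]_x ((A * v y)%:E * (rnorm (Kd x y) * m x y)%:E)))%E.
  apply: le_lint => x; first exact: (weighted_ge0).
  have -> : V (gam y *: psi (xs (ind y)) - psi y) x = - (A%:C * Kd x y).
    rewrite -scaleN1r voiceD !voiceZ !(voice_psi) /kernel_defect /sampled_kernel.
    ring.
  rewrite rnormN rnormM rnorm_real ger0_norm// -EFinM lee_fin.
  rewrite [leLHS](_ : _ = A * rnorm (Kd x y) * v x); last by ring.
  rewrite [leRHS](_ : _ = A * rnorm (Kd x y) * (m x y * v y)); last by ring.
  by rewrite ler_wpM2l ?mulr_ge0 ?rnorm_ge0// (v_submul).
rewrite lintZ//.
- rewrite mulrAC EFinM; apply: lee_wpmul2l Ey.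
  by rewrite lee_fin mulr_ge0 ?(v_ge0).
- by move=> x; exact: rnorm_weight_ge0.
- by rewrite mulr_ge0 ?(v_ge0).
Qed.

Lemma null_partial g n : HH g -> Num.conj (del (partial_sampling g n)) =
  (A^-1)%:C * cintegral mu (fun y => if (iota y < n)%N then
    Num.conj (del (psi (xs (ind y)))) * (gam y * V g y) else 0).
Proof.
move=> gH; have jH j : HH (psi (sample_point j)) by exact: (H1_psi _).1.
have sH j : HH (sampling_coef g j *: psi (sample_point j)) by exact: (H1Z).
rewrite /partial_sampling null_scale; last exact: (H1_sum).
rewrite conjM conjK (null_sum _ sH) rmorph_sum/=; congr (_ * _).
have [_ E] := cintegral_steps iota_meas
  (fun j => Num.conj (del (psi (sample_point j)))) n (phase_voice_cint gH).
transitivity (\sum_(j < n) Num.conj (del (psi (sample_point j))) * sampling_coef g j).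
  by apply: eq_bigr => j _; rewrite null_scale// conjM conjK mulrC.
rewrite -E; apply: cintegral_ae; apply: aeW => y; case: ifP => // _.
by rewrite sample_pointE.
Qed.

(** Replacing g by a finite combination of samples costs eta. On the combination
the functional is an integral of its values at the samples; these differ by at
most eta from its values elsewhere, whose integral vanishes. *)
Lemma null_contract g : HH g -> rnorm (del g) <= 2 * eta * nK * c * NH g.
Proof.
move=> gH; have A0 := frame_gt0 hfr; have K0 := kernel_ge0; have e0 := eta_ge0.
have N0 := H1_norm_ge0 g.
suff main (e : R) : 0 < e -> rnorm (del g) <= 2 * eta * c * NH g + e * (c + A^-1).
  have le1 : rnorm (del g) <= 2 * eta * c * NH g.
    apply/ler_addgt0Pr => e ep; have cA : 0 < c + A^-1 by rewrite ltr_wpDl// invr_gt0.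
    have := main (e / (c + A^-1)) (divr_gt0 ep cA).
    by rewrite mulfVK// gt_eqF.
  apply: le_trans le1 _; rewrite [leRHS](_ : _ = 2 * eta * c * (nK * NH g)); last by ring.
  by rewrite ler_wpM2l ?mulr_ge0// H1_norm_repr.
move=> ep; have [n0 hn0] := partial_sampling_error gH ep.
pose F y := Num.conj (del (psi y)) * V g y.
have iF0 : cintegrable mu (fun x => del (psi x) * Num.conj (V g x)).
  apply: (proj1 (pair_cint (null_meas Del) (aeW _ null_psi) gH)).
have FE y : F y = Num.conj (del (psi y) * Num.conj (V g y)) by rewrite conjM conjK.
have iF : cintegrable mu F.
  by apply: cintegrable_ae (cintegrable_conj iF0); apply: aeW => y; rewrite FE.
have F0 : cintegral mu F = 0.
  rewrite (cintegral_ae (aeW _ FE)) cintegral_conj//.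
  by rewrite [cintegral _ _](null_pair Del gH) rmorph0.
have [n1 hn1] := cintegral_level_cvg iota_meas iF ep.
pose n := maxn n0 n1.
have h0 := hn0 n (leq_maxl _ _); have h1 := hn1 n (leq_maxr _ _).
rewrite F0 sub0r rnormN in h1.
have gnH := partial_sampling_H1 g n.
have ggH : HH (g - partial_sampling g n).
  by rewrite -scaleN1r addrC; apply: (H1_lin).
have -> : del g = del (g - partial_sampling g n) + del (partial_sampling g n).
  by rewrite null_sub// subrK.
apply: le_trans (rnormD _ _) _.
have b1 : rnorm (del (g - partial_sampling g n)) <= c * (eta * NH g + e).
  by apply: le_trans (null_bound Del ggH) _; rewrite ler_wpM2l.
have b2 : rnorm (del (partial_sampling g n)) <= c * eta * NH g + A^-1 * e.
  rewrite -rnorm_conj null_partial//.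
  set P1 := fun y : X => _.
  pose P2 y := if (iota y < n)%N then F y else 0.
  have iP2 : cintegrable mu P2 by apply: cintegrable_if => //; exact: measurable_lt_level iota_meas n.
  have iP1 : cintegrable mu P1.
    have [iT _] := cintegral_steps iota_meas
      (fun j => Num.conj (del (psi (sample_point j)))) n (phase_voice_cint gH).
    apply: cintegrable_ae iT; apply: aeW => y; rewrite /P1; case: ifP => // _.
    by rewrite sample_pointE.
  have -> : cintegral mu P1 = cintegral mu (fun y => P1 y - P2 y) + cintegral mu P2.
    by rewrite cintegralB// subrK.
  rewrite mulrDr; apply: le_trans (rnormD _ _) _; apply: lerD; last first.
    by rewrite rnorm_realM ?invr_ge0 ?(ltW A0)// ler_wpM2l ?invr_ge0 ?(ltW A0)// ltW.
  rewrite rnorm_realM ?invr_ge0 ?(ltW A0)//.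
  rewrite -ler_pdivlMl ?invr_gt0// invrK -lee_fin.
  apply: le_trans (le_rnorm_cintegral (cintegrableB iP1 iP2)) _.
  rewrite [X in (_ <= X%:E)%E](_ : _ = c * (A * eta) * NH g); last by ring.
  rewrite EFinM -(H1_normE gH) -lintZ; last 3 first.
  - by move=> y; exact: (weighted_ge0).
  - by rewrite !mulr_ge0// ltW.
  - exact: (weighted_meas (voice_meas g)).
  apply: ae_le_lint.
  - by move=> y; rewrite lee_fin rnorm_ge0.
  - by move=> y; rewrite mule_ge0 ?(weighted_ge0)// lee_fin !mulr_ge0// ltW.
  apply: filterS null_osc => y oy; rewrite -EFinM lee_fin mulrA /P1 /P2.
  case: ifP => _; last first.
    by rewrite subr0 rnorm0 !mulr_ge0 ?rnorm_ge0 ?(v_ge0)// ltW.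
  have -> : Num.conj (del (psi (xs (ind y)))) * (gam y * V g y) - F y =
      Num.conj (Num.conj (gam y) * del (psi (xs (ind y))) - del (psi y)) * V g y.
    by rewrite conjB conjM conjK /F; ring.
  rewrite rnormM rnorm_conj [leRHS](_ : _ = c * (A * eta) * v y * rnorm (V g y : R[i])); last by ring.
  by rewrite ler_wpM2r ?rnorm_ge0.
lra.
Qed.

End null.

Lemma null_functional0 del c g : null_functional del c -> HH g -> del g = 0.
Proof.
move=> Del gH; set q := 2 * eta * nK.
have K0 := kernel_ge0; have e0 := eta_ge0; have q1 : q < 1 := smp_small P.
have q0 : 0 <= q by rewrite /q !mulr_ge0.
have iter k : null_functional del (q ^+ k * c).
  elim: k => [|k IH]; first by rewrite expr0 mul1r.
  case: (IH) => c0 dl _ dm dp; split => //; first by rewrite mulr_ge0 ?exprn_ge0 ?(null_ge0 Del).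
  move=> h hH; have := null_contract IH hH.
  by rewrite exprS [q * _ * _](_ : _ = 2 * eta * nK * (q ^+ k * c)) //; rewrite -mulrA.
apply: rnorm_eq0; apply/eqP; rewrite eq_le rnorm_ge0 andbT.
have N0 := H1_norm_ge0 g.
have cv : (fun k => q ^+ k * (c * NH g)) @ \oo --> 0 * (c * NH g).
  apply: cvgMl; apply: cvg_expr; by rewrite ger0_norm.
rewrite -[leRHS](mul0r (c * NH g)).
apply: (closed_cvg (fun x => rnorm (del g) <= x)) cv.
  exact: closed_ge.
by apply: nearW => k; rewrite mulrA; exact: (null_bound (iter k) gH).
Qed.

(** The functional and the one defined by its transform differ by a null
functional, since pairing with K F or with F is the same. *)
Lemma rho_extended_voice phi : BB phi -> rho (extended_voice psi phi) = phi.
Proof.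
move=> [[pout plin [c pbd]] YF]; set F := extended_voice psi phi in YF *.
apply/funext => g; have [gH|gH] := pselect (HH g); last first.
  by rewrite rho_out// pout.
apply/esym/eqP; rewrite -subr_eq0; apply/eqP.
pose del h := phi h - rho F h.
have [rout rlin [c' rbd]] := rho_antidual YF.
apply: (@null_functional0 del (Num.max 0 c + Num.max 0 c') g _ gH).
have KY := (act_solid YF).1.
have dE p : del (psi p) = (F - kernel_act mu K F) p.
  by rewrite /del -[rho _ (psi p)]/(extended_voice psi (rho F) p) (rho_voice YF).
split.
- by rewrite addr_ge0// le_max lexx.
- by move=> a h k hH kH; rewrite /del plin// rlin//; ring.
- move=> h hH; apply: le_trans (rnormB _ _) _; rewrite mulrDl; apply: lerD.
    apply: le_trans (pbd h hH) _; rewrite ler_wpM2r ?(H1_norm_ge0)//.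
    by rewrite le_max lexx orbT.
  apply: le_trans (rbd h hH) _; rewrite ler_wpM2r ?(H1_norm_ge0)//.
  by rewrite le_max lexx orbT.
- by under eq_fun do rewrite dE; exact: solid_meas hY _ (solidB hY YF KY).1.
- move=> h hH; rewrite /pair; under eq_fun do rewrite dE.
  have iF : cintegrable mu (fun x => F x * Num.conj (V h x)).
    have bnd x : rnorm (F x : R[i]) <= Num.max 0 c * (A * colC) * v x.
      have [xH xN] := H1_psi x; apply: le_trans (pbd _ xH) _.
      apply: (@le_trans _ _ (Num.max 0 c * NH (psi x))).
        by rewrite ler_wpM2r ?(H1_norm_ge0)// le_max lexx orbT.
      by rewrite -mulrA ler_wpM2l// le_max lexx.
    by have [] := pair_cint (solid_meas hY YF) (aeW _ bnd) hH.
  rewrite (@cintegral_ae _ _ _ _ _ (fun x => F x * Num.conj (V h x) -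
    kernel_act mu K F x * Num.conj (V h x))); last first.
    by apply: aeW => x; rewrite !fctE mulrBl.
  have iK := act_pair_cint YF hH; rewrite (cintegralB iF iK).
  apply/eqP; rewrite subr_eq0; apply/eqP; symmetry; exact: (pair_act YF hH).
Qed.

(** * The coorbit space *)

Local Notation EV := (extended_voice psi).

Lemma EV_lin a (f g : H -> R[i]^o) : EV (a *: f + g) = a *: EV f + EV g.
Proof. by []. Qed.

Lemma Co_in phi : BB phi -> Y (EV phi).
Proof. by case. Qed.

Lemma rho_ae F G : {ae mu, forall x, F x = G x} -> rho F = rho G.
Proof.
move=> FG; have E : kernel_act mu K F = kernel_act mu K G.
  apply/funext => x; apply: cintegral_ae; apply: filterS FG => y ->; exact: erefl.
by rewrite /rho E.
Qed.

Lemma rho0 : rho 0 = 0.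
Proof.
apply/funext => g; have [gH|gH] := pselect (HH g); last by rewrite rho_out.
rewrite rho_in// /pair (@cintegral_ae _ _ _ _ _ (fun=> 0)) ?cintegral0 ?mulr0//.
apply: aeW => x; rewrite /kernel_act (@cintegral_ae _ _ _ _ _ (fun=> 0)) ?cintegral0 ?mul0r//.
by apply: aeW => y; rewrite mulr0.
Qed.

Lemma rhoB F G : Y F -> Y G -> rho (F - G) = rho F - rho G.
Proof.
by move=> YF YG; rewrite addrC -scaleN1r (rho_lin)// scaleN1r addrC.
Qed.

Lemma Co_reproduce phi : BB phi -> kernel_act mu K (EV phi) = EV phi.
Proof.
by move=> Bphi; rewrite -(rho_voice (Co_in Bphi)) (rho_extended_voice Bphi).
Qed.

(** A limit of transforms in Y need not be a transform; its image under rho is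
the limit in the coorbit space. *)
Lemma Co_banach : banach BB NB.
Proof.
have K0 := kernel_ge0.
split.
- split; last exact: (solid0 hY).
  split => // [a g h _ _|]; first by rewrite mulr0 addr0.
  by exists 0 => g _; rewrite rnorm0 mul0r.
- move=> a f g [[fo fl [cf fb]] Yf] [[go gl [cg gb]] Yg].
  split; last by rewrite EV_lin; exact: (banach_lin (solid_banach hY)).
  split=> [h hH|b h k hH kH|].
  + by rewrite !fctE fo// go// scaler0 addr0.
  + by rewrite !fctE fl// gl// /GRing.scale/=; ring.
  + exists (rnorm a * cf + cg) => h hH; rewrite !fctE.
    apply: le_trans (rnormD _ _) _; rewrite mulrDl; apply: lerD; last exact: gb.
    by rewrite rnormM -mulrA ler_wpM2l ?rnorm_ge0//; exact: fb.
- by move=> f [_ Yf]; exact: (solid_ge0 hY Yf).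
- move=> f Bf; split=> [N0|->]; last first.
    by apply: (solid_null hY); exact: aeW.
  have /rho_ae := solid_eq0 hY (Co_in Bf) N0.
  by rewrite (rho_extended_voice Bf) => ->; exact: rho0.
- by move=> a f [_ Yf]; rewrite /Co_norm -(solidZ hY a Yf).2.
- by move=> f g [_ Yf] [_ Yg]; rewrite /Co_norm; exact: (solidD hY Yf Yg).2.
- move=> u uB ucauchy.
  have [F YF Fcv] := banach_complete (solid_banach hY) (fun n => Co_in (uB n)) ucauchy.
  have [BF _] := rho_Co YF; exists (rho F) => //.
  apply: (@squeeze_cvgr _ _ _ _ (fun=> 0) (fun n => nK * NY (EV (u n) - F))).
  + apply: nearW => n; have Yn := Co_in (uB n); have [YnF _] := solidB hY Yn YF.
    have [Bn Nn] := rho_Co YnF.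
    have E : u n - rho F = rho (EV (u n) - F).
      apply: etrans (esym (rhoB Yn YF)); congr (_ - _).
      exact/esym/(rho_extended_voice (uB n)).
    by rewrite E Nn andbT; exact: (solid_ge0 hY (Co_in Bn)).
  + exact: cvg_cst.
  + by rewrite -[X in _ --> X](mulr0 nK); exact: cvgMr.
Qed.

Lemma Co_point : exists2 c, 0 <= c & forall p phi, BB phi ->
  rnorm (EV phi p : R[i]) <= c * v p * NB phi.
Proof.
have [c c0 ab] := act_bound; exists c => // p phi Bphi.
by rewrite -{1}(Co_reproduce Bphi); exact: (ab _ _ (Co_in Bphi)).
Qed.

(** The distance to the identity of the two operators below. *)
Definition factor := eta * nK.
Local Notation q := factor.

Lemma factor_ge0 : 0 <= q.
Proof. by rewrite mulr_ge0 ?(eta_ge0) ?(kernel_ge0). Qed.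

Lemma factor_lt1 : q < 1.
Proof.
have := smp_small P; rewrite -mulrA -/q => h; have := factor_ge0; lra.
Qed.

Lemma sampled_kbound : kbound mu m (sampled_kernel K xs ind gam) (nK + eta).
Proof.
have := kboundB hm (set_kernel S) (smp_defect P).
by congr kbound; apply/funext => x; apply/funext => y; rewrite /kernel_defect subKr.
Qed.

(** This operator is a series of sampled frame vectors, by [synthesis]. *)
Definition sampled_op phi := rho (kernel_act mu (sampled_kernel K xs ind gam) (EV phi)).

Lemma sampled_act phi : BB phi -> Y (kernel_act mu (sampled_kernel K xs ind gam) (EV phi)).
Proof. by move=> /Co_in Yp; exact: (kbound_act hY hm hact sampled_kbound Yp).1. Qed.

Lemma sampled_op_Co phi : BB phi -> BB (sampled_op phi).
Proof. by move=> Bphi; exact: (rho_Co (sampled_act Bphi)).1. Qed.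

Lemma sampled_op_lin (a : R[i]) f g : BB f -> BB g ->
  sampled_op (a *: f + g) = a *: sampled_op f + sampled_op g.
Proof.
move=> Bf Bg; have Yf := Co_in Bf; have Yg := Co_in Bg.
apply: etrans (rho_lin a (sampled_act Bf) (sampled_act Bg)).
apply: rho_ae.
apply: filterS2 (kbound_cint hY hm hact sampled_kbound Yf)
  (kbound_cint hY hm hact sampled_kbound Yg) => x fx gx.
rewrite EV_lin !fctE /kernel_act.
apply: etrans (congr1 (fun z : R[i] => z + _) (cintegralZ a fx)).
apply: etrans (cintegralD (cintegrableZ a fx) gx).
by apply: cintegral_ae; apply: aeW => y; rewrite mulrDr mulrCA.
Qed.

Lemma sampled_op_near phi : BB phi -> NB (phi - sampled_op phi) <= q * NB phi.
Proof.
move=> Bphi; have Yp := Co_in Bphi; have Ys := sampled_act Bphi.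
have [Yd Nd] := kbound_act hY hm hact (smp_defect P) Yp.
have E : phi - sampled_op phi = rho (kernel_act mu Kd (EV phi)).
  apply: (@etrans _ _ (rho (EV phi - kernel_act mu (sampled_kernel K xs ind gam) (EV phi)))).
    apply: etrans (esym (rhoB Yp Ys)); congr (_ - _).
    exact/esym/(rho_extended_voice Bphi).
  apply: rho_ae.
  apply: filterS (kbound_cint hY hm hact sampled_kbound Yp) => x sx.
  rewrite -{1}(Co_reproduce Bphi) !fctE /kernel_act -cintegralB//; last first.
    exact: (act_cint).
  by apply: cintegral_ae; apply: aeW => y; rewrite -mulrBl.
rewrite E; apply: le_trans (rho_Co Yd).2 _.
rewrite /q [eta * nK]mulrC -mulrA.
by apply: ler_wpM2l => //; exact: (kernel_ge0).
Qed.

Definition sample_fun (c : I -> R[i]^o) : X -> R[i]^o := fun y => Num.conj (gam y) * c (ind y).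

(** By the reproducing formula, the transform and its samples are integrals
against rows of K; the adjoint of the defect compares these rows. *)
Lemma sample_defect phi : BB phi ->
  EV phi - sample_fun (fun i => EV phi (xs i)) =
  kernel_act mu (fun x y => Num.conj (Kd y x)) (EV phi).
Proof.
move=> Bphi; have Yp := Co_in Bphi; apply/funext => y.
have iE p := act_cint p Yp; have RE := Co_reproduce Bphi.
rewrite !fctE /sample_fun -{1 2}RE /kernel_act.
rewrite -cintegralZ// -cintegralB//; last exact: cintegrableZ.
apply: cintegral_ae; apply: aeW => z.
rewrite /kernel_defect /sampled_kernel conjB conjM -!frame_kernel_conj; ring.
Qed.

Lemma sample_fun_solid phi : BB phi -> Y (sample_fun (fun i => EV phi (xs i))) /\
  NY (EV phi - sample_fun (fun i => EV phi (xs i))) <= eta * NB phi.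
Proof.
move=> Bphi; have Yp := Co_in Bphi.
have [Yd Nd] := kbound_act hY hm hact (kbound_adj hm (smp_defect P)) Yp.
rewrite sample_defect//; split => //.
have -> : sample_fun (fun i => EV phi (xs i)) =
    EV phi - (EV phi - sample_fun (fun i => EV phi (xs i))) by rewrite subKr.
by rewrite sample_defect//; exact: (solidB hY Yp Yd).1.
Qed.

(** This operator depends on the samples of the transform only. *)
Definition evaluated_op phi := rho (sample_fun (fun i => EV phi (xs i))).

Lemma evaluated_op_Co phi : BB phi -> BB (evaluated_op phi).
Proof. by move=> Bphi; exact: (rho_Co (sample_fun_solid Bphi).1).1. Qed.

Lemma evaluated_op_lin (a : R[i]) f g : BB f -> BB g ->
  evaluated_op (a *: f + g) = a *: evaluated_op f + evaluated_op g.
Proof.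
move=> Bf Bg.
apply: etrans (rho_lin a (sample_fun_solid Bf).1 (sample_fun_solid Bg).1).
congr rho; apply/funext => y; rewrite EV_lin !fctE /sample_fun /GRing.scale/=.
by rewrite mulrDr mulrCA.
Qed.

Lemma evaluated_op_near phi : BB phi -> NB (phi - evaluated_op phi) <= q * NB phi.
Proof.
move=> Bphi; have Yp := Co_in Bphi; have [Ys Ns] := sample_fun_solid Bphi.
rewrite -{1}(rho_extended_voice Bphi) -rhoB//.
apply: le_trans (rho_Co (solidB hY Yp Ys).1).2 _.
rewrite /q [eta * nK]mulrC -mulrA.
by apply: ler_wpM2l => //; exact: (kernel_ge0).
Qed.

(** * The Banach frame *)

Section frame_sequences.
(** By [Co_point], the values of a transform grow at most like v. *)
Definition frame_weight i := (v (xs i))^-1.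
Local Notation t := frame_weight.
Local Notation sfun := sample_fun.
Local Notation st := (step ind (fun=> 1)).
Local Notation SS := (step_space ind (fun=> 1) t set0).
Local Notation NS := (step_norm ind (fun=> 1) t).

Lemma frame_weight_gt0 i : 0 < t i.
Proof. by rewrite invr_gt0 (v_gt0). Qed.

Lemma sample_fun_meas c : ae_measurable mu (sfun c : X -> R[i]).
Proof.
apply: ae_measurableW; apply: cmeasurableM; first exact: cmeasurable_conj (smp_phase_meas P).
apply: (ind_glue (smp_meas P) (F := fun i _ => c i)) => i; exact: cmeasurable_cst.
Qed.

Lemma rnorm_sample_fun c x : rnorm (sfun c x : R[i]) = rnorm (st c x : R[i]).
Proof.
by rewrite /sample_fun /step !rnormM rnorm_conj (smp_phase P) rnorm1.
Qed.

Lemma step_sample c : Y (st c) -> Y (sfun c) /\ NY (sfun c) <= NY (st c).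
Proof.
move=> Yc; apply: (solid_le hY (sample_fun_meas c) Yc).
by apply: aeW => x; rewrite rnorm_sample_fun.
Qed.

Lemma sample_step c : Y (sfun c) -> Y (st c) /\ NY (st c) <= NY (sfun c).
Proof.
move=> Yc; apply: (solid_le hY (step_meas (smp_meas P) (fun=> 1) c) Yc).
by apply: aeW => x; rewrite rnorm_sample_fun.
Qed.

Lemma rho_step c : SS c -> BB (rho (sfun c)) /\ NB (rho (sfun c)) <= nK * NS c.
Proof.
move=> [_ Yc bc]; have [Ys Ns] := step_sample Yc; have [Br Nr] := rho_Co Ys.
split => //; apply: le_trans Nr _; apply: ler_wpM2l; first exact: (kernel_ge0).
apply: le_trans Ns _; rewrite lerDl.
exact: (wsup_ge0 (ind z0) frame_weight_gt0 bc).
Qed.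

Lemma samples_step : exists2 c, 0 <= c & forall phi, BB phi ->
  SS (fun i => EV phi (xs i)) /\ NS (fun i => EV phi (xs i)) <= c * NB phi.
Proof.
have [c c0 pt] := Co_point; exists (1 + eta + c).
  by rewrite !addr_ge0// (eta_ge0).
move=> phi Bphi; have [Ys Ns] := sample_fun_solid Bphi; have Yp := Co_in Bphi.
have [Yst Nst] := sample_step Ys.
have le i : t i * rnorm (EV phi (xs i) : R[i]) <= c * NB phi.
  by rewrite ler_pdivrMl ?(v_gt0)// mulrA [v _ * c]mulrC; exact: pt.
split; first by split => //; exists (c * NB phi).
rewrite mulrDl; apply: lerD; last exact: (wsup_le (ind z0)).
apply: le_trans Nst _; rewrite -[sfun _](subKr (EV phi)).
have YB := (solidB hY Yp Ys).1.
apply: le_trans (solidB hY Yp YB).2 _.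
by rewrite mulrDl mul1r lerD2l.
Qed.

Lemma samples_banach_frame : banach_frame BB NB (fun i phi => EV phi (xs i)).
Proof.
have hB := Co_banach.
have [J [JB Jlin TJ JT JN]] := near_identity_inverse hB (evaluated_op_Co)
  (evaluated_op_lin) (factor_ge0) (factor_lt1) (evaluated_op_near).
have q1 := factor_lt1; have K0 := kernel_ge0.
have [c c0 smp] := samples_step.
pose cJ := (1 - q)^-1 * (nK + 1).
have cJ0 : 0 < cJ by rewrite mulr_gt0 ?invr_gt0 ?subr_gt0 ?ltr_wpDl.
have JNS a : SS a -> NB (J (rho (sfun a))) <= cJ * NS a.
  move=> Sa; have [Br Nr] := rho_step Sa; apply: le_trans (JN _ Br) _.
  rewrite -mulrA; apply: ler_wpM2l; first by rewrite invr_ge0 subr_ge0 ltW.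
  apply: le_trans Nr _; apply: ler_wpM2r; last by rewrite lerDl.
  exact: (step_norm_ge0 frame_weight_gt0 Sa).
split => //.
- move=> i; split=> [a f g _ _|]; first by [].
  have [cp cp0 pt] := Co_point; exists (cp * v (xs i)) => phi Bphi; exact: pt.
exists SS, NS, (fun a => J (rho (sfun a))), cJ^-1, (c + cJ^-1).
split.
- split; first exact: (step_BK (smp_in P) (smp_meas P) _ _ frame_weight_gt0).
  by rewrite invr_gt0 cJ0 lerDr.
- split; first by move=> a /rho_step[Ba _]; exact: JB.
  split; last by exists cJ.
  move=> a u w Su Sw; have [Yu _] := step_sample (let: And3 _ h _ := Su in h).
  have [Yw _] := step_sample (let: And3 _ h _ := Sw in h).
  have -> : sfun (a *: u + w) = a *: sfun u + sfun w.
    apply/funext => y; rewrite /sample_fun !fctE /GRing.scale/=.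
    by rewrite mulrDr mulrCA.
  rewrite (rho_lin a Yu Yw); apply: Jlin; [exact: (rho_step Su).1|exact: (rho_step Sw).1].
- by move=> f Bf; exact: (smp f Bf).1.
- move=> f Bf; have [Sf Nf] := smp f Bf; apply/andP; split.
    rewrite ler_pdivrMl//; apply: le_trans (JNS _ Sf).
    by rewrite -[rho _]/(evaluated_op f) JT.
  apply: le_trans Nf _; rewrite ler_wpM2r ?(banach_ge0 hB)// lerDl invr_ge0 ltW//.
- by move=> f Bf; exact: esym (JT f Bf).
Qed.

End frame_sequences.

(** * The atomic decomposition *)

Section atom_sequences.
Local Notation K' := (sampled_kernel K xs ind gam).
Local Notation atom := (fun i => embed mu ip psi v (psi (xs i))).

Lemma ip_psi_voice p g : ip (psi p) g = Num.conj (V g p).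
Proof. exact: ipC. Qed.

(** By the reproducing formula, pairing with the column of K at p evaluates the
transform at p. *)
Lemma embed_psi p : embed mu ip psi v (psi p) = rho (A%:C *: (fun x => K x p : R[i]^o)).
Proof.
have Yp := kernel_column_solid p; have YAp := (solidZ hY A%:C Yp).1.
have A0 : A%:C != 0 :> R[i] by rewrite -[0]/((0 : R)%:C) (inj_eq (@complexI R)) gt_eqF ?(frame_gt0 hfr).
apply/funext => g; have [gH|gH] := pselect (HH g); last first.
  by rewrite rho_out// /embed /patch memNset.
rewrite rho_in// (pair_act YAp gH) /embed /patch mem_set// ip_psi_voice.
have [iK KE] := voice_repr hip hfr g p.
rewrite -{1}KE /pair /kernel_act -cintegral_conj//.
have E x : (A%:C *: (fun x => K x p : R[i]^o)) x * Num.conj (V g x) =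
    A%:C * Num.conj (K p x * V g x).
  rewrite !fctE /GRing.scale/= conjM -mulrA; congr (_ * (_ * _)).
  exact: frame_kernel_conj.
rewrite (cintegral_ae (aeW _ E)) (cintegralZ _ (cintegrable_conj iK)).
by rewrite mulrA -rmorphM mulVf ?mul1r// gt_eqF ?(frame_gt0 hfr).
Qed.

Lemma embed_psi_Co p : BB (embed mu ip psi v (psi p)).
Proof.
by rewrite embed_psi; exact: (rho_Co (solidZ hY A%:C (kernel_column_solid p)).1).1.
Qed.

Lemma embed_in h g : HH g -> embed mu ip psi v h g = ip h g.
Proof. by move=> gH; rewrite /embed /patch mem_set. Qed.

Lemma embed_psi_voice p x : EV (embed mu ip psi v (psi p)) x = A%:C * K x p.
Proof.
have xH := (H1_psi x).1; rewrite /extended_voice embed_in//.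
exact: (voice_psi p x).
Qed.

Lemma Co_sum (J : Type) (r : seq J) (b : J -> R[i]) (f : J -> H -> R[i]^o) :
  (forall j, BB (f j)) -> BB (\sum_(j <- r) b j *: f j).
Proof.
move=> fB; have hB := Co_banach; elim: r => [|j r IH].
  by rewrite big_nil; exact: (banach0 hB).
by rewrite big_cons; exact: (banach_lin hB).
Qed.

Lemma sum_app (T J : Type) (r : seq J) (b : J -> R[i]) (f : J -> T -> R[i]^o) x :
  (\sum_(j <- r) b j *: f j) x = \sum_(j <- r) b j * f j x.
Proof. by elim/big_rec2 : _ => // j u w _ <-. Qed.

Lemma Co_dual_bound : exists2 c, 0 <= c & forall phi g, BB phi -> HH g ->
  rnorm (phi g : R[i]) <= c * NB phi * NH g.
Proof.
have [c c0 ab] := act_bound; have A0 := ltW (frame_inv_gt0).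
exists (A^-1 * c) => [|phi g Bphi gH]; first exact: mulr_ge0.
have Yp := Co_in Bphi.
rewrite -{1}(rho_extended_voice Bphi) rho_in// rnorm_realM// -!mulrA.
apply: ler_wpM2l => //; rewrite mulrA.
have bd : {ae mu, forall x, rnorm (kernel_act mu K (EV phi) x : R[i]) <= c * NB phi * v x}.
  by apply: aeW => x; rewrite mulrAC; exact: ab.
by have [] := pair_cint (solid_meas hY (act_solid Yp).1) bd gH.
Qed.

Definition cell_mass i := fine (mu [set x | ind x = i]).

Lemma cell_sub i : [set x | ind x = i] `<=` U i.
Proof. by move=> x /= <-; exact: smp_in P x. Qed.

Lemma cell_massE i : mu [set x | ind x = i] = (cell_mass i)%:E.
Proof.
rewrite fineK// ge0_fin_numE//; apply: le_lt_trans (set_fin S i).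
by apply: le_measure; rewrite ?inE; [exact: smp_meas P i|exact: set_meas S i|exact: cell_sub].
Qed.

Lemma cell_mass_ge0 i : 0 <= cell_mass i.
Proof. by rewrite fine_ge0. Qed.

Lemma coefficient_bound : exists2 c, 0 <= c & forall i G, Y G ->
  cintegrable mu (cut ind i (fun y => gam y * G y)) /\
  rnorm (cintegral mu (cut ind i (fun y => gam y * G y))) <=
    c * v (xs i) * NY G * fine (mu (U i)).
Proof.
have [c c0 mb] := mass_bound; exists c => // i G YG.
have [mfin mle] := mb i (xs i) G (set_sample S i) YG.
have le y : ((rnorm (cut ind i (fun y => gam y * G y) y : R[i]))%:E <=
    (\1_(U i) y * rnorm (G y : R[i]))%:E)%E.
  rewrite lee_fin /cut; case: eqP => [yi|_].
    by rewrite rnormM (smp_phase P) indicE mem_set//; exact: cell_sub.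
  by rewrite rnorm0 mulr_ge0 ?rnorm_ge0 ?indicE.
have g0 y : (0 <= (\1_(U i) y * rnorm (G y : R[i]))%:E)%E by exact: le_trans (rnormE_ge0 _ _) (le y).
have iG : cintegrable mu (cut ind i (fun y => gam y * G y)).
  apply: (cintegrable_le _ g0 (aeW _ le) mfin); apply: (cut_meas (smp_meas P)).
  apply: ae_measurableM (solid_meas hY YG); apply: ae_measurableW; exact: smp_phase_meas P.
split => //; apply: le_trans mle; rewrite -lee_fin fineK; last first.
  by rewrite ge0_fin_numE//; exact: mass_ge0.
apply: le_trans (le_rnorm_cintegral iG) _; apply: le_lint => y; [exact: rnormE_ge0|exact: le].
Qed.

Section synthesis.
Variables (c : I -> R[i]^o) (G : X -> R[i]^o).
Hypothesis YG : Y G.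
Hypothesis Gc : forall i, cintegral mu (cut ind i (fun y => gam y * G y)) = A%:C * c i.

Let iG i : cintegrable mu (cut ind i (fun y => gam y * G y)).
Proof. by have [k _ /(_ i G YG)[]] := coefficient_bound. Qed.

Definition masked (b : I -> R[i]) (J : {fset I}) : X -> R[i]^o :=
  fun y => if ind y \in J then b (ind y) * G y else 0.

Lemma masked_solid b J : (forall i, rnorm (b i) <= 1) -> Y (masked b J) /\ NY (masked b J) <= NY G.
Proof.
move=> b1; apply: (solid_le hY _ YG).
  apply: (@ae_measurable_ae _ _ _ _ _ (fun y => (if ind y \in J then b (ind y) else 0) * G y)).
    by apply: aeW => y; rewrite /masked; case: ifP => _; rewrite ?mul0r.
  apply: ae_measurableM (solid_meas hY YG); apply: ae_measurableW.
  apply: (ind_glue (smp_meas P) (F := fun i _ => if i \in J then b i else 0)) => i.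
  exact: cmeasurable_cst.
apply: aeW => y; rewrite /masked; case: ifP => _; last by rewrite rnorm0 rnorm_ge0.
by rewrite rnormM ler_piMl ?rnorm_ge0.
Qed.

Lemma finite_synthesis b (J : {fset I}) : EV (\sum_(i <- J) (b i * c i) *: atom i) =
  kernel_act mu K' (masked b J).
Proof.
apply/funext => x; rewrite /extended_voice sum_app.
pose F i y : R[i] := b i * K x (xs i) * (gam y * G y).
have FE i : cut ind i (F i) = fun y => b i * K x (xs i) * (cut ind i (fun y => gam y * G y) y : R[i]).
  by apply/funext => y; rewrite /cut; case: ifP => //; rewrite mulr0.
have iF i : cintegrable mu (cut ind i (F i)) by rewrite FE; exact: cintegrableZ.
have [_ E] := cintegral_cells J iF.
transitivity (\sum_(i <- J) cintegral mu (cut ind i (F i))).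
  apply: eq_bigr => i _; rewrite FE cintegralZ// Gc.
  by rewrite -[atom i (psi x)]/(EV (atom i) x) embed_psi_voice; ring.
rewrite -E; apply: cintegral_ae; apply: aeW => y; rewrite /masked /F /sampled_kernel.
by case: ifP => _; [ring|rewrite mulr0].
Qed.

Let term g i : R[i] := c i * ip (psi (xs i)) g.

(** The series converges absolutely against every vector of H1: multiplying
each term by a unimodular factor turns the sum of the absolute values into the
value of an element of the coorbit space whose norm is controlled. *)
Lemma synthesis_abs : exists2 k, 0 <= k & forall g, HH g ->
  forall J : {fset I}, \sum_(i <- J) rnorm (term g i) <= k * NH g.
Proof.
have [k k0 db] := Co_dual_bound; have K0 := kernel_ge0; have e0 := eta_ge0.
exists (k * ((nK + eta) * NY G)) => [|g gH J].
  by rewrite !mulr_ge0 ?addr_ge0 ?(solid_ge0 hY YG).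
pose b i := phase (term g i).
have b1 i : rnorm (b i) <= 1 by rewrite rnorm_phase.
have [Ym Nm] := masked_solid J b1.
have Bf : BB (\sum_(i <- J) (b i * c i) *: atom i) by apply: Co_sum => i; exact: embed_psi_Co.
have := db _ _ Bf gH; rewrite sum_app.
have -> : \sum_(i <- J) b i * c i * atom i g = (\sum_(i <- J) rnorm (term g i))%:C.
  rewrite rmorph_sum; apply: eq_bigr => i _.
  by rewrite embed_in// -mulrA; exact: phaseE.
rewrite rnorm_real ger0_norm; last by apply: sumr_ge0 => i _; exact: rnorm_ge0.
move=> /le_trans; apply; apply: ler_wpM2r; first exact: (H1_norm_ge0).
apply: ler_wpM2l => //; rewrite /Co_norm finite_synthesis.
apply: le_trans (kbound_act hY hm hact (sampled_kbound) Ym).2 _.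
by rewrite ler_wpM2l// addr_ge0.
Qed.

(** At almost every x the integral of K'(x, y) G(y) in y is the unconditional
sum of its parts over the cells, which are the terms of the series at x. *)
Lemma synthesis : exists f, [/\ BB f,
  forall g, HH g -> usum (term g) (f g : R[i]) &
  {ae mu, forall x, EV f x = kernel_act mu K' G x}].
Proof.
have [k k0 bd] := synthesis_abs.
have ex g : exists s : R[i]^o, HH g -> usum (term g) s.
  have [gH|gH] := pselect (HH g); last by exists 0.
  by have [s us] := usum_exists (bd g gH); exists s.
have [h hh] := boolp.choice ex.
pose f : H -> R[i]^o := patch (fun=> 0) HH h.
have fin g : HH g -> f g = h g by move=> gH; rewrite /f /patch mem_set.
have fS g : HH g -> usum (term g) (f g : R[i]) by move=> gH; rewrite fin//; exact: hh.
have af : antidual mu ip psi v f.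
  split.
  - by move=> g gH; rewrite /f /patch memNset.
  - move=> a g1 g2 H1 H2; have H3 := H1_lin a H1 H2.
    apply: (usum_unique (fS _ H3)).
    apply: usum_ext (usum_lin (Num.conj a) (fS _ H1) (fS _ H2)) => i.
    by rewrite /term !ip_psi_voice voiceD voiceZ conjD conjM; ring.
  - exists k => g gH; apply: (usum_bound (fS g gH)) => J.
    apply: le_trans (bd g gH J).
    by elim/big_rec2 : _ => [|i x y _ le]; [rewrite rnorm0|apply: le_trans (rnormD _ _) _; rewrite lerD2l].
have vE : {ae mu, forall x, EV f x = kernel_act mu K' G x}.
  apply: filterS (kbound_cint hY hm hact (sampled_kbound) YG) => x ix.
  apply: (usum_unique (fS _ (H1_psi x).1)).
  apply: usum_ext (cintegral_cells_usum (smp_meas P) ix) => i.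
  rewrite /term -[ip _ _]/(V (psi (xs i)) x) (voice_psi) mulrCA mulrA -Gc.
  rewrite mulrC -cintegralZ; last exact: iG.
  apply: cintegral_ae; apply: aeW => y; rewrite /cut /sampled_kernel.
  by case: eqP => [->|_]; [ring|rewrite mulr0].
exists f; split => //; split => //=.
exact: (solid_ae hY vE (kbound_act hY hm hact (sampled_kbound) YG).1).1.
Qed.

End synthesis.

(** The conditional expectation on the cells; the inverse of the mass of a null
cell is 0. *)
Definition averaging x y : R[i] :=
  if ind x == ind y then ((cell_mass (ind x))^-1)%:C else 0.

Lemma averaging_kbound : kbound mu m averaging C.
Proof.
have C0 : 0 <= C by exact: le_trans (local_ge1).
have sym x y : averaging x y = averaging y x.
  by rewrite /averaging eq_sym; case: eqP => // ->.
have row x : (\int[mu]_y (rnorm (averaging x y) * m x y)%:E <= C%:E)%E.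
  pose w := (cell_mass (ind x))^-1.
  have w0 : 0 <= w by rewrite invr_ge0 cell_mass_ge0.
  apply: (@le_trans _ _ (\int[mu]_y ((C * w)%:E * (\1_[set y | ind y = ind x] y)%:E)))%E.
    apply: le_lint => y; first exact: rnorm_weight_ge0.
    rewrite -EFinM lee_fin /averaging; case: eqP => [xy|_]; last first.
      by rewrite rnorm0 mul0r !mulr_ge0// indicE.
    rewrite rnorm_real ger0_norm// indicE mem_set//= mulr1 mulrC.
    apply: ler_wpM2r => //; apply: (set_local S (smp_in P x)).
    by rewrite xy; exact: (smp_in P).
  rewrite lintZ.
  - rewrite integral_indic ?setIT//; last exact: smp_meas P _.
    rewrite [X in (_ * X <= _)%E](_ : _ = (cell_mass (ind x))%:E); last exact: cell_massE.
    rewrite -EFinM lee_fin -mulrA ler_piMr//.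
    have [->|w1] := eqVneq (cell_mass (ind x)) 0; first by rewrite mulr0.
    by rewrite mulVf.
  - by move=> y; rewrite lee_fin indicE.
  - exact: mulr_ge0.
  - by apply: ae_emeasurableW; apply/measurable_EFinP/measurable_indic; exact: smp_meas P _.
split => //.
- apply: ae_measurableW.
  pose F i y : R[i] := ((cell_mass i)^-1)%:C * (\1_[set y | ind y = i] y : R)%:C.
  pose FF n : X -> R[i] := if choice.unpickle n is Some i then F i else fun=> 0.
  have mF i : cmeasurable (F i).
    apply: cmeasurableM; first exact: cmeasurable_cst.
    by apply: cmeasurable_real; apply: measurable_indic; exact: smp_meas P i.
  have -> : (fun p : X * X => averaging p.1 p.2) =
      (fun p => FF (choice.pickle (ind p.1)) p.2).
    apply/funext => p; rewrite /FF choice.pickleK /F /averaging indicE.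
    case: eqP => pp; first by rewrite mem_set//= mulr1.
    by rewrite memNset ?mulr0// => /= qq; apply: pp.
  have mii n : measurable [set p : X * X | choice.pickle (ind p.1) = n].
    rewrite (_ : mkset _ = fst @^-1` [set y | choice.pickle (ind y) = n])//.
    rewrite -[_ @^-1` _]setTI; apply: measurable_fst => //.
    exact: levels_pickle (smp_meas P) n.
  apply: (@cmeasurable_glue _ _ _ _ (fun n p => FF n p.2) mii) => n.
  have mFF : cmeasurable (FF n).
    by rewrite /FF; case: choice.unpickle => // ; exact: cmeasurable_cst.
  by split; [exact: (measurableT_comp mFF.1)|exact: (measurableT_comp mFF.2)].
- by apply: aeW => x; exact: row.
- apply: aeW => y; have := row y; congr (_ <= _)%E; apply: eq_integral => x _.
  by rewrite sym (weight_sym hm).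
Qed.

Definition atom_scale i := (cell_mass i)^-1.
Definition atom_weight i := (fine (mu (U i)) * v (xs i))^-1.
(** The step function does not determine the coefficients over null cells. *)
Definition null_cell : set I := [set i | cell_mass i = 0].

Local Notation st := (step ind atom_scale).
Local Notation SS := (step_space ind atom_scale atom_weight null_cell).
Local Notation NS := (step_norm ind atom_scale atom_weight).

Lemma atom_weight_gt0 i : 0 < atom_weight i.
Proof. by rewrite invr_gt0 mulr_gt0 ?(cell_fine_gt0)// (v_gt0). Qed.

Definition cell_coefficient i (G : X -> R[i]^o) : R[i]^o :=
  (A^-1)%:C * cintegral mu (cut ind i (fun y => gam y * G y)).

Lemma phased_solid G : Y G -> Y (fun y => gam y * G y : R[i]^o) /\
  NY (fun y => gam y * G y : R[i]^o) <= NY G.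
Proof.
move=> YG; apply: (solid_le hY _ YG).
  apply: ae_measurableM (solid_meas hY YG); apply: ae_measurableW; exact: smp_phase_meas P.
by apply: aeW => y; rewrite rnormM (smp_phase P) mul1r.
Qed.

(** The step function of the coefficients is an average over the cells. *)
Lemma cell_coefficient_step : exists2 k, 0 <= k & forall G, Y G ->
  SS (fun i => cell_coefficient i G) /\ NS (fun i => cell_coefficient i G) <= k * NY G.
Proof.
have [c c0 cb] := coefficient_bound; have A0 := ltW (frame_inv_gt0).
have C0 : 0 <= C by exact: le_trans (local_ge1).
exists (A^-1 * C + A^-1 * c) => [|G YG]; first by rewrite addr_ge0// mulr_ge0.
have [Yp Np] := phased_solid YG.
have [Ya Na] := kbound_act hY hm hact averaging_kbound Yp.
have [Yz Nz] := solidZ hY (A^-1)%:C Ya.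
have sE : st (fun i => cell_coefficient i G) =
    (A^-1)%:C *: kernel_act mu averaging (fun y => gam y * G y).
  apply/funext => x; rewrite /step /cell_coefficient !fctE /GRing.scale/= mulrCA; congr (_ * _).
  rewrite -cintegralZ; last exact: (cb _ _ YG).1.
  apply: cintegral_ae; apply: aeW => y; rewrite /cut /averaging eq_sym.
  by case: eqP => _; rewrite ?mulr0 ?mul0r.
have le i : atom_weight i * rnorm (cell_coefficient i G) <= A^-1 * c * NY G.
  rewrite ler_pdivrMl ?mulr_gt0 ?(cell_fine_gt0) ?(v_gt0)//.
  rewrite /cell_coefficient rnorm_realM//.
  rewrite [leRHS](_ : _ = A^-1 * (c * v (xs i) * NY G * fine (mu (U i)))); last by ring.
  by rewrite ler_wpM2l//; exact: (cb _ _ YG).2.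
split.
  split; [|by rewrite sE|by exists (A^-1 * c * NY G)].
  move=> i; rewrite /null_cell/= => Zi; rewrite /cell_coefficient.
  rewrite (@cintegral_ae _ _ _ _ _ (fun=> 0)) ?cintegral0 ?mulr0//.
  exists [set x | ind x = i]; split; [exact: smp_meas P i|exact: etrans (cell_massE i) (congr1 EFin Zi)|].
  by move=> x /= h; apply: contrapT => xi; apply: h; rewrite /cut; case: eqP.
rewrite mulrDl; apply: lerD; last exact: (wsup_le (ind z0)).
rewrite sE Nz rnorm_real ger0_norm// -mulrA ler_wpM2l//.
by apply: le_trans Na _; rewrite ler_wpM2l.
Qed.

Lemma cintegral_cut_const i (a : R[i]) :
  cintegral mu (cut ind i (fun=> a)) = a * (cell_mass i)%:C.
Proof.
pose V1 y : R[i] := (\1_[set x | ind x = i] y : R)%:C.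
have mi : measurable [set x | ind x = i] := smp_meas P i.
have iV : cintegrable mu V1.
  split; first by apply: ae_measurableW; apply: cmeasurable_real; exact: measurable_indic.
  under eq_integral do rewrite rnorm_real ger0_norm ?indicE//.
  under eq_integral do rewrite -indicE.
  rewrite integral_indic// setIT; apply: (@le_lt_trans _ _ (cell_mass i)%:E); last exact: ltry.
  by have := cell_massE i => /= ->.
have E y : cut ind i (fun=> a) y = a * V1 y.
  rewrite /cut /V1 indicE; case: eqP => yi; first by rewrite mem_set//= mulr1.
  by rewrite memNset ?mulr0.
rewrite (cintegral_ae (aeW _ E)) cintegralZ//; congr (_ * _).
rewrite /cintegral/= /Rintegral integral0/=; congr (_ +i* _).
by rewrite integral_indic// setIT.
Qed.

Lemma step_synthesis c : SS c -> exists f, [/\ BB f,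
  forall g, HH g -> usum (fun i => c i * ip (psi (xs i)) g) (f g : R[i]) &
  NB f <= A * (nK + eta) * NS c].
Proof.
move=> [zc Yc bc]; have A0 := ltW (frame_gt0 hfr).
pose G y : R[i]^o := A%:C * (Num.conj (gam y) * st c y).
have mG : ae_measurable mu G.
  apply: ae_measurableZ; apply: ae_measurableM.
    by apply: ae_measurable_conj; apply: ae_measurableW; exact: smp_phase_meas P.
  exact: (step_meas (smp_meas P)).
have [YG NG] : Y G /\ NY G <= A * NY (st c).
  apply: (solid_dom hY mG Yc A0); apply: aeW => y.
  by rewrite /G rnorm_realM// rnormM rnorm_conj (smp_phase P) mul1r.
have gg y : gam y * Num.conj (gam y) = 1.
  have : `|gam y| ^+ 2 = 1 by rewrite normC_rnorm (smp_phase P) expr1n.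
  by rewrite normCK.
have Gc i : cintegral mu (cut ind i (fun y => gam y * G y)) = A%:C * c i.
  have -> : cut ind i (fun y => gam y * G y) = cut ind i (fun=> A%:C * ((atom_scale i)%:C * c i)).
    apply/funext => y; rewrite /cut; case: eqP => // yi; rewrite /G /step yi.
    by rewrite mulrCA [gam y * _]mulrA gg mul1r.
  rewrite cintegral_cut_const; have [i0|i0] := eqVneq (cell_mass i) 0.
    by rewrite zc// !mulr0 mul0r.
  have e : (atom_scale i)%:C * (cell_mass i)%:C = 1 :> R[i].
    by rewrite -rmorphM /atom_scale mulVf.
  transitivity (A%:C * c i * ((atom_scale i)%:C * (cell_mass i)%:C)); first by ring.
  by rewrite e mulr1.
have [f [Bf fS fE]] := synthesis YG Gc; exists f; split => //.
have [Ya Na] := kbound_act hY hm hact (sampled_kbound) YG.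
rewrite /Co_norm (solid_ae hY fE Ya).2; apply: le_trans Na _.
have n0 : 0 <= nK + eta by rewrite addr_ge0 ?(kernel_ge0) ?(eta_ge0).
rewrite [A * _]mulrC -mulrA ler_wpM2l//; apply: le_trans NG _; rewrite ler_wpM2l//.
by rewrite lerDl; exact: (wsup_ge0 (ind z0) atom_weight_gt0 bc).
Qed.

Lemma usum_weak (c : I -> R[i]^o) (f : H -> R[i]^o) :
  (forall g, HH g -> usum (fun i => c i * ip (psi (xs i)) g) (f g : R[i])) ->
  weak_unconditional_sum (weak_star mu ip psi v) c atom f.
Proof.
move=> fS l [g gH <-]; apply: cvg_trans (usum_cvg (fS g gH)).
suff -> : (fun J : {fset I} => (\sum_(i <- J) c i *: atom i) g : R[i]^o) =
    (fun J : {fset I} => (\sum_(i <- J) c i * ip (psi (xs i)) g : R[i]) : R[i]^o) by [].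
apply/funext => J; rewrite sum_app; apply: eq_bigr => i _; by rewrite embed_in.
Qed.

Lemma samples_atomic_decomposition :
  atomic_decomposition BB NB (weak_star mu ip psi v) atom.
Proof.
have hB := Co_banach.
have [J [JB Jlin TJ JT JN]] := near_identity_inverse hB (sampled_op_Co)
  (sampled_op_lin) (factor_ge0) (factor_lt1) (sampled_op_near).
have q1 := factor_lt1; have K0 := kernel_ge0; have e0 := eta_ge0.
have A0 := frame_gt0 hfr; have iq : 0 < (1 - q)^-1 by rewrite invr_gt0 subr_gt0.
have [k k0 ck] := cell_coefficient_step.
have [c c0 cb] := coefficient_bound.
pose lam i phi : R[i]^o := cell_coefficient i (EV (J phi)).
have JY f : BB f -> Y (EV (J f)) by move=> Bf; exact: Co_in (JB _ Bf).
have lamN phi : BB phi -> SS (fun i => lam i phi) /\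
    NS (fun i => lam i phi) <= (k * (1 - q)^-1 + 1) * NB phi.
  move=> Bphi; have [Sl Nl] := ck _ (JY _ Bphi); split => //.
  apply: le_trans Nl _; rewrite mulrDl mul1r -mulrA; apply: ler_wpDr.
    exact: (banach_ge0 hB).
  by rewrite ler_wpM2l//; exact: JN.
split => //.
- move=> f g [[fo _ _] _] [[go _ _] _] fg; apply/funext => h.
  have [hH|hH] := pselect (HH h); last by rewrite fo// go.
  by have := fg (fun phi => phi h); apply; exists h.
- by move=> i; exact: embed_psi_Co.
exists SS, NS, lam, (k * (1 - q)^-1 + 1), (A * (nK + eta) + 1); split.
- split; first exact: (step_BK (smp_in P) (smp_meas P) _ _ atom_weight_gt0).
  by split; rewrite ltr_wpDl// ?mulr_ge0 ?addr_ge0// ltW.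
- move=> i; split.
    move=> a f g Bf Bg; rewrite /lam Jlin// EV_lin /cell_coefficient.
    have [i1 _] := cb i _ (JY _ Bf); have [i2 _] := cb i _ (JY _ Bg).
    rewrite (@cintegral_ae _ _ _ _ _ (fun y => a * (cut ind i (fun y => gam y * EV (J f) y) y : R[i]) +
      (cut ind i (fun y => gam y * EV (J g) y) y : R[i]))); last first.
      apply: aeW => y; rewrite /cut !fctE /GRing.scale/=; case: eqP => _; last by rewrite mulr0 addr0.
      by rewrite mulrDr mulrCA.
    by rewrite cintegralD ?cintegralZ//; [rewrite mulrDr mulrCA|exact: cintegrableZ].
  exists ((k * (1 - q)^-1 + 1) / atom_weight i) => phi Bphi.
  have [Sl Nl] := lamN _ Bphi.
  have := step_norm_coord i Sl => /le_trans/(_ Nl).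
  by rewrite mulrAC ler_pdivlMr ?atom_weight_gt0// mulrC.
- exact: lamN.
- move=> a Sa; have [f [Bf fS Nf]] := step_synthesis Sa; exists f; split => //.
    exact: usum_weak.
  apply: le_trans Nf _; rewrite ler_wpM2r ?lerDl//.
  exact: (step_norm_ge0 atom_weight_gt0 Sa).
- move=> phi Bphi; apply: usum_weak.
  have Gc i : cintegral mu (cut ind i (fun y => gam y * EV (J phi) y)) = A%:C * lam i phi.
    rewrite /lam /cell_coefficient mulrA -rmorphM divff ?mul1r//.
    by rewrite gt_eqF.
  have [f [Bf fS fE]] := synthesis (JY _ Bphi) Gc.
  suff E : f = phi by have := fS; rewrite E.
  apply: etrans (TJ _ Bphi); apply: etrans (esym (rho_extended_voice Bf)) _.
  exact: rho_ae.
Qed.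

End atom_sequences.

End setting.

(** * The hypotheses on the frame and the covering *)

Section covering_sets.
Context d (X : borelTopologicalType d) (R : realType).
Variable mu : {sigma_finite_measure set X -> \bar R}.

Lemma closed_measurable (Q : set X) : closed Q -> measurable Q.
Proof.
move=> cQ; rewrite -[Q]setCK; apply: measurableC.
rewrite borel_measurableE; apply: sub_sigma_algebra; exact: closed_openC.
Qed.

Variables (I : countType) (U : I -> set X).
Hypothesis hU : admissible_covering U.

Lemma covering_fin i : radon mu -> (mu (U i) < +oo)%E.
Proof.
move=> rmu; have cU : compact (closure (U i)).
  by rewrite -precompactE; exact: covering_precompact hU i.
apply: le_lt_trans (radon_compact rmu cU).
apply: le_measure; rewrite ?inE; [exact: covering_measurable hU i| |exact: subset_closure].
by apply: closed_measurable; exact: closed_closure.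
Qed.

Lemma covering_finite i : finite_set [set j | U i `&` U j !=set0].
Proof.
have [N le] := covering_overlap hU; exact: card_le_finite (le i) (finite_II N).
Qed.

Lemma nbhd_bounded (f : X -> R[i]^o) y : continuous f ->
  exists M : R, forall z, nbhd U y z -> rnorm (f z : R[i]) <= M.
Proof.
move=> cf; have [i _ Ui] : (\bigcup_i U i) y by rewrite (covering_total hU).
have /finite_seqP[s sE] := covering_finite i.
have cs : compact (\big[setU/set0]_(j <- s) closure (U j)).
  apply: bigsetU_compact => j _.
  by rewrite -precompactE; exact: covering_precompact hU j.
have cg : continuous (fun z => rnorm (f z : R[i])).
  apply: (continuous_contraction cf) => z w; rewrite ler_norml; apply/andP; split.
    by have := rnormD (w - z : R[i]) z; rewrite subrK rnormBC; lra.
  by have := rnormD (z - w : R[i]) w; rewrite subrK; lra.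
have cfs := continuous_compact (continuous_subspaceT cg) cs.
have [M [Mr hM]] := compact_bounded cfs.
exists (M + 1) => z [j Uj jz].
have zs : (\big[setU/set0]_(j <- s) closure (U j)) z.
  rewrite -bigcup_seq; exists j; last exact: subset_closure.
  have : [set j | U i `&` U j !=set0] j by exists y.
  by rewrite sE.
have M1 : M < M + 1 by rewrite ltrDl.
have := hM (M + 1) M1 (rnorm (f z : R[i])) (ex_intro2 _ _ z zs erefl).
exact: le_trans (ler_norm _).
Qed.

End covering_sets.

(** The maximum is at least y. *)
Lemma small_of_bound (R : realType) (x y : \bar R) (C : R) :
  x = (fine x)%:E -> y = (fine y)%:E -> 0 <= fine x -> 0 <= fine y ->
  (x * (y + maxe (C%:E * y) (y + x)) < 1)%E -> 2 * fine x * fine y < 1.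
Proof.
move=> -> ->; set a := fine _; set b := fine _ => /= a0 b0.
rewrite -[1%E]/(1%:E) -[_ < 1]lte_fin; apply: le_lt_trans.
have -> : 2 * a * b = a * (b + b) by ring.
rewrite EFinM; apply: lee_wpmul2l; first by rewrite lee_fin.
rewrite EFinD leeD2l// le_max; apply/orP; right.
by rewrite -EFinD lee_fin lerDl.
Qed.

Section setting_of_hypotheses.
Context (d : measure_display) (X : borelTopologicalType d) (R : realType).
Variable mu : {sigma_finite_measure set X -> \bar R}.
Variable H : completeNormedModType R[i].
Variables (ip : {dot H for Num.conj}) (psi : X -> H) (A : R).
Variables (m : X -> X -> R) (z0 : X).
Variables (Y : set (X -> R[i]^o)) (NY : (X -> R[i]^o) -> R).
Variables (Gamma : X -> X -> R[i]) (I : countType) (U : I -> set X) (C : R).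
Variable xs : I -> X.
Local Notation K := (frame_kernel ip psi A).
Local Notation O := (osc ip psi A U Gamma).

(** The supremum in the oscillation bounds each of its members, being taken
over a bounded set: the covering sets around a point lie in a compact set, on
which a weakly continuous family is bounded. *)
Lemma kernel_osc_le i y z x : continuous_tight_frame mu ip psi A ->
  admissible_covering U -> (forall x y, `|Gamma x y| = 1) -> U i y -> U i z ->
  rnorm (K x y - Gamma y z * K x z) <= rnorm (O x y).
Proof.
move=> hfr hU G1 Uy Uz; have A0 := frame_gt0 hfr.
have rG u w : rnorm (Gamma u w) = 1 by rewrite /rnorm G1.
have E w : ip (psi x) (psi y - Gamma y w *: psi w) =
    Num.conj (A%:C * (K x y - Gamma y w * K x w)).
  have -> : A%:C * (K x y - Gamma y w * K x w) = ip (psi y - Gamma y w *: psi w) (psi x).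
    have -> : psi y - Gamma y w *: psi w = psi y + (- Gamma y w) *: psi w by rewrite scaleNr.
    rewrite ipDl ipZl mulNr /frame_kernel.
    have AA : A%:C * (A^-1)%:C = 1 :> R[i] by rewrite -rmorphM divff// gt_eqF.
    transitivity (A%:C * (A^-1)%:C * (ip (psi y) (psi x) - Gamma y w * ip (psi w) (psi x))).
      by ring.
    by rewrite AA mul1r.
  exact: ipC.
have rE w : rnorm (ip (psi x) (psi y - Gamma y w *: psi w)) =
    A * rnorm (K x y - Gamma y w * K x w).
  by rewrite E rnorm_conj rnorm_realM// ltW.
pose Q := [set rnorm (ip (psi x) (psi y - Gamma y w *: psi w)) | w in nbhd U y].
have cf : continuous (voice ip psi (psi x)).
  exact: (@frame_weakly_continuous _ _ _ _ _ _ _ _ hfr (psi x)).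
have [M hM] := nbhd_bounded hU y cf.
have bQ : has_ubound Q.
  exists (A * (rnorm (K x y) + A^-1 * M)) => _ [w wy <-]; rewrite rE.
  apply: ler_wpM2l; first exact: ltW.
  apply: le_trans (rnormB _ _) _; rewrite lerD2l rnormM rG mul1r.
  have Ai : 0 <= A^-1 by rewrite invr_ge0 ltW.
  rewrite /frame_kernel rnorm_realM// ler_wpM2l//.
  by rewrite ipC rnorm_conj; exact: hM.
have zQ : rnorm (ip (psi x) (psi y - Gamma y z *: psi z)) <= sup Q.
  by apply: ub_le_sup => //; exists z => //; exists i.
have Q0 : 0 <= sup Q by apply: le_trans zQ; exact: rnorm_ge0.
rewrite /osc rnorm_real ger0_norm; last by rewrite mulr_ge0// invr_ge0 ltW.
by rewrite -/Q ler_pdivlMl// -rE.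
Qed.

Lemma setting_of_hypotheses : radon mu -> hilbert ip ->
  continuous_tight_frame mu ip psi A -> admissible_weight m -> Am mu m K ->
  solid_space mu Y NY -> Am_acts mu m Y NY -> (forall x y, `|Gamma x y| = 1) ->
  admissible_covering U -> moderate mu U ->
  (forall i x y, U i x -> U i y -> m x y <= C) -> Am mu m O ->
  (Am_norm mu m O * (Am_norm mu m K +
     maxe (C%:E * Am_norm mu m K) (Am_norm mu m K + Am_norm mu m O)) < 1)%E ->
  (forall i, U i (xs i)) ->
  exists D, coorbit_setting mu ip psi A m Y NY U xs O C D
    (fine (Am_norm mu m K)) (fine (Am_norm mu m O)).
Proof.
move=> rmu hip hfr hm KA hY hact G1 hU [[D D0 UD] _] locC OA small Uxs.
have cov x : exists i, U i x.
  have [i _ Ui] : (\bigcup_i U i) x by rewrite (covering_total hU).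
  by exists i.
have mu0 : (0 < mu setT)%E.
  have [i _] := cov z0; apply: (@lt_le_trans _ _ (mu (U i))).
    by apply: lt_le_trans (UD i); rewrite lte_fin.
  by apply: le_measure; rewrite ?inE//; exact: covering_measurable hU i.
have [kK KE] := Am_kbound hm mu0 KA; have [kO OE] := Am_kbound hm mu0 OA.
exists D; split => //.
- move=> i y z Uy Uz; exists (Gamma y z); first by rewrite /rnorm G1.
  by move=> x; exact: (kernel_osc_le x hfr hU G1 Uy Uz).
- exact: (small_of_bound OE KE (kbound_ge0 kO) (kbound_ge0 kK) small).
- exact: covering_measurable hU.
- by move=> i; exact: covering_fin.
Qed.

End setting_of_hypotheses.

Theorem theorem3p1 (R : realType) (d : measure_display)
  (X : borelTopologicalType d) (mu : {sigma_finite_measure set X -> \bar R})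
  (H : completeNormedModType R[i]) (ip : {dot H for Num.conj})
  (psi : X -> H) (A : R) (m : X -> X -> R) (z0 : X)
  (Y : set (X -> R[i]^o)) (NY : (X -> R[i]^o) -> R)
  (Gamma : X -> X -> R[i]) (I : countType) (U : I -> set X) (C : R)
  (xs : I -> X) :
  hausdorff_space X -> locally_compact [set: X] -> sigma_compact X ->
  radon mu ->
  hilbert ip -> separable H ->
  continuous_tight_frame mu ip psi A ->
  admissible_weight m -> Am mu m (frame_kernel ip psi A) ->
  solid_space mu Y NY -> Am_acts mu m Y NY ->
  (forall F, Y F ->
     Lw mu +oo%E (fun x => (m x z0)^-1)
       (kernel_act mu (frame_kernel ip psi A) F)) ->
  (forall x y, `|Gamma x y| = 1) ->
  admissible_covering U -> moderate mu U ->
  (forall i x y, U i x -> U i y -> m x y <= C) ->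
  Am mu m (osc ip psi A U Gamma) ->
  (let nK := Am_norm mu m (frame_kernel ip psi A) in
   let nO := Am_norm mu m (osc ip psi A U Gamma) in
   (nO * (nK + maxe (C%:E * nK) (nK + nO)) < 1)%E) ->
  (forall i, U i (xs i)) ->
  let v := fun x => m x z0 in
  let B := Co mu ip psi v Y in
  let NB := Co_norm psi NY in
  banach_frame B NB (fun i phi => extended_voice psi phi (xs i)) /\
  atomic_decomposition B NB (weak_star mu ip psi v)
    (fun i => embed mu ip psi v (psi (xs i))).
Proof.
move=> _ _ _ rmu hip _ hfr hm KA hY hact _ G1 hU hmod locC OA small Uxs v B NB.
have [D S] := setting_of_hypotheses z0 rmu hip hfr hm KA hY hact G1 hU hmod locC OA small Uxs.
have [ind [gam [eta [Uind mind mgam gam1 [se ke]]]]] := discretization S.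
have P : sampling mu (frame_kernel ip psi A) m (fine (Am_norm mu m (frame_kernel ip psi A)))
    U xs ind gam eta by split.
split; first exact: (samples_banach_frame z0 S P).
exact: (samples_atomic_decomposition z0 S P).
Qed.
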